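(* Let $\Gamma_{Bor}=\langle a,b,c\mid [a,[b,c^{-1}]],\ [b,[c,a^{-1}]],\ [c,[a,b^{-1}]]\rangle$ be the fundamental group of the Borromean rings exterior. Then $B(\Gamma_{Bor})$ is reduced, and sending variables to trace functions gives an isomorphism $B(\Gamma_{Bor})\cong\mathbb C[t_a,t_b,t_c,t_{ab},t_{ac},t_{bc},t_{abc}]/I_{Bor}$ with $$I_{Bor}=I_{ns}\cap I_a^+\cap I_a^-\cap I_b^+\cap I_b^-\cap I_c^+\cap I_c^-\cap I_0,$$ an intersection of eight prime ideals. Consequently $X(\Gamma_{Bor},\mathrm{SL}_2(\mathbb C))$ has exactly eight irreducible components, $X_{ns}\cup X_a^+\cup X_a^-\cup X_b^+\cup X_b^-\cup X_c^+\cup X_c^-\cup X_0$ (the vanishing loci of these ideals), with $X_a^\pm,X_b^\pm,X_c^\pm\cong\mathbb C^3$.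
   Context: Let $p=t_at_{bc}+t_bt_{ac}+t_ct_{ab}-t_at_bt_c$ and $q=t_a^2+t_b^2+t_c^2+t_{ab}^2+t_{ac}^2+t_{bc}^2+t_{ab}t_{ac}t_{bc}-t_at_bt_{ab}-t_at_ct_{ac}-t_bt_ct_{bc}-4$. The ideals in $\mathbb C[t_a,t_b,t_c,t_{ab},t_{ac},t_{bc},t_{abc}]$ are: $I_a^\pm=(t_a\mp2,\ t_{ab}\mp t_b,\ t_{ac}\mp t_c,\ t_{abc}\mp t_{bc})$, and $I_b^\pm$, $I_c^\pm$ defined analogously by permuting the roles of $a,b,c$ (e.g. $I_b^\pm=(t_b\mp2,\ t_{ab}\mp t_a,\ t_{bc}\mp t_c,\ t_{abc}\mp t_{ac})$, $I_c^\pm=(t_c\mp2,\ t_{ac}\mp t_a,\ t_{bc}\mp t_b,\ t_{abc}\mp t_{ab})$); $I_{ns}$ is generated by $t_a^2+t_b^2+t_{ab}^2-t_at_bt_{ab}-4$, $t_a^2+t_c^2+t_{ac}^2-t_at_ct_{ac}-4$, $t_b^2+t_c^2+t_{bc}^2-t_bt_ct_{bc}-4$, $t_a p-2t_{ab}t_{ac}-4t_{bc}+2t_bt_c$, $t_b p-2t_{ab}t_{bc}-4t_{ac}+2t_at_c$, $t_c p-2t_{ac}t_{bc}-4t_{ab}+2t_at_b$, and $2t_{abc}-p$; $I_0$ is generated by $t_{abc}^2-p\,t_{abc}+q$, $t_at_{bc}-t_bt_{ac}$, $t_bt_{ac}-t_ct_{ab}$, $t_at_{abc}-t_{ab}t_{ac}$,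 $t_bt_{abc}-t_{ab}t_{bc}$, $t_ct_{abc}-t_{ac}t_{bc}$. $B(\Gamma)$ is the universal algebra of $\mathrm{SL}_2(\mathbb C)$-characters (conjugation invariants of the universal representation algebra) and $X(\Gamma,\mathrm{SL}_2(\mathbb C))$ the corresponding character scheme; $t_\gamma$ is the trace function of $\gamma$. *)

(* Defs.v *)
From HB Require Import structures.
From mathcomp Require Import all_boot all_order all_algebra.
From mathcomp Require Import mpoly.
From mathcomp Require Import complex.
From mathcomp Require Import reals.

Set Implicit Arguments.
Unset Strict Implicit.
Unset Printing Implicit Defensive.

Import Order.TTheory GRing.Theory Num.Theory.
Local Open Scope ring_scope.

(* The complex numbers: R[i] for a model R of the real numbers
   (every realType is isomorphic to the real line). *)
Notation CC R := (complex R).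

(* Polynomial rings C[t_a,t_b,t_c,t_ab,t_ac,t_bc,t_abc] (7 variables),
   C[x_{g,ij}] (12 variables: entries of the matrices of a, b, c),
   and C[y_1,y_2,y_3]. *)
Notation P7 R := {mpoly (CC R)[7]}.
Notation P12 R := {mpoly (CC R)[12]}.
Notation P3 R := {mpoly (CC R)[3]}.

Definition in_ideal (T : comNzRingType) (gs : seq T) (f : T) : Prop :=
  exists cs : seq T, f = \sum_(i < size gs) cs`_i * gs`_i.

Definition ideal_sub (T : comNzRingType) (gs hs : seq T) : Prop :=
  forall f, in_ideal gs f -> in_ideal hs f.

Definition prime_ideal (T : comNzRingType) (gs : seq T) : Prop :=
  ~ in_ideal gs 1 /\
  forall x y : T, in_ideal gs (x * y) -> in_ideal gs x \/ in_ideal gs y.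

Section Bor.
Variable R : realType.

Definition ta  : P7 R := 'X_(inord 0).
Definition tb  : P7 R := 'X_(inord 1).
Definition tc  : P7 R := 'X_(inord 2).
Definition tab : P7 R := 'X_(inord 3).
Definition tac : P7 R := 'X_(inord 4).
Definition tbc : P7 R := 'X_(inord 5).
Definition tabc : P7 R := 'X_(inord 6).

Definition pB : P7 R := ta * tbc + tb * tac + tc * tab - ta * tb * tc.
Definition qB : P7 R :=
  ta ^+ 2 + tb ^+ 2 + tc ^+ 2 + tab ^+ 2 + tac ^+ 2 + tbc ^+ 2
  + tab * tac * tbc - ta * tb * tab - ta * tc * tac - tb * tc * tbc - 4%:R.

Definition sgn (s : bool) : P7 R := if s then 1 else -1.

Definition Ia (s : bool) : seq (P7 R) :=
  [:: ta - sgn s * 2%:R; tab - sgn s * tb; tac - sgn s * tc; tabc - sgn s * tbc].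
Definition Ib (s : bool) : seq (P7 R) :=
  [:: tb - sgn s * 2%:R; tab - sgn s * ta; tbc - sgn s * tc; tabc - sgn s * tac].
Definition Ic (s : bool) : seq (P7 R) :=
  [:: tc - sgn s * 2%:R; tac - sgn s * ta; tbc - sgn s * tb; tabc - sgn s * tab].

Definition Ins : seq (P7 R) :=
  [:: ta ^+ 2 + tb ^+ 2 + tab ^+ 2 - ta * tb * tab - 4%:R;
      ta ^+ 2 + tc ^+ 2 + tac ^+ 2 - ta * tc * tac - 4%:R;
      tb ^+ 2 + tc ^+ 2 + tbc ^+ 2 - tb * tc * tbc - 4%:R;
      ta * pB - 2%:R * tab * tac - 4%:R * tbc + 2%:R * tb * tc;
      tb * pB - 2%:R * tab * tbc - 4%:R * tac + 2%:R * ta * tc;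
      tc * pB - 2%:R * tac * tbc - 4%:R * tab + 2%:R * ta * tb;
      2%:R * tabc - pB].

Definition I0 : seq (P7 R) :=
  [:: tabc ^+ 2 - pB * tabc + qB;
      ta * tbc - tb * tac;
      tb * tac - tc * tab;
      ta * tabc - tab * tac;
      tb * tabc - tab * tbc;
      tc * tabc - tac * tbc].

Definition eight : seq (seq (P7 R)) :=
  [:: Ins; Ia true; Ia false; Ib true; Ib false; Ic true; Ic false; I0].
Definition Ik (k : 'I_8) : seq (P7 R) := nth [::] eight k.

Definition in_IBor (f : P7 R) : Prop := forall k : 'I_8, in_ideal (Ik k) f.

Definition univM (o : nat) : 'M[P12 R]_2 :=
  \matrix_(i < 2, j < 2) 'X_(inord (o + 2 * i + j)%N).
Definition Ma := univM 0.
Definition Mb := univM 4.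
Definition Mc := univM 8.

(* inverse in SL_2 : the adjugate (equal to the inverse once det = 1) *)
Definition minv (T : comNzRingType) (A : 'M[T]_2) : 'M[T]_2 := \adj A.
Definition mcomm (T : comNzRingType) (A B : 'M[T]_2) : 'M[T]_2 :=
  A *m B *m minv A *m minv B.

Definition rel1 := mcomm Ma (mcomm Mb (minv Mc)).
Definition rel2 := mcomm Mb (mcomm Mc (minv Ma)).
Definition rel3 := mcomm Mc (mcomm Ma (minv Mb)).

Definition mxentries (T : comNzRingType) (A : 'M[T]_2) : seq T :=
  [:: A 0 0; A 0 1; A 1 0; A 1 1].

(* Generators of the defining ideal J of the universal representation
   algebra A(Γ_Bor) = C[x_{g,ij}] / J. *)
Definition Jbor : seq (P12 R) :=
  [:: \det Ma - 1; \det Mb - 1; \det Mc - 1]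
  ++ mxentries (rel1 - 1%:M) ++ mxentries (rel2 - 1%:M)
  ++ mxentries (rel3 - 1%:M).

Definition trtuple : 7.-tuple (P12 R) :=
  [tuple \tr Ma; \tr Mb; \tr Mc; \tr (Ma *m Mb); \tr (Ma *m Mc);
         \tr (Mb *m Mc); \tr (Ma *m Mb *m Mc)].

Definition tau (f : P7 R) : P12 R := f \mPo trtuple.

Definition ent (A B C : 'M[P12 R]_2) (k : nat) : P12 R :=
  let M := if (k < 4)%N then A else if (k < 8)%N then B else C in
  M (inord ((k %% 4) %/ 2)%N) (inord (k %% 2)%N).

Definition conj_tuple (g : 'M[CC R]_2) : 12.-tuple (P12 R) :=
  let gP := map_mx (fun c => c%:MP) g in
  let cj A := gP *m A *m minv gP in
  [tuple ent (cj Ma) (cj Mb) (cj Mc) i | i < 12].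

(* p represents an element of B(Γ) = A(Γ)^{SL_2(C)} *)
Definition Binv (p : P12 R) : Prop :=
  forall g : 'M[CC R]_2, \det g = 1 -> in_ideal Jbor (p \mPo conj_tuple g - p).

End Bor.

(* Main.v *)
Require Import Defs.
From HB Require Import structures.
From mathcomp Require Import all_boot all_order all_algebra.
From mathcomp Require Import ring_quotient generic_quotient.
From mathcomp Require Import mpoly.
From mathcomp Require Import complex.
From mathcomp Require Import reals boolp.
From mathcomp Require Import ring zify.
Set Implicit Arguments.
Unset Strict Implicit.
Unset Printing Implicit Defensive.
Import Order.TTheory GRing.Theory Num.Theory.
Local Open Scope ring_scope.

(** A matrix of determinant 1 is a unit quaternion: half its trace plus a traceless part.
    The relator [a, [b, c^-1]] says that a commutes with b c^-1 b^-1 c, whose traceless part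
    is an explicit combination of b, c and b x c.  Taking inner products, the three relators
    become equations in the half traces x, y, z, the inner products u = b.c, v = a.c, w = a.b
    and the triple product d; their main consequence is that h = v w + x d + x^2 u and its two
    permutations are annihilated by d and are proportional to each other.  By a Koszul
    argument every f in I_Bor then vanishes on the universal representation.

    Conversely every component carries a dense family of representations: diagonal ones for
    X_ns, one generator equal to +1 or -1 for the six affine components, and for X_0 the
    representations with traces t_S = k x^S (S a nonempty subset of {a, b, c}), where k and
    x, y, z satisfy a single equation F = P z^2 + Q = 0.  The ideals of functions vanishing on
    these families are computed by normal forms; for I_0 this is a toric ideal and the
    expansion of 1 / F in powers of k.  I_0 is prime because P u^2 + Q v^2 is anisotropic, as
    one sees from the parity of the degree in k of leading coefficients in y.

    For surjectivity, invariance under one-parameter subgroups gives invariance modulo the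
    ideal under sl_2.  By Clebsch-Gordan the polynomial ring in the matrix entries is spanned,
    over the ring of traces, by the images under the lowering operator of products of highest
    weight vectors, and the Casimir operator splits off the invariants. *)

(** * Ideals given by generators *)

(** Reducedness of B is part of the conclusion, so I_Bor cannot be placed in the kernel by checking
    points: whatever is used about the universal representation is an explicit identity over an
    arbitrary commutative ring in which 2 is invertible. Membership in the component ideals, by
    contrast, is tested only at points, and primeness leads back: if p is nilpotent modulo the
    relations and congruent to the trace polynomial f, then a power of f lies in each of the eight
    ideals, hence f lies in I_Bor and p is zero. Primeness of I_0 is needed even earlier.
    Representations only show that f vanishes at the roots in k of F, without control of
    multiplicities; since F has degree at most 4 in k, this gives that F divides f^4. The expansion
    of 1 / F works because F = -4 at k = 0. Every trace t_S is linear in k, so truncation by degree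
    in the seven variables is truncation in k. The quotient f / F, known to exist separately for
    each generic (x, y, z), thereby becomes a single polynomial in the traces. *)

Section Ideals.
Variable T : comNzRingType.
Implicit Types (gs : seq T) (f g c : T).

Lemma in_ideal0 gs : in_ideal gs 0.
Proof. by exists [::]; rewrite big1 // => i _; rewrite nth_nil mul0r. Qed.

Lemma in_idealD gs f g : in_ideal gs f -> in_ideal gs g -> in_ideal gs (f + g).
Proof.
move=> [cs ->] [ds ->]; exists (mkseq (fun i => cs`_i + ds`_i) (size gs)).
by rewrite -big_split; apply: eq_bigr => i _; rewrite nth_mkseq // mulrDl.
Qed.

Lemma in_idealM gs c f : in_ideal gs f -> in_ideal gs (c * f).
Proof.
move=> [cs ->]; exists (mkseq (fun i => c * cs`_i) (size gs)).
by rewrite mulr_sumr; apply: eq_bigr => i _; rewrite nth_mkseq // mulrA.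
Qed.

Lemma in_idealN gs f : in_ideal gs f -> in_ideal gs (- f).
Proof. by move=> /(in_idealM (-1)); rewrite mulN1r. Qed.

Lemma in_idealB gs f g : in_ideal gs f -> in_ideal gs g -> in_ideal gs (f - g).
Proof. by move=> hf /in_idealN; apply: in_idealD. Qed.

Lemma in_ideal_gen gs g : g \in gs -> in_ideal gs g.
Proof.
move=> gin; have lt_i : (index g gs < size gs)%N by rewrite index_mem.
exists (mkseq (fun i => (i == index g gs)%:R) (size gs)).
rewrite (bigD1 (Ordinal lt_i)) //= nth_mkseq // eqxx mul1r nth_index //.
rewrite big1 ?addr0 // => i ne_i; rewrite nth_mkseq //.
by rewrite (negbTE (ne_i : i != index g gs :> nat)) mul0r.
Qed.

Lemma in_ideal_sum gs (I : Type) (r : seq I) (Q : pred I) (h : I -> T) :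
  (forall i, Q i -> in_ideal gs (h i)) -> in_ideal gs (\sum_(i <- r | Q i) h i).
Proof. by move=> hh; apply: big_ind => //; [apply: in_ideal0 | apply: in_idealD]. Qed.

Lemma in_ideal_ind gs (Q : T -> Prop) :
  Q 0 -> (forall f g, Q f -> Q g -> Q (f + g)) ->
  (forall c g, g \in gs -> Q (c * g)) -> forall f, in_ideal gs f -> Q f.
Proof.
move=> Q0 QD QM f [cs ->]; apply: big_ind => // i _.
by apply: QM; apply: mem_nth.
Qed.

Lemma in_ideal_trans gs hs f :
  (forall g, g \in gs -> in_ideal hs g) -> in_ideal gs f -> in_ideal hs f.
Proof.
move=> sub; apply: in_ideal_ind => [|? ?|c g /sub]; [exact: in_ideal0| exact: in_idealD|].
exact: in_idealM.
Qed.

(* The trivial case 1 \in gs is excluded because comNzRingType has 0 <> 1. *)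
Lemma quotient_ring gs : ~ in_ideal gs 1 ->
  exists (Q : comNzRingType) (pr : {rmorphism T -> Q}),
    forall f, pr f = 0 <-> in_ideal gs f.
Proof.
move=> proper.
pose I : {pred T} := fun f => `[< in_ideal gs f >].
have I_closed : idealr_closed I.
  split.
  - by rewrite unfold_in; apply/asboolP; apply: in_ideal0.
  - by rewrite unfold_in; apply/negP => /asboolP.
  - move=> c f g /asboolP fI /asboolP gI; rewrite unfold_in; apply/asboolP.
    by apply: in_idealD => //; apply: in_idealM.
pose B := isIdealr.Build T I I_closed.
pose HI : Idealr.type T := HB.pack I B.
exists {ideal_quot HI}, ((\pi_{ideal_quot HI})%qT : {rmorphism T -> {ideal_quot HI}}) => f.
rewrite -(rmorph0 ((\pi_{ideal_quot HI})%qT : {rmorphism T -> {ideal_quot HI}})).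
split.
- move=> /eqP; rewrite -Quotient.idealrBE subr0 => h; exact/asboolP.
- move=> h; apply/eqP; rewrite -Quotient.idealrBE subr0; exact/asboolP.
Qed.

End Ideals.

Lemma in_ideal_morph (T U : comNzRingType) (phi : {rmorphism T -> U}) gs hs f :
  (forall g, g \in gs -> in_ideal hs (phi g)) -> in_ideal gs f ->
  in_ideal hs (phi f).
Proof.
move=> sub; apply: (@in_ideal_ind _ gs (fun f => in_ideal hs (phi f))) => [|f1 f2|c g /sub].
- by rewrite rmorph0; apply: in_ideal0.
- by rewrite rmorphD; apply: in_idealD.
- by rewrite rmorphM; apply: in_idealM.
Qed.

Lemma in_ideal_ker (T U : comNzRingType) (phi : {rmorphism T -> U}) gs f :
  (forall g, g \in gs -> phi g = 0) -> in_ideal gs f -> phi f = 0.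
Proof.
move=> sub; apply: (@in_ideal_ind _ gs (fun f => phi f = 0)) => [|f1 f2|c g /sub].
- by rewrite rmorph0.
- by rewrite rmorphD => -> ->; rewrite addr0.
- by rewrite rmorphM => ->; rewrite mulr0.
Qed.

(** * Polynomial identities and 2 x 2 matrices *)

Section MpolyMorphisms.
Variables (K S : comNzRingType) (n : nat).
Implicit Types (phi psi : {rmorphism {mpoly K[n]} -> S}).

Lemma mpoly_ring_ind (P : {mpoly K[n]} -> Prop) :
  (forall c, P c%:MP) -> (forall i, P 'X_i) ->
  (forall p q, P p -> P q -> P (p + q)) ->
  (forall p q, P p -> P q -> P (p * q)) -> forall p, P p.
Proof.
move=> PC PX PD PM; apply: mpolyind => [|c m p _ _ Pp].
  by rewrite -mpolyC0; apply: PC.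
apply: (PD) => //; rewrite -mul_mpolyC; apply: (PM) => //.
rewrite mpolyXE_id; apply: big_ind => [||i _]; [by rewrite -mpolyC1 | exact: (PM) |].
by elim: (m i) => [|k IH]; rewrite ?expr0 ?exprS -?mpolyC1 //; apply: (PM).
Qed.

Lemma mpoly_rmorph_eq phi psi :
  (forall c, phi c%:MP = psi c%:MP) -> (forall i, phi 'X_i = psi 'X_i) ->
  phi =1 psi.
Proof.
move=> hC hX p; elim/mpoly_ring_ind: p => [c|i|p q hp hq|p q hp hq] //.
- by rewrite !rmorphD hp hq.
- by rewrite !rmorphM hp hq.
Qed.

Lemma mpoly_rmorph_cong (gs : seq S) phi psi :
  (forall c, phi c%:MP = psi c%:MP) ->
  (forall i, in_ideal gs (phi 'X_i - psi 'X_i)) ->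
  forall p, in_ideal gs (phi p - psi p).
Proof.
move=> hC hX p; elim/mpoly_ring_ind: p => [c|i|p q hp hq|p q hp hq] //.
- by rewrite hC subrr; apply: in_ideal0.
- by rewrite !rmorphD opprD addrACA; apply: in_idealD.
- rewrite !rmorphM.
  have -> : phi p * phi q - psi p * psi q
    = phi q * (phi p - psi p) + psi p * (phi q - psi q) by ring.
  by apply: in_idealD; apply: in_idealM.
Qed.

Lemma mmap_XU (f : {rmorphism K -> S}) (h : 'I_n -> S) i : mmap f h 'X_i = h i.
Proof. by rewrite mmapX mmap1U. Qed.

End MpolyMorphisms.

(** * Polynomials vanishing on a dense set of points *)

Section NonVanishing.
Variable K : numFieldType.

Lemma poly_eq0_inf (p : {poly K}) (q : {poly K}) : q != 0 ->
  (forall x, q.[x] != 0 -> p.[x] = 0) -> p = 0.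
Proof.
move=> q0 hp; apply/eqP; apply: contraT => p0.
have pq0 : p * q != 0 by rewrite mulf_neq0.
have := max_poly_roots pq0 (rs := [seq i%:R | i <- iota 0 (size (p * q))]).
rewrite size_map size_iota ltnn; apply.
- apply/allP => x /mapP[i _ ->]; rewrite rootE hornerM mulf_eq0.
  by case: (eqVneq q.[i%:R] 0) => [_|/hp ->]; rewrite ?orbT ?eqxx.
- by rewrite map_inj_uniq ?iota_uniq // => i j /eqP; rewrite eqr_nat => /eqP.
Qed.

Definition ext_fun n (v : 'I_n -> K) (x : K) (i : 'I_n.+1) : K :=
  if insub (i : nat) is Some j then v j else x.

Lemma muni_eval n (p : {mpoly K[n.+1]}) (v : 'I_n -> K) x :
  (map_poly (meval v) (muni p)).[x] = p.@[ext_fun v x].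
Proof.
rewrite muniE mevalE rmorph_sum horner_sum; apply: eq_bigr => m _.
rewrite /= -[_ *: _ *: _]mul_polyC rmorphM /= map_polyC /= map_polyXn.
rewrite hornerCM hornerXn mevalZ -mulrA; congr (_ * _).
rewrite mevalX big_ord_recr /=; congr (_ * _).
  apply: eq_bigr => i _; rewrite mnmE /ext_fun.
  by rewrite insubT //= => lt_i; congr (v _ ^+ _); apply: val_inj.
by rewrite /ext_fun insubN //= ltnn.
Qed.

Lemma muni_inj n : injective (@muni n K).
Proof.
pose mw := [the {rmorphism {mpoly K[n]} -> {mpoly K[n.+1]}} of @mwiden n K].
suff inv p : (map_poly mw (muni p)).['X_ord_max] = p.
  by move=> p q e; rewrite -(inv p) -(inv q) e.
rewrite [RHS]mpolyE muniE rmorph_sum horner_sum; apply: eq_bigr => m _.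
rewrite /= -[_ *: _ *: _]mul_polyC rmorphM /= map_polyC /= map_polyXn.
rewrite hornerCM hornerXn mwidenZ -scalerAl mwidenX; congr (_ *: _).
rewrite mpolyXn -mpolyXD; congr ('X_[_]); apply/mnmP => i.
rewrite mnmDE mulmnE mnm1E -val_eqE /=.
case: (unliftP ord_max i) => [j ->|->].
  have -> : lift ord_max j = widen_ord (leqnSn n) j by apply: val_inj; exact: lift_max.
  by rewrite mnmwiden_widen mnmE /= gtn_eqF // mul0n addn0.
by rewrite mnmwiden_ordmax eqxx mul1n.
Qed.

Lemma mpoly_eq0_eval n (p : {mpoly K[n]}) : (forall v, p.@[v] = 0) -> p = 0.
Proof.
elim: n p => [|n IH] p hp.
  have all0 (m : 'X_{1..0}) : m = 0%MM by apply/mnmP; case.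
  have pE : p = (mcoeff 0%MM p)%:MP.
    by apply/mpolyP => m; rewrite mcoeffC (all0 m) eqxx mulr1.
  by have := hp (fun _ => 0); rewrite pE mevalC => ->; rewrite mpolyC0.
apply: muni_inj; rewrite muni0; apply/polyP => i; rewrite coef0.
apply: IH => v.
have : map_poly (meval v) (muni p) = 0.
  apply: (@poly_eq0_inf _ 1); first exact: oner_neq0.
  by move=> x _; rewrite muni_eval.
by move/polyP/(_ i); rewrite coef_map coef0.
Qed.

Lemma mpoly_eq0_generic n (p d : {mpoly K[n]}) : d != 0 ->
  (forall v, d.@[v] != 0 -> p.@[v] = 0) -> p = 0.
Proof.
move=> d0 hp; suff /eqP : p * d = 0 by rewrite mulf_eq0 (negbTE d0) orbF => /eqP.
apply: mpoly_eq0_eval => v; rewrite mevalM.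
by case: (eqVneq d.@[v] 0) => [->|/hp ->]; rewrite ?mulr0 ?mul0r.
Qed.

End NonVanishing.

Section Matrix2.
Variable S : comNzRingType.
Implicit Types (A B : 'M[S]_2) (a b c d : S).

Definition mx2 a b c d : 'M[S]_2 :=
  \matrix_(i, j) if i == 0 then (if j == 0 then a else b)
                 else (if j == 0 then c else d).

Lemma mx2_eta A : A = mx2 (A 0 0) (A 0 1) (A 1 0) (A 1 1).
Proof.
apply/matrixP => i j; rewrite mxE.
by case: i => [[|[|//]] ?]; case: j => [[|[|//]] ?] /=; congr (A _ _); apply: val_inj.
Qed.

Lemma mx2_mul a b c d a' b' c' d' :
  mx2 a b c d *m mx2 a' b' c' d' =
  mx2 (a * a' + b * c') (a * b' + b * d') (c * a' + d * c') (c * b' + d * d').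
Proof.
apply/matrixP => i j; rewrite !mxE !big_ord_recl big_ord0 !mxE addr0.
by case: i => [[|[|//]] ?]; case: j => [[|[|//]] ?].
Qed.

Lemma mx2_add a b c d a' b' c' d' :
  mx2 a b c d + mx2 a' b' c' d' = mx2 (a + a') (b + b') (c + c') (d + d').
Proof.
apply/matrixP => i j; rewrite !mxE.
by case: i => [[|[|//]] ?]; case: j => [[|[|//]] ?].
Qed.

Lemma mx2_opp a b c d : - mx2 a b c d = mx2 (- a) (- b) (- c) (- d).
Proof.
apply/matrixP => i j; rewrite !mxE.
by case: i => [[|[|//]] ?]; case: j => [[|[|//]] ?].
Qed.

Lemma mx2_scalar a : a%:M = mx2 a 0 0 a.
Proof.
apply/matrixP => i j; rewrite !mxE.
by case: i => [[|[|//]] ?]; case: j => [[|[|//]] ?].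
Qed.

Lemma mx2_tr a b c d : \tr (mx2 a b c d) = a + d.
Proof. by rewrite /mxtrace !big_ord_recl big_ord0 !mxE addr0. Qed.

Lemma mx2_det a b c d : \det (mx2 a b c d) = a * d - b * c.
Proof.
rewrite (expand_det_row _ 0) !big_ord_recl big_ord0 addr0 /cofactor !det_mx11 !mxE /=.
by rewrite expr0 expr1 mul1r mulN1r mulrN.
Qed.

Lemma mx2_adj a b c d : minv (mx2 a b c d) = mx2 d (- b) (- c) a.
Proof.
apply/matrixP => i j; rewrite /minv !mxE /cofactor det_mx11 !mxE.
by case: i => [[|[|//]] ?]; case: j => [[|[|//]] ?] /=;
   rewrite /= ?expr0 ?expr1 ?mul1r ?mulN1r ?sqrrN ?expr1n ?mul1r.
Qed.

Lemma mx2_inj a b c d a' b' c' d' : mx2 a b c d = mx2 a' b' c' d' ->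
  [/\ a = a', b = b', c = c' & d = d'].
Proof.
by move=> /matrixP e; have := (e 0 0, e 0 1, e 1 0, e 1 1); rewrite !mxE /= => -[[[]]].
Qed.

End Matrix2.

Definition mx2E := (mx2_adj, mx2_mul, mx2_opp, mx2_add, mx2_scalar, mx2_tr, mx2_det).

Lemma map_mx2 (S T : comNzRingType) (f : S -> T) a b c d :
  map_mx f (mx2 a b c d) = mx2 (f a) (f b) (f c) (f d).
Proof.
apply/matrixP => i j; rewrite !mxE.
by case: i => [[|[|//]] ?]; case: j => [[|[|//]] ?].
Qed.

(** * The Borromean relations in quaternion coordinates *)

Section Quaternions.
Variable S : comNzRingType.

(* The factor 2 off the diagonal keeps dot and cross products of the traceless
   parts free of denominators. *)
Definition qmx (t : S) (a : S * S * S) : 'M[S]_2 :=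
  mx2 (t + a.1.1) (2%:R * a.1.2) a.2 (t - a.1.1).

(* Normalised so that the product of traceless matrices is - dot + cross. *)
Definition dot (a b : S * S * S) : S := - (a.1.1 * b.1.1 + a.1.2 * b.2 + a.2 * b.1.2).
Definition cross (a b : S * S * S) : S * S * S :=
  (a.1.2 * b.2 - a.2 * b.1.2, a.1.1 * b.1.2 - a.1.2 * b.1.1, a.2 * b.1.1 - a.1.1 * b.2).

Lemma qmx_tr t a : \tr (qmx t a) = 2%:R * t.
Proof. by rewrite mx2_tr; ring. Qed.

Lemma qmx_det t a : \det (qmx t a) = t ^+ 2 + dot a a.
Proof. by rewrite mx2_det /dot; ring. Qed.

Lemma qmx_mul_tr s a t b : \tr (qmx s a *m qmx t b) = 2%:R * (s * t - dot a b).
Proof. by rewrite !mx2E /dot; ring. Qed.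

Lemma qmx_mul3_tr s a t b r c :
  \tr (qmx s a *m qmx t b *m qmx r c) = 2%:R * (s * t * r - s * dot b c
    - t * dot a c - r * dot a b - dot (cross a b) c).
Proof. by rewrite !mx2E /dot /cross /=; ring. Qed.

(** The inner commutator [b, c^-1], with the double adjugate of c already cancelled. *)
Definition innerX (B C : 'M[S]_2) := B *m minv C *m minv B *m C.

(** The traceless part of (b x c) b^-1 c, its double cross products expanded. The traceless part of
    [innerX] is -2 times this vector, whatever the norms of b and c. *)
Definition xvec (t : S) (b : S * S * S) (r : S) (c : S * S * S) : S * S * S :=
  let n := cross b c in
  let s := t * r + dot b c in
  let p := t * dot b c - r * dot b b in
  let q := r * dot b c - t * dot c c in
  (s * n.1.1 + p * c.1.1 + q * b.1.1, s * n.1.2 + p * c.1.2 + q * b.1.2,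
   s * n.2 + p * c.2 + q * b.2).

(* b c^-1 b^-1 c = 1 - 2 (b x c) b^-1 c for unit quaternions. *)
Lemma commutator_innerX s a t b r c :
  qmx s a *m innerX (qmx t b) (qmx r c) - innerX (qmx t b) (qmx r c) *m qmx s a =
  - 4%:R *: qmx 0 (cross a (xvec t b r c)).
Proof.
rewrite /innerX /qmx !mx2E.
have -> x (M : 'M[S]_2) : x *: M = mx2 (x * M 0 0) (x * M 0 1) (x * M 1 0) (x * M 1 1).
  by rewrite [in LHS](mx2_eta M); apply/matrixP => i j; rewrite !mxE; do 2!case: ifP.
rewrite !mxE /= /cross /xvec /dot /cross /=.
congr mx2; ring.
Qed.

(** Pairing the vector equation a x X = 0 with b, c, b x c and a x b leaves scalar equations in the
    half traces, the inner products and the triple product alone. *)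
Lemma dot_crossx s a t b r c (x := cross a (xvec t b r c)) :
  [/\ dot b x = - ((t * r + dot b c) * (dot b c * dot a b - dot a c * dot b b)
                   + (t * dot b c - r * dot b b) * dot (cross a b) c),
      dot c x = (t * r + dot b c) * (dot b c * dot a c - dot a b * dot c c)
                   + (r * dot b c - t * dot c c) * dot (cross a b) c,
      dot (cross b c) x = (dot b b * dot c c - dot b c ^+ 2) * (t * dot a c - r * dot a b)
    & dot (cross a b) x = s * 0 - (dot a a * t * (dot b b * dot c c - dot b c ^+ 2)
        + dot a b * ((t * r + dot b c) * dot (cross a b) c
          + (t * dot b c - r * dot b b) * dot a c
          + (r * dot b c - t * dot c c) * dot a b))].
Proof. by rewrite /x /xvec /dot /cross /=; split; ring. Qed.

Lemma gram_det a b c :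
  dot (cross a b) c ^+ 2 = dot a a * dot b b * dot c c
    + 2%:R * dot b c * dot a c * dot a b - dot a a * dot b c ^+ 2
    - dot b b * dot a c ^+ 2 - dot c c * dot a b ^+ 2.
Proof. by rewrite /dot /cross /=; ring. Qed.

Lemma dot_cross_rot a b c : dot (cross b c) a = dot (cross a b) c.
Proof. by rewrite /dot /cross /=; ring. Qed.

Lemma dotC a b : dot a b = dot b a.
Proof. by rewrite /dot /=; ring. Qed.

End Quaternions.

Section BorromeanEquations.
Variable S : comNzRingType.
Implicit Types (x y z u v w d : S).

(* [x, y, z] are half traces, [u, v, w, d] the inner products b.c, a.c, a.b and
   the triple product of the traceless parts. *)
Definition gram x y z u v w : S :=
  (1 - x ^+ 2) * (1 - y ^+ 2) * (1 - z ^+ 2) + 2%:R * u * v * w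
  - (1 - x ^+ 2) * u ^+ 2 - (1 - y ^+ 2) * v ^+ 2 - (1 - z ^+ 2) * w ^+ 2.

Definition minorE y u v w : S := w * u - v * (1 - y ^+ 2).

Definition h3 x u v w d : S := v * w + x * d + x ^+ 2 * u.

Definition bor_eq x y z u v w d : Prop :=
  [/\ d ^+ 2 = gram x y z u v w,
      x * u - y * v = x * h3 x u v w d - y * h3 y v w u d &
      y * v - z * w = y * h3 y v w u d - z * h3 z w u v d] /\
  [/\ (1 - x ^+ 2) * h3 x u v w d = w * h3 y v w u d,
      w * h3 y v w u d = v * h3 z w u v d,
      (1 - y ^+ 2) * h3 y v w u d = w * h3 x u v w d &
      w * h3 x u v w d = u * h3 z w u v d] /\
  [/\ (1 - z ^+ 2) * h3 z w u v d = v * h3 x u v w d,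
      v * h3 x u v w d = u * h3 y v w u d,
      d * h3 x u v w d = 0, d * h3 y v w u d = 0 & d * h3 z w u v d = 0].

(* The hypotheses are the inner products of the vector equation a x X = 0 with
   b, c and b x c (and with a x b for the last one), for the three relators. *)
Lemma bor_eqP x y z u v w d :
  let k1b := (y * z + u) * minorE y u v w + (y * u - z * (1 - y ^+ 2)) * d in
  let k1c := (y * z + u) * minorE z v w u + (z * u - y * (1 - z ^+ 2)) * d in
  let k2c := (z * x + v) * minorE z v w u + (z * v - x * (1 - z ^+ 2)) * d in
  let k2a := (z * x + v) * minorE x w u v + (x * v - z * (1 - x ^+ 2)) * d in
  let k3a := (x * y + w) * minorE x w u v + (x * w - y * (1 - x ^+ 2)) * d in
  let k3b := (x * y + w) * minorE y u v w + (y * w - x * (1 - y ^+ 2)) * d in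
  let nbc := (1 - y ^+ 2) * (1 - z ^+ 2) - u ^+ 2 in
  let nca := (1 - z ^+ 2) * (1 - x ^+ 2) - v ^+ 2 in
  let k1ab := (1 - x ^+ 2) * y * nbc + w * ((y * z + u) * d
     + (y * u - z * (1 - y ^+ 2)) * v + (z * u - y * (1 - z ^+ 2)) * w) in
  d ^+ 2 = gram x y z u v w ->
  k1b = 0 -> k1c = 0 -> k2c = 0 -> k2a = 0 -> k3a = 0 -> k3b = 0 ->
  nbc * (y * v - z * w) = 0 -> nca * (z * w - x * u) = 0 -> k1ab = 0 ->
  bor_eq x y z u v w d.
Proof.
move=> k1b k1c k2c k2a k3a k3b nbc nca k1ab eF e1b e1c e2c e2a e3a e3b e1n e2n e1ab.
pose F := d ^+ 2 - gram x y z u v w; have eF0 : F = 0 by rewrite /F eF subrr.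
pose k1n := nbc * (y * v - z * w); pose k2n := nca * (z * w - x * u).
have E := (eF0, e1b, e1c, e2c, e2a, e3a, e3b, e1n : k1n = 0, e2n : k2n = 0, e1ab).
(* Each remaining goal is an explicit combination, with polynomial coefficients, of the ten
   quantities that [E] sends to 0. *)
rewrite /bor_eq; do ![split]; first exact: eF; apply: subr0_eq.
- transitivity (- k2n - z * k2a + x * k2c - k1n + z * k1b - y * k1c); last by rewrite !E; ring.
  by rewrite /k2n /k2a /k2c /k1n /k1b /k1c /nbc /nca /h3 /minorE; ring.
- transitivity (k1n - z * k1b + y * k1c); last by rewrite !E; ring.
  by rewrite /k2n /k2a /k2c /k1n /k1b /k1c /nbc /nca /h3 /minorE; ring.
- transitivity (- x * k2n - x * z * k2a + x ^+ 2 * k2c - k3b - x * k1n + x * z * k1b - x * y * k1c);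
    last by rewrite !E; ring.
  by rewrite /k2n /k2a /k2c /k1n /k1b /k1c /k3a /k3b /nbc /nca /h3 /minorE; ring.
- transitivity (k3b + x * k1n - x * z * k1b + x * y * k1c - k2c); last by rewrite !E; ring.
  by rewrite /k2n /k2a /k2c /k1n /k1b /k1c /k3a /k3b /nbc /nca /h3 /minorE; ring.
- transitivity (- k3a + y * k2n + y * z * k2a - x * y * k2c + y * k1n - y * z * k1b + y ^+ 2 * k1c);
    last by rewrite !E; ring.
  by rewrite /k2n /k2a /k2c /k1n /k1b /k1c /k3a /k3b /nbc /nca /h3 /minorE; ring.
- transitivity (k3a - y * k2n - y * z * k2a + x * y * k2c - k1c); last by rewrite !E; ring.
  by rewrite /k2n /k2a /k2c /k1n /k1b /k1c /k3a /k3b /nbc /nca /h3 /minorE; ring.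
- transitivity (z * k2n + (z ^+ 2 - 1) * k2a - x * z * k2c); last by rewrite !E; ring.
  by rewrite /k2n /k2a /k2c /k1n /k1b /k1c /k3a /k3b /nbc /nca /h3 /minorE; ring.
- transitivity (- z * k2n + (1 - z ^+ 2) * k2a + x * z * k2c - z * k1n + (z ^+ 2 - 1) * k1b - y * z * k1c);
    last by rewrite !E; ring.
  by rewrite /k2n /k2a /k2c /k1n /k1b /k1c /k3a /k3b /nbc /nca /h3 /minorE; ring.
- rewrite subr0; transitivity ((- x * y * z - x * u) * k2c + (x ^+ 2 * z + x * v) * k1c
    - (x ^+ 2 * z + x * v) * k3a + (x ^+ 2 * y + x * w) * k2a + (x * y + w) * k1ab
    + (x * y ^+ 2 + y * w) * F + (y * v - d - z * w) * k3b); last by rewrite !E; ring.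
  by rewrite /k2n /k2a /k2c /k1n /k1b /k1c /k3a /k3b /k1ab /F /gram /nbc /nca /h3 /minorE; ring.
- rewrite subr0; transitivity (k1ab + y * F - (v + x * z) * k1n + (z * v + x * z ^+ 2) * k1b
    - (y * v + x * y * z) * k1c - z * k3b + z * k2c); last by rewrite !E; ring.
  by rewrite /k2n /k2a /k2c /k1n /k1b /k1c /k3a /k3b /k1ab /F /gram /nbc /nca /h3 /minorE; ring.
- rewrite subr0; transitivity ((y * z + u) * k1ab + (y ^+ 2 * z + y * u) * F
    + (y * v - d - z * w) * k1b); last by rewrite !E; ring.
  by rewrite /k2n /k2a /k2c /k1n /k1b /k1c /k3a /k3b /k1ab /F /gram /nbc /nca /h3 /minorE; ring.
Qed.

(** Inverting 2 turns the commutation relations into the vanishing of the vectors a x X, whose inner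
    products are the hypotheses of [bor_eqP]. Nothing is assumed about zero divisors or nilpotents,
    as the lemma is meant for the quotient by the relations. *)
Lemma bor_eq_of_relators (h : S) x a y b z c : 2%:R * h = 1 ->
  \det (qmx x a) = 1 -> \det (qmx y b) = 1 -> \det (qmx z c) = 1 ->
  qmx x a *m innerX (qmx y b) (qmx z c) = innerX (qmx y b) (qmx z c) *m qmx x a ->
  qmx y b *m innerX (qmx z c) (qmx x a) = innerX (qmx z c) (qmx x a) *m qmx y b ->
  qmx z c *m innerX (qmx x a) (qmx y b) = innerX (qmx x a) (qmx y b) *m qmx z c ->
  bor_eq x y z (dot b c) (dot a c) (dot a b) (dot (cross a b) c).
Proof.
move=> half; rewrite !qmx_det => da db dc r1 r2 r3.
have gaa : dot a a = 1 - x ^+ 2 by rewrite -da; ring.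
have gbb : dot b b = 1 - y ^+ 2 by rewrite -db; ring.
have gcc : dot c c = 1 - z ^+ 2 by rewrite -dc; ring.
have crossx0 (s1 : S) a1 (t1 : S) b1 (q1 : S) c1 :
    qmx s1 a1 *m innerX (qmx t1 b1) (qmx q1 c1)
      = innerX (qmx t1 b1) (qmx q1 c1) *m qmx s1 a1 ->
    forall e, dot e (cross a1 (xvec t1 b1 q1 c1)) = 0.
  move=> r e; have := commutator_innerX s1 a1 t1 b1 q1 c1; rewrite r subrr.
  move: (cross _ _) => m /matrixP m0.
  have nz (X : S) : 4%:R * X = 0 -> X = 0.
    move=> X0; have -> : X = (2%:R * h) ^+ 2 * X by rewrite half; ring.
    by transitivity (h ^+ 2 * (4%:R * X)); [ring | rewrite X0 mulr0].
  have m1 : m.1.1 = 0.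
    apply: (nz); have := m0 0 0; rewrite !mxE /= => e0.
    by transitivity (- (- 4%:R * (0 + m.1.1))); [ring | rewrite -e0 oppr0].
  have m2 : m.1.2 = 0.
    apply: (nz); apply: (nz).
    have := m0 0 1; rewrite !mxE /= => e0.
    by transitivity (- 2%:R * (- 4%:R * (2%:R * m.1.2))); [ring | rewrite -e0 mulr0].
  have m3 : m.2 = 0.
    apply: (nz); have := m0 1 0; rewrite !mxE /= => e0.
    by transitivity (- (- 4%:R * m.2)); [ring | rewrite -e0 oppr0].
  by rewrite /dot m1 m2 m3; ring.
have [e1 e2 e3 e4] := dot_crossx x a y b z c.
have [f1 f2 f3 _] := dot_crossx y b z c x a.
have [g1 g2 _ _] := dot_crossx z c x a y b.
move: e1 e2 e3 e4 f1 f2 f3 g1 g2; rewrite !(crossx0 _ _ _ _ _ _ r1) !(crossx0 _ _ _ _ _ _ r2).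
rewrite !(crossx0 _ _ _ _ _ _ r3) (dot_cross_rot b c a) (dot_cross_rot a b c).
rewrite (dotC c a) (dotC b a) (dotC c b) gaa gbb gcc.
move=> e1 e2 e3 e4 f1 f2 f3 g1 g2.
have gd := gram_det a b c; rewrite gaa gbb gcc in gd.
set u := dot b c in gd e1 e2 e3 e4 f1 f2 f3 g1 g2 *.
set v := dot a c in gd e1 e2 e3 e4 f1 f2 f3 g1 g2 *.
set w := dot a b in gd e1 e2 e3 e4 f1 f2 f3 g1 g2 *.
set d := dot _ _ in gd e1 e2 e3 e4 f1 f2 f3 g1 g2 *.
have opp0 (X Y : S) : 0 = X -> Y = - X -> Y = 0 by move=> <- ->; rewrite oppr0.
have id0 (X Y : S) : 0 = X -> Y = X -> Y = 0 by move=> <- ->.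
apply: bor_eqP; first by rewrite gd /gram.
- by apply: opp0 e1 _; rewrite /minorE; ring.
- by apply: id0 e2 _; rewrite /minorE; ring.
- by apply: opp0 f1 _; rewrite /minorE; ring.
- by apply: id0 f2 _; rewrite /minorE; ring.
- by apply: opp0 g1 _; rewrite /minorE; ring.
- by apply: id0 g2 _; rewrite /minorE; ring.
- by apply: id0 e3 _; ring.
- by apply: id0 f3 _; ring.
- by apply: opp0 e4 _; ring.
Qed.

End BorromeanEquations.

(** * Matrices with prescribed Gram data *)

Section Realisation.
Variable K : numClosedFieldType.
Implicit Types (x y z u v w d : K).

(** With a = (l, 0, 0) and b = (b1, 1, t), the prescribed values of a.c, b.c and the triple product
    are linear equations that determine c. The Gram equation then forces c.c = 1 - z^2. The two
    nonvanishing hypotheses say that l and t are nonzero. *)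
Lemma gram_realised x y z u v w d :
  d ^+ 2 = gram x y z u v w -> 1 - x ^+ 2 != 0 ->
  (1 - x ^+ 2) * (1 - y ^+ 2) - w ^+ 2 != 0 ->
  exists a b c, [/\ dot a a = 1 - x ^+ 2, dot b b = 1 - y ^+ 2 & dot c c = 1 - z ^+ 2]
    /\ [/\ dot b c = u, dot a c = v, dot a b = w & dot (cross a b) c = d].
Proof.
move=> eF nx nab; pose l := sqrtC (x ^+ 2 - 1).
have l2 : l ^+ 2 = x ^+ 2 - 1 by rewrite sqrtCK.
have nl : l != 0 by rewrite -sqrf_eq0 l2 -oppr_eq0 opprB.
pose t : K := ((1 - x ^+ 2) * (1 - y ^+ 2) - w ^+ 2) / (2%:R * l ^+ 2).
have n2 : 2%:R != 0 :> K by rewrite pnatr_eq0.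
have nt : t != 0 by rewrite mulf_neq0 // invr_eq0 mulf_neq0 // expf_neq0.
pose b1 := - w / l; pose c1 := - v / l.
pose c3 := (- u - b1 * c1 - d / l) / 2%:R.
pose c2 := (- u - b1 * c1 + d / l) / (2%:R * t).
exists (l, 0, 0), (b1, 1, t), (c1, c2, c3); rewrite /dot /cross /=.
have b12 : b1 ^+ 2 = w ^+ 2 / l ^+ 2 by rewrite /b1; field.
have ex : x ^+ 2 = l ^+ 2 + 1 by rewrite l2; ring.
split; split.
- by rewrite ex; ring.
- by rewrite /t /b1 ex; field; rewrite ?n2 ?nl ?nt.
- have Y : 1 - y ^+ 2 = - (b1 ^+ 2 + 2%:R * t).
    by rewrite /t /b1 ex; field; rewrite ?n2 ?nl ?nt.
  have ed : d ^+ 2 = - l ^+ 2 * (- (b1 ^+ 2 + 2%:R * t)) * (1 - z ^+ 2) + 2%:R * u * v * w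
     + l ^+ 2 * u ^+ 2 + (b1 ^+ 2 + 2%:R * t) * v ^+ 2 - (1 - z ^+ 2) * w ^+ 2.
    by rewrite eF /gram Y ex; ring.
  have z2 : z ^+ 2 = 1 - (d ^+ 2 - 2%:R * u * v * w - l ^+ 2 * u ^+ 2
       - (b1 ^+ 2 + 2%:R * t) * v ^+ 2) / (2%:R * t * l ^+ 2).
    rewrite ed; have -> : w = - b1 * l by rewrite /b1; field.
    by field; rewrite ?n2 ?nl ?nt.
  rewrite z2 /c3 /c2 /c1; have -> : w = - b1 * l by rewrite /b1; field.
  by field; rewrite ?n2 ?nl ?nt.
- by rewrite /c3 /c2; field; rewrite ?n2 ?nl ?nt.
- by rewrite /c1; field.
- by rewrite /b1; field.
- by rewrite /c3 /c2; field; rewrite ?n2 ?nl ?nt.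
Qed.

Lemma cramer_cross (a b c m : K * K * K) : dot (cross a b) c != 0 ->
  dot a m = 0 -> dot b m = 0 -> dot c m = 0 -> m = (0, 0, 0).
Proof.
case: m => [[m1 m2] m3] nd am bm cm.
pose T (X Y Z : K) := dot a (m1, m2, m3) * X + dot b (m1, m2, m3) * Y + dot c (m1, m2, m3) * Z.
have T0 X Y Z : T X Y Z = 0 by rewrite /T am bm cm; ring.
have e1 : dot (cross a b) c * m1 = T (cross b c).1.1 (cross c a).1.1 (cross a b).1.1.
  by rewrite /T /dot /cross /=; ring.
have e2 : dot (cross a b) c * m2 = T (cross b c).1.2 (cross c a).1.2 (cross a b).1.2.
  by rewrite /T /dot /cross /=; ring.
have e3 : dot (cross a b) c * m3 = T (cross b c).2 (cross c a).2 (cross a b).2.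
  by rewrite /T /dot /cross /=; ring.
have z0 X : dot (cross a b) c * X = 0 -> X = 0.
  by move/eqP; rewrite mulf_eq0 (negbTE nd) => /eqP.
by rewrite (z0 _ (etrans e1 (T0 _ _ _))) (z0 _ (etrans e2 (T0 _ _ _))) (z0 _ (etrans e3 (T0 _ _ _))).
Qed.

(** When a, b, c form a basis, a x X = 0 can be tested by inner products with them. The product with
    a is zero automatically, so two scalar equations suffice for one relator. *)
Lemma relator_of_dots s a t b r c :
  dot (cross a b) c != 0 ->
  (t * r + dot b c) * minorE t (dot b c) (dot a c) (dot a b)
    + (t * dot b c - r * (1 - t ^+ 2)) * dot (cross a b) c = 0 ->
  (t * r + dot b c) * minorE r (dot a c) (dot a b) (dot b c)
    + (r * dot b c - t * (1 - r ^+ 2)) * dot (cross a b) c = 0 ->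
  dot b b = 1 - t ^+ 2 -> dot c c = 1 - r ^+ 2 ->
  qmx s a *m innerX (qmx t b) (qmx r c) = innerX (qmx t b) (qmx r c) *m qmx s a :> 'M[K]_2.
Proof.
move=> nd e1 e2 gb gc; apply: subr0_eq; rewrite commutator_innerX.
have [d1 d2 _ _] := dot_crossx s a t b r c.
rewrite (cramer_cross (m := cross a (xvec t b r c)) nd).
- by apply/matrixP => i j; rewrite !mxE /=; do 2!case: ifP => _ /=; ring.
- by rewrite /dot /cross /=; ring.
- rewrite d1 -[RHS]oppr0 -e1 gb /minorE; ring.
- rewrite d2 -e2 gc /minorE; ring.
Qed.

End Realisation.

(** Points are lists rather than functions, so that they can be written out and transported by
    [map]; coordinates beyond the end of the list read as 0. *)
Definition evs (K S : comNzRingType) (f : {rmorphism K -> S}) n (s : seq S) :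
  {rmorphism {mpoly K[n]} -> S} := mmap f (fun i : 'I_n => s`_i).

Lemma evsC (K S : comNzRingType) (f : {rmorphism K -> S}) n s c :
  evs f n s c%:MP = f c.
Proof. exact: mmapC. Qed.

Lemma evsXi (K S : comNzRingType) (f : {rmorphism K -> S}) n s (i : 'I_n) :
  evs f n s 'X_i = s`_i.
Proof. exact: mmap_XU. Qed.

Lemma evsX (K S : comNzRingType) (f : {rmorphism K -> S}) n s k : (k < n.+1)%N ->
  evs f n.+1 s 'X_(inord k) = s`_k.
Proof. by move=> lt_k; rewrite evsXi inordK. Qed.

Lemma evs_comp (K S T : comNzRingType) (f : {rmorphism K -> S}) (g : {rmorphism S -> T})
    n s p :
  g (evs f n s p) = evs (g \o f) n (map g s) p.
Proof.
apply: (mpoly_rmorph_eq (phi := g \o evs f n s)) => [c|i] /=.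
  by rewrite !evsC.
rewrite !evsXi; case: (ltnP i (size s)) => h; first by rewrite (nth_map 0).
by rewrite !nth_default ?size_map // rmorph0.
Qed.

(** * Representations over a ring and their traces *)

Section BorromeanRepresentations.
Variable S : comNzRingType.

Lemma minvM (A : 'M[S]_2) : minv A *m A = (\det A)%:M.
Proof. exact: mul_adj_mx. Qed.

Lemma mulm_minv (A : 'M[S]_2) : A *m minv A = (\det A)%:M.
Proof. exact: mul_mx_adj. Qed.

Lemma det_minv (A : 'M[S]_2) : \det (minv A) = \det A.
Proof. by rewrite (mx2_eta A) !mx2E; ring. Qed.

Lemma det_innerX (B C : 'M[S]_2) : \det B = 1 -> \det C = 1 -> \det (innerX B C) = 1.
Proof. by move=> b c; rewrite /innerX !det_mulmx !det_minv b c !mulr1. Qed.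

Lemma mcomm_eq1 (A X : 'M[S]_2) : \det A = 1 -> \det X = 1 ->
  mcomm A X = 1%:M <-> A *m X = X *m A.
Proof.
move=> dA dX; rewrite /mcomm; split=> [e|->].
  rewrite -[RHS]mul1mx -e -!mulmxA (mulmxA (minv X)) minvM dX mul1mx.
  by rewrite minvM dA mulmx1.
by rewrite -!mulmxA (mulmxA A) mulm_minv dA mul1mx mulm_minv dX.
Qed.

(** The relators in commutation form, equivalent to the vanishing of the commutators by [mcomm_eq1]
    once all determinants are 1. *)
Definition bor_rep (A B C : 'M[S]_2) : Prop :=
  [/\ \det A = 1, \det B = 1 & \det C = 1] /\
  [/\ A *m innerX B C = innerX B C *m A, B *m innerX C A = innerX C A *m B
    & C *m innerX A B = innerX A B *m C].

End BorromeanRepresentations.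

Section MatrixMorphism.
Variables (T S : comNzRingType) (phi : {rmorphism T -> S}).

Lemma map_minv (A : 'M[T]_2) : map_mx phi (minv A) = minv (map_mx phi A).
Proof. by rewrite /minv map_mx_adj. Qed.

Lemma map_mcomm (A B : 'M[T]_2) :
  map_mx phi (mcomm A B) = mcomm (map_mx phi A) (map_mx phi B).
Proof. by rewrite /mcomm !map_mxM !map_minv. Qed.

Lemma minvK (A : 'M[S]_2) : minv (minv A) = A.
Proof. by rewrite (mx2_eta A) !mx2E !opprK. Qed.

Lemma map_mcomm2 (A B C : 'M[T]_2) : map_mx phi (mcomm A (mcomm B (minv C))) =
  mcomm (map_mx phi A) (innerX (map_mx phi B) (map_mx phi C)).
Proof. by rewrite !map_mcomm map_minv /innerX {2}/mcomm minvK. Qed.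

Lemma mxentries0 (A : 'M[T]_2) :
  (forall g, g \in mxentries (A - 1%:M) -> phi g = 0) <-> map_mx phi A = 1%:M.
Proof.
rewrite /mxentries; split=> [h|e g].
  apply/matrixP => i j; rewrite !mxE; apply/eqP; rewrite -subr_eq0.
  have -> : (i == j)%:R = phi ((1%:M : 'M[T]_2) i j) by rewrite mxE rmorph_nat.
  rewrite -rmorphB; apply/eqP.
  have -> : A i j - (1%:M : 'M_2) i j = (A - 1%:M) i j by rewrite !mxE.
  apply: h; rewrite !inE.
  by case: i => [[|[|//]] ?]; case: j => [[|[|//]] ?];
     apply/or4P; [constructor 1|constructor 2|constructor 3|constructor 4];
     apply/eqP; congr ((A - _) _ _); apply: val_inj.
have key i j : phi ((A - 1%:M) i j) = 0.
  rewrite !mxE rmorphB rmorph_nat; have /matrixP/(_ i j) := e.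
  by rewrite !mxE => ->; rewrite subrr.
by rewrite !inE => /or4P[] /eqP ->.
Qed.

Lemma det_sub1 (X : 'M[T]_2) : phi (\det X - 1) = 0 <-> \det (map_mx phi X) = 1.
Proof.
rewrite rmorphB rmorph1 -det_map_mx; split=> [/eqP|->]; last exact: subrr.
by rewrite subr_eq0 => /eqP.
Qed.

Lemma rep_ker (MA MB MC : 'M[T]_2) (A := map_mx phi MA) (B := map_mx phi MB)
    (C := map_mx phi MC) :
  (forall g, g \in [:: \det MA - 1; \det MB - 1; \det MC - 1]
     ++ mxentries (mcomm MA (mcomm MB (minv MC)) - 1%:M)
     ++ mxentries (mcomm MB (mcomm MC (minv MA)) - 1%:M)
     ++ mxentries (mcomm MC (mcomm MA (minv MB)) - 1%:M) -> phi g = 0) <->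
  bor_rep A B C.
Proof.
rewrite /bor_rep; split=> [h|[[dA dB dC] [r1 r2 r3]] g].
  have dA : \det A = 1 by apply/det_sub1; apply: h; rewrite !inE eqxx.
  have dB : \det B = 1 by apply/det_sub1; apply: h; rewrite !inE eqxx orbT.
  have dC : \det C = 1 by apply/det_sub1; apply: h; rewrite !inE eqxx !orbT.
  split=> //; split; apply/mcomm_eq1; rewrite ?det_innerX //.
  - apply: etrans (esym (map_mcomm2 MA MB MC)) _; apply/mxentries0 => g gin.
    by apply: h; rewrite !mem_cat; apply/or4P; constructor 2.
  - apply: etrans (esym (map_mcomm2 MB MC MA)) _; apply/mxentries0 => g gin.
    by apply: h; rewrite !mem_cat; apply/or4P; constructor 3.
  - apply: etrans (esym (map_mcomm2 MC MA MB)) _; apply/mxentries0 => g gin.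
    by apply: h; rewrite !mem_cat; apply/or4P; constructor 4.
rewrite !mem_cat => /or4P[].
- by rewrite !inE => /or3P[] /eqP ->; apply/det_sub1.
- move: g; apply/mxentries0; apply: etrans (map_mcomm2 MA MB MC) _.
  by apply/mcomm_eq1; rewrite ?det_innerX.
- move: g; apply/mxentries0; apply: etrans (map_mcomm2 MB MC MA) _.
  by apply/mcomm_eq1; rewrite ?det_innerX.
- move: g; apply/mxentries0; apply: etrans (map_mcomm2 MC MA MB) _.
  by apply/mcomm_eq1; rewrite ?det_innerX.
Qed.

End MatrixMorphism.

Section Traces.
Variables (R : realType) (S : comNzRingType) (phi : {rmorphism P12 R -> S}).
Local Notation K := (CC R).

Definition trseq (A B C : 'M[S]_2) : seq S :=
  [:: \tr A; \tr B; \tr C; \tr (A *m B); \tr (A *m C); \tr (B *m C); \tr (A *m B *m C)].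

Lemma tau_ev f :
  phi (tau f) = evs (phi \o @mpolyC 12 K) 7
    (trseq (map_mx phi (Ma R)) (map_mx phi (Mb R)) (map_mx phi (Mc R))) f.
Proof.
apply: (mpoly_rmorph_eq (phi := phi \o comp_mpoly (trtuple R))) => [c|i] /=.
  by rewrite comp_mpolyC evsC.
have -> : trseq (map_mx phi (Ma R)) (map_mx phi (Mb R)) (map_mx phi (Mc R)) =
    map phi (trtuple R).
  rewrite /trseq -(map_mxM phi (Ma R) (Mb R)) -(map_mxM phi (Ma R) (Mc R)).
  rewrite -(map_mxM phi (Mb R) (Mc R)) -(map_mxM phi (Ma R *m Mb R) (Mc R)).
  transitivity [:: phi (\tr (Ma R)); phi (\tr (Mb R)); phi (\tr (Mc R));
    phi (\tr (Ma R *m Mb R)); phi (\tr (Ma R *m Mc R)); phi (\tr (Mb R *m Mc R));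
    phi (\tr (Ma R *m Mb R *m Mc R))]; last by [].
  by congr [:: _; _; _; _; _; _; _]; exact: trace_map_mx.
by rewrite comp_mpolyXU evsXi (nth_map 0) // size_tuple.
Qed.

Lemma Jbor_ker :
  (forall g, g \in Jbor R -> phi g = 0) <->
  bor_rep (map_mx phi (Ma R)) (map_mx phi (Mb R)) (map_mx phi (Mc R)).
Proof. exact: rep_ker (Ma R) (Mb R) (Mc R). Qed.

End Traces.

Section Representations.
Variable R : realType.
Local Notation K := (CC R).

Definition cvec (S : comNzRingType) (A B C : 'M[S]_2) : seq S :=
  mxentries A ++ mxentries B ++ mxentries C.

Lemma univ_map (S : comNzRingType) (phi : P12 R -> S) (A B C : 'M[S]_2) :
  (forall i : 'I_12, phi 'X_i = (cvec A B C)`_i) ->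
  [/\ map_mx phi (Ma R) = A, map_mx phi (Mb R) = B & map_mx phi (Mc R) = C].
Proof.
move=> h.
have e o M : (o + 4 <= 12)%N ->
   (forall k, (k < 4)%N -> (cvec A B C)`_(o + k) = (mxentries M)`_k) -> map_mx phi (univM R o) = M.
  move=> ho hk; apply/matrixP => i j; rewrite !mxE h inordK; last first.
    by rewrite -addnA; apply: leq_trans ho; rewrite ltn_add2l;
       case: i => [[|[|//]] ?]; case: j => [[|[|//]] ?].
  rewrite -addnA hk; last by case: i => [[|[|//]] ?]; case: j => [[|[|//]] ?].
  by case: i => [[|[|//]] ?]; case: j => [[|[|//]] ?] /=; congr (M _ _); apply: val_inj.
by split; apply: e => // -[|[|[|[|//]]]].
Qed.

(** A representation is a point of the scheme cut out by [Jbor], so a polynomial in the kernel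
    vanishes at its character. Every inclusion of the kernel in a component ideal rests on this. *)
Lemma tau_of_rep (A B C : 'M[K]_2) f : bor_rep A B C -> in_ideal (Jbor R) (tau f) ->
  evs (@idfun K) 7 (trseq A B C) f = 0.
Proof.
move=> rABC.
pose phi : {rmorphism P12 R -> K} := evs (@idfun K) 12 (cvec A B C).
have [eA eB eC] := @univ_map K phi A B C (fun i => evsXi _ _ i).
have ker : forall g, g \in Jbor R -> phi g = 0 by apply/Jbor_ker; rewrite eA eB eC.
move=> /(in_ideal_ker ker); rewrite tau_ev eA eB eC => <-.
by apply: (@mpoly_rmorph_eq _ _ _ (evs idfun 7 _) (evs _ 7 _)) => [c|i]; rewrite ?evsC ?evsXi //= evsC.
Qed.

End Representations.

(** * I_Bor lies in the kernel *)

Section IdealLists.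
Variable T : comNzRingType.

Lemma in_ideal_cons (g : T) gs f :
  in_ideal (g :: gs) f <-> exists c f', in_ideal gs f' /\ f = c * g + f'.
Proof.
split; last first.
  move=> [c [f' [h ->]]]; apply: in_idealD; first by apply/in_idealM/in_ideal_gen; rewrite inE eqxx.
  by apply: in_ideal_trans h => x xin; apply: in_ideal_gen; rewrite inE xin orbT.
move: f; apply: (in_ideal_ind (gs := g :: gs)) => [|f1 f2 [c1 [f1' [h1 ->]]] [c2 [f2' [h2 ->]]]|c x].
  - by exists 0, 0; split; [apply: in_ideal0 | ring].
  - by exists (c1 + c2), (f1' + f2'); split; [apply: in_idealD | ring].
  - rewrite inE => /orP[/eqP ->|xin].
      by exists c, 0; split; [apply: in_ideal0 | ring].
    by exists 0, (c * x); split; [apply/in_idealM/in_ideal_gen | ring].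
Qed.

Lemma in_ideal_nil (f : T) : in_ideal [::] f -> f = 0.
Proof. by case=> cs ->; rewrite big_ord0. Qed.

Lemma in_ideal1 (a f : T) : in_ideal [:: a] f -> exists c, f = c * a.
Proof.
by move=> /in_ideal_cons[c [_ [/in_ideal_nil -> ->]]]; exists c; rewrite addr0.
Qed.

Lemma in_ideal2 (a b f : T) : in_ideal [:: a; b] f -> exists c d, f = c * a + d * b.
Proof. by move=> /in_ideal_cons[c [_ [/in_ideal1[d ->] ->]]]; exists c, d. Qed.

Lemma in_ideal3 (a b c f : T) : in_ideal [:: a; b; c] f ->
  exists x y z, f = x * a + (y * b + z * c).
Proof. by move=> /in_ideal_cons[x [_ [/in_ideal2[y [z ->]] ->]]]; exists x, y, z. Qed.

Lemma in_ideal4 (a b c d f : T) : in_ideal [:: a; b; c; d] f ->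
  exists x y z t, f = x * a + (y * b + (z * c + t * d)).
Proof. by move=> /in_ideal_cons[x [_ [/in_ideal3[y [z [t ->]]] ->]]]; exists x, y, z, t. Qed.

End IdealLists.

(* Integrality is a hypothesis, rather than a structure on T, so that these lemmas
   apply to polynomial rings without unfolding their instances. *)
Definition integral (T : comNzRingType) := forall a b : T, a * b = 0 -> b != 0 -> a = 0.

Section TwoSections.
Variables (T : comNzRingType) (x v w d : T) (e1 e2 : {rmorphism T -> T}).
Hypothesis T_integral : integral T.
Hypothesis two_neq0 : 2%:R != 0 :> T.
Hypothesis e1P : forall p, in_ideal [:: x - 1; v; w; d] (p - e1 p).
Hypothesis e2P : forall p, in_ideal [:: x + 1; v; w; d] (p - e2 p).
Hypothesis e2E : [/\ e2 x = -1, e2 v = 0, e2 w = 0 & e2 d = 0].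

(** Here [e1] and [e2] stand for the substitutions x = 1 and x = -1 with v = w = d = 0, so n
    vanishes on two parallel linear spaces. Writing n = a (x - 1) + ..., the second substitution
    gives -2 e2(a) = 0, which puts x + 1 into a modulo v, w, d. *)
Lemma two_sections n : e1 n = 0 -> e2 n = 0 -> in_ideal [:: x ^+ 2 - 1; v; w; d] n.
Proof.
move=> n1 n2; have := e1P n; rewrite n1 subr0 => /in_ideal4[a [b [c [t def_n]]]].
have a0 : e2 a = 0.
  move: n2; rewrite def_n !(rmorphD, rmorphM, rmorphN, rmorph1).
  case: e2E => -> -> -> ->; rewrite !mulr0 !addr0.
  have -> : -1 - 1 = - 2%:R :> T by ring.
  by move/T_integral; apply; rewrite oppr_eq0.
have := e2P a; rewrite a0 subr0 => /in_ideal4[a' [b' [c' [t' def_a]]]].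
apply/in_ideal_cons; exists a', ((b' * (x - 1) + b) * v + ((c' * (x - 1) + c) * w + (t' * (x - 1) + t) * d)).
split; last by rewrite def_n def_a; ring.
do 2![apply/in_ideal_cons; do 2!eexists; split; last reflexivity].
by apply/in_idealM/in_ideal_gen; rewrite inE.
Qed.

End TwoSections.

(** * The seven components other than X_0, in Gram coordinates *)

Section Minors.
Variables (T : comNzRingType) (x y z u v w d : T).

(** The cofactors of the Gram matrix with diagonal 1 - x^2, 1 - y^2, 1 - z^2 and off-diagonal
    entries w, v, u: the M are the off-diagonal cofactors, the N the diagonal ones. *)
Definition Mab := u * v - w * (1 - z ^+ 2).
Definition Mac := w * u - v * (1 - y ^+ 2).
Definition Mbc := v * w - u * (1 - x ^+ 2).
Definition Nbc := (1 - y ^+ 2) * (1 - z ^+ 2) - u ^+ 2.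
Definition Nac := (1 - x ^+ 2) * (1 - z ^+ 2) - v ^+ 2.
Definition Nab := (1 - x ^+ 2) * (1 - y ^+ 2) - w ^+ 2.
Definition gram_ideal := [:: Mab; Mac; Mbc; gram x y z u v w].

End Minors.

Section Intersection.
Variables (T : comNzRingType) (x y z u v w d : T).
Hypothesis T_integral : integral T.
Local Notation Mab := (Mab z u v w).
Local Notation Mac := (Mac y u v w).
Local Notation Mbc := (Mbc x u v w).
Local Notation Nbc := (Nbc y z u).
Local Notation Nac := (Nac x z v).
Local Notation Nab := (Nab x y w).
Local Notation gram_ideal := (gram_ideal x y z u v w).

(** The certificates are the entries of the identity Gram matrix times adjugate = determinant. *)
Lemma minor_products :
  [/\ forall t, t \in [:: x ^+ 2 - 1; v; w; d] -> in_ideal (d :: gram_ideal) (t * Nbc),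
      forall t, t \in [:: y ^+ 2 - 1; u; w; d] -> in_ideal (d :: gram_ideal) (t * Nac)
    & forall t, t \in [:: z ^+ 2 - 1; u; v; d] -> in_ideal (d :: gram_ideal) (t * Nab)].
Proof.
have mk t c0 c1 c2 c3 c4 :
    t = c0 * d + (c1 * Mab + (c2 * Mac + (c3 * Mbc + c4 * gram x y z u v w))) ->
    in_ideal (d :: gram_ideal) t.
  move=> ->; do 4![apply/in_ideal_cons; do 2!eexists; split; last reflexivity].
  by apply/in_idealM/in_ideal_gen; rewrite inE.
split=> t; rewrite !inE => /or4P[] /eqP ->.
- by apply: (mk _ 0 w v 0 (-1)); rewrite /Nbc /Mab /Mac /Mbc /gram; ring.
- by apply: (mk _ 0 (- u) (- (1 - z ^+ 2)) 0 0); rewrite /Nbc /Mab /Mac /Mbc /gram; ring.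
- by apply: (mk _ 0 (- (1 - y ^+ 2)) (- u) 0 0); rewrite /Nbc /Mab /Mac /Mbc /gram; ring.
- by apply: (mk _ Nbc 0 0 0 0); rewrite /Nbc; ring.
- by apply: (mk _ 0 w 0 u (-1)); rewrite /Nac /Mab /Mac /Mbc /gram; ring.
- by apply: (mk _ 0 (- v) 0 (- (1 - z ^+ 2)) 0); rewrite /Nac /Mab /Mac /Mbc /gram; ring.
- by apply: (mk _ 0 (- (1 - x ^+ 2)) 0 (- v) 0); rewrite /Nac /Mab /Mac /Mbc /gram; ring.
- by apply: (mk _ Nac 0 0 0 0); rewrite /Nac; ring.
- by apply: (mk _ 0 0 v u (-1)); rewrite /Nab /Mab /Mac /Mbc /gram; ring.
- by apply: (mk _ 0 0 (- w) (- (1 - y ^+ 2)) 0); rewrite /Nab /Mab /Mac /Mbc /gram; ring.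
- by apply: (mk _ 0 0 (- (1 - x ^+ 2)) (- w) 0); rewrite /Nab /Mab /Mac /Mbc /gram; ring.
- by apply: (mk _ Nab 0 0 0 0); rewrite /Nab; ring.
Qed.

(** An element of I_ns is g plus a combination of the three N. Vanishing on X_a^+ and X_a^-
    constrains only the coefficient of [Nbc], and similarly for b and c; [minor_products] then
    removes the N. So the ideal of the union of the seven components is generated by d, the M and
    the Gram determinant. *)
Lemma seven_components f (n1 n2 n3 g : T) :
  f = g + (n1 * Nbc + n2 * Nac + n3 * Nab) -> in_ideal (d :: gram_ideal) g ->
  in_ideal [:: x ^+ 2 - 1; v; w; d] n1 -> in_ideal [:: y ^+ 2 - 1; u; w; d] n2 ->
  in_ideal [:: z ^+ 2 - 1; u; v; d] n3 -> in_ideal (d :: gram_ideal) f.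
Proof.
have [p1 p2 p3] := minor_products.
have mul gs N : (forall t, t \in gs -> in_ideal (d :: gram_ideal) (t * N)) ->
    forall n, in_ideal gs n -> in_ideal (d :: gram_ideal) (n * N).
  move=> h; apply: (in_ideal_ind (gs := gs)) => [|a b ha hb|c a /h ha].
  - by rewrite mul0r; apply: in_ideal0.
  - by rewrite mulrDl; apply: in_idealD.
  - by rewrite -mulrA; apply: in_idealM.
move=> -> hg h1 h2 h3'; apply: in_idealD => //; apply: in_idealD; last exact: mul p3 _ h3'.
apply: in_idealD; [exact: mul p1 _ h1 | exact: mul p2 _ h2].
Qed.

(** The syzygies of the regular sequence w, v, u. The substitutions [s1] (v = w = 0) and [s2] (w =
    0) stand for reduction modulo the first terms, which makes the divisions explicit. *)
Lemma koszul (s1 s2 : {rmorphism T -> T}) (d3 d4 d5 : T) :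
  (forall p, in_ideal [:: v; w] (p - s1 p)) -> (forall p, in_ideal [:: w] (p - s2 p)) ->
  [/\ s1 u = u, s1 v = 0 & s1 w = 0] -> s2 v = v /\ s2 w = 0 ->
  u != 0 -> v != 0 -> w != 0 ->
  d3 * u + d4 * v + d5 * w = 0 ->
  exists a b c, [/\ d3 = a * v + b * w, d4 = c * w - a * u & d5 = - b * u - c * v].
Proof.
move=> s1P s2P [s1u s1v s1w] [s2v s2w] u0 v0 w0 e.
have z3 : s1 d3 = 0.
  have := congr1 s1 e; rewrite !rmorphD !rmorphM s1u s1v s1w !mulr0 !addr0 rmorph0.
  by move/T_integral; apply.
have := s1P d3; rewrite z3 subr0 => /in_ideal2[a [b def3]].
have e' : (d4 + a * u) * v + (d5 + b * u) * w = 0.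
  by rewrite -[RHS]e def3; ring.
have z4 : s2 (d4 + a * u) = 0.
  have := congr1 s2 e'; rewrite rmorphD (rmorphM s2 (d4 + a * u)) (rmorphM s2 (d5 + _)).
  rewrite s2v s2w mulr0 addr0 rmorph0.
  by move/T_integral; apply.
have := s2P (d4 + a * u); rewrite z4 subr0 => /in_ideal1[c def4].
have z5 : c * v + d5 + b * u = 0.
  have : (c * v + d5 + b * u) * w = 0 by rewrite -[RHS]e' def4; ring.
  by move/T_integral; apply.
exists a, b, c; split=> //.
  by rewrite -def4; ring.
by apply: subr0_eq; rewrite -[RHS]z5; ring.
Qed.

(* The ideal quotient I_0 / (kernel) is the image of the ideal (u, v, w) of the
   coordinate ring of the union of the other seven components, each of u, v, w
   corresponding to one of the h3's. *)
Lemma eighth_component (Q : comNzRingType) (q : {rmorphism T -> Q})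
    (del eps s1 s2 : {rmorphism T -> T}) f c1 c2 c3 c4 c5 c6 :
  2%:R != 0 :> T ->
  bor_eq (q x) (q y) (q z) (q u) (q v) (q w) (q d) ->
  (forall p, in_ideal [:: d] (p - del p)) -> (forall p, in_ideal [:: u; v; w] (p - eps p)) ->
  (forall p, in_ideal [:: v; w] (p - s1 p)) -> (forall p, in_ideal [:: w] (p - s2 p)) ->
  [/\ del x = x, del y = y & del z = z] ->
  [/\ del u = u, del v = v, del w = w & del d = 0] ->
  [/\ eps x = x, eps y = y & eps z = z] -> [/\ eps u = 0, eps v = 0 & eps w = 0] ->
  [/\ s1 u = u, s1 v = 0 & s1 w = 0] -> s2 v = v /\ s2 w = 0 ->
  u != 0 -> v != 0 -> w != 0 -> (1 - x ^+ 2) * (1 - y ^+ 2) * (1 - z ^+ 2) != 0 ->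
  in_ideal (d :: gram_ideal) f ->
  f = c1 * (x * u - y * v) + c2 * (y * v - z * w) + c3 * h3 x u v w d
    + c4 * h3 y v w u d + c5 * h3 z w u v d + c6 * (d ^+ 2 - gram x y z u v w) ->
  q f = 0.
Proof.
move=> two0 bor delP epsP s1P s2P [dx dy dz] [du dv dw dd] [ex ey ez] [eu ev ew] hs1 hs2.
move=> u0 v0 w0 g0 f7 f8.
(* By [bor_eq], x u - y v and y v - z w have the same images as the corresponding differences of the
   x h; these are the coefficients of the three h after this replacement. *)
pose C3 := c3 + x * c1; pose C4 := c4 - y * c1 + y * c2; pose C5 := c5 - z * c2.
have delD : [/\ del Mab = Mab, del Mac = Mac, del Mbc = Mbc & del (gram x y z u v w) = gram x y z u v w].
  rewrite /Mab /Mac /Mbc /gram.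
  by rewrite !(rmorphD, rmorphM, rmorphN, rmorphXn, rmorph1, rmorph_nat) dx dy dz du dv dw.
have [dMab dMac dMbc dG] := delD.
have f0 : in_ideal gram_ideal (del f).
  move: f7 => /in_ideal_cons[c [f' [f'in ->]]].
  rewrite rmorphD rmorphM dd mulr0 add0r; apply: in_ideal_morph f'in => g.
  by rewrite !inE => /or4P[] /eqP ->; rewrite ?dMab ?dMac ?dMbc ?dG; apply: in_ideal_gen;
     rewrite !inE eqxx ?orbT.
(* At d = 0 the three h become u + Mbc, v + Mac and w + Mab, so membership in the Gram ideal becomes
   a linear relation between u, v, w modulo that ideal. *)
have [m1 [m2 [m3 [e def]]]] : exists m1 m2 m3 e, del C3 * u + del C4 * v + del C5 * w
    = m1 * Mab + (m2 * Mac + (m3 * Mbc + e * gram x y z u v w)).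
  move: f0 => /in_ideal4[n1 [n2 [n3 [e0 def]]]].
  exists (n1 - del c5), (n2 - del c4), (n3 - del c3), (e0 + del c6).
  have := def; rewrite {1}f8 /C3 /C4 /C5 /h3.
  rewrite {1}/gram !(rmorphD, rmorphN, rmorphM, rmorphXn, rmorph1, rmorph_nat).
  rewrite dx dy dz du dv dw dd => def'.
  apply: subr0_eq; rewrite -[RHS](subrr (n1 * Mab + (n2 * Mac + (n3 * Mbc + e0 * gram x y z u v w)))).
  by rewrite -{1}def' /Mab /Mac /Mbc /gram; ring.
(* At u = v = w = 0 the three M vanish, and the Gram determinant reduces to its nonzero diagonal
   product; hence e lies in (u, v, w) and the relation becomes a genuine syzygy. *)
have e0 : eps e = 0.
  move: def; move: (del C3) (del C4) (del C5) => D3 D4 D5 def.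
  have := congr1 eps def; rewrite /Mab /Mac /Mbc /gram.
  rewrite !(rmorphD, rmorphM, rmorphN, rmorphXn, rmorph1, rmorph_nat) ex ey ez eu ev ew => h.
  have : eps e * ((1 - x ^+ 2) * (1 - y ^+ 2) * (1 - z ^+ 2)) = 0.
    apply: subr0_eq; rewrite -(subrr (eps D3 * 0 + eps D4 * 0 + eps D5 * 0)).
    by rewrite {1}h; ring.
  by move/T_integral; apply.
have := epsP e; rewrite e0 subr0 => /in_ideal3[e1 [e2 [e3 def_e]]].
pose G := gram x y z u v w.
have kos : (del C3 - m1 * v - m2 * w + m3 * (1 - x ^+ 2) - G * e1) * u
   + (del C4 + m2 * (1 - y ^+ 2) - m3 * w - G * e2) * v
   + (del C5 + m1 * (1 - z ^+ 2) - G * e3) * w = 0.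
  apply: subr0_eq; rewrite -(subrr (del C3 * u + del C4 * v + del C5 * w)) {2}def def_e.
  by rewrite /Mab /Mac /Mbc -/G; ring.
have [a [b [c [k3 k4 k5]]]] := koszul s1P s2P hs1 hs2 u0 v0 w0 kos.
have {k3}k3 : del C3 = a * v + b * w + m1 * v + m2 * w - m3 * (1 - x ^+ 2) + G * e1.
  by apply: subr0_eq; rewrite -[RHS](subrr (a * v + b * w)) -{1}k3; ring.
have {k4}k4 : del C4 = c * w - a * u - m2 * (1 - y ^+ 2) + m3 * w + G * e2.
  by apply: subr0_eq; rewrite -[RHS](subrr (c * w - a * u)) -{1}k4; ring.
have {k5}k5 : del C5 = - b * u - c * v - m1 * (1 - z ^+ 2) + G * e3.
  by apply: subr0_eq; rewrite -[RHS](subrr (- b * u - c * v)) -{1}k5; ring.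
case: bor => -[b1 b2 b3] [[b4 b5 b6 b7] [b8 b9 b10 b11 b12]].
set H3 := h3 (q x) _ _ _ _ in b1 b2 b3 b4 b5 b6 b7 b8 b9 b10 b11 b12.
set H4 := h3 (q y) _ _ _ _ in b1 b2 b3 b4 b5 b6 b7 b8 b9 b10 b11 b12.
set H5 := h3 (q z) _ _ _ _ in b1 b2 b3 b4 b5 b6 b7 b8 b9 b10 b11 b12.
have qG : q G = q d ^+ 2.
  by rewrite b1 /G /gram !(rmorphD, rmorphM, rmorphN, rmorphXn, rmorph1, rmorph_nat).
(* Since d kills each h, their coefficients matter only modulo d. *)
have qdel C H : q d * H = 0 -> q C * H = q (del C) * H.
  move=> dH; have /in_ideal1[r hr] := delP C.
  by apply: subr0_eq; rewrite -mulrBl -rmorphB hr rmorphM -mulrA dH mulr0.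
have -> : q f = q C3 * H3 + q C4 * H4 + q C5 * H5.
  transitivity (q c1 * (q x * q u - q y * q v) + q c2 * (q y * q v - q z * q w) + q c3 * H3
    + q c4 * H4 + q c5 * H5 + q c6 * (q d ^+ 2 - gram (q x) (q y) (q z) (q u) (q v) (q w))).
    rewrite f8 /H3 /H4 /H5 /h3 /gram.
    by rewrite !(rmorphD, rmorphN, rmorphM, rmorphXn, rmorph1, rmorph_nat).
  rewrite b1 b2 b3 /C3 /C4 /C5 !(rmorphD, rmorphN, rmorphM); ring.
clearbody G.
rewrite (qdel _ _ b10) (qdel _ _ b11) (qdel _ _ b12) k3 k4 k5.
rewrite !(rmorphD, rmorphN, rmorphM, rmorphXn, rmorph1) qG.
(* The Koszul coefficients a, b, c meet the proportionality of (H3, H4, H5) to (u, v, w), the m meet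
   the relations with the diagonal entries, and the Gram terms carry a factor d^2. *)
transitivity (q a * (q v * H3 - q u * H4) + q b * (q w * H3 - q u * H5)
  + q c * (q w * H4 - q v * H5) + q m1 * (q v * H3 - (1 - q z ^+ 2) * H5)
  + q m2 * (q w * H3 - (1 - q y ^+ 2) * H4) + q m3 * (q w * H4 - (1 - q x ^+ 2) * H3)
  + q d * q e1 * (q d * H3) + q d * q e2 * (q d * H4) + q d * q e3 * (q d * H5)); first by ring.
by rewrite b10 b11 b12 b8 b6 b4 b9 b7 b5; ring.
Qed.

End Intersection.

(** * The component ideals in Gram coordinates *)

Section GenericGenerators.
Variable T : comNzRingType.
Implicit Types (a b c ab ac bc abc s : T).

Definition pBg a b c ab ac bc := a * bc + b * ac + c * ab - a * b * c.
Definition qBg a b c ab ac bc :=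
  a ^+ 2 + b ^+ 2 + c ^+ 2 + ab ^+ 2 + ac ^+ 2 + bc ^+ 2
  + ab * ac * bc - a * b * ab - a * c * ac - b * c * bc - 4%:R.

(** One list serves all six affine components: I_b and I_c arise by permuting the arguments. *)
Definition Iag s a b c ab ac bc abc :=
  [:: a - s * 2%:R; ab - s * b; ac - s * c; abc - s * bc].
Definition Insg a b c ab ac bc abc :=
  [:: a ^+ 2 + b ^+ 2 + ab ^+ 2 - a * b * ab - 4%:R;
      a ^+ 2 + c ^+ 2 + ac ^+ 2 - a * c * ac - 4%:R;
      b ^+ 2 + c ^+ 2 + bc ^+ 2 - b * c * bc - 4%:R;
      a * pBg a b c ab ac bc - 2%:R * ab * ac - 4%:R * bc + 2%:R * b * c;
      b * pBg a b c ab ac bc - 2%:R * ab * bc - 4%:R * ac + 2%:R * a * c;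
      c * pBg a b c ab ac bc - 2%:R * ac * bc - 4%:R * ab + 2%:R * a * b;
      2%:R * abc - pBg a b c ab ac bc].
Definition I0g a b c ab ac bc abc :=
  [:: abc ^+ 2 - pBg a b c ab ac bc * abc + qBg a b c ab ac bc;
      a * bc - b * ac; b * ac - c * ab;
      a * abc - ab * ac; b * abc - ab * bc; c * abc - ac * bc].

(* The list of traces as a function of half traces and Gram data. *)
Definition tpt x y z u v w d : seq T :=
  [:: 2%:R * x; 2%:R * y; 2%:R * z; 2%:R * (x * y - w); 2%:R * (x * z - v);
      2%:R * (y * z - u); 2%:R * (x * y * z - x * u - y * v - z * w - d)].

Definition app7 (U : Type) (F : T -> T -> T -> T -> T -> T -> T -> U) (s : seq T) : U :=
  F s`_0 s`_1 s`_2 s`_3 s`_4 s`_5 s`_6.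

Lemma in_ideal_mul gs (g c h : T) : h = c * g -> g \in gs -> in_ideal gs h.
Proof. by move=> -> /in_ideal_gen; apply: in_idealM. Qed.

(** In these coordinates X_ns is the locus where the Gram matrix has rank at most one and the triple
    product vanishes. *)
Lemma Ins_tpt x y z u v w d h : h \in app7 Insg (tpt x y z u v w d) ->
  in_ideal [:: Nbc y z u; Nac x z v; Nab x y w; d; Mab z u v w; Mac y u v w; Mbc x u v w] h.
Proof.
rewrite /app7 /Insg /pBg /= !inE => /or4P[/eqP->|/eqP->|/eqP->|/or4P[/eqP->|/eqP->|/eqP->|/eqP->]].
- by apply: (@in_ideal_mul _ (Nab x y w) (- 4%:R)); [rewrite /Nab; ring | rewrite !inE eqxx ?orbT].
- by apply: (@in_ideal_mul _ (Nac x z v) (- 4%:R)); [rewrite /Nac; ring | rewrite !inE eqxx ?orbT].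
- by apply: (@in_ideal_mul _ (Nbc y z u) (- 4%:R)); [rewrite /Nbc; ring | rewrite !inE eqxx ?orbT].
- by apply: (@in_ideal_mul _ (Mbc x u v w) (- 8%:R)); [rewrite /Mbc; ring | rewrite !inE eqxx ?orbT].
- by apply: (@in_ideal_mul _ (Mac y u v w) (- 8%:R)); [rewrite /Mac; ring | rewrite !inE eqxx ?orbT].
- by apply: (@in_ideal_mul _ (Mab z u v w) (- 8%:R)); [rewrite /Mab; ring | rewrite !inE eqxx ?orbT].
- by apply: (@in_ideal_mul _ d (- 4%:R)); [ring | rewrite !inE eqxx ?orbT].
Qed.

(** The generators of I_0 become multiples of the expressions occurring in [bor_eq]: x u = y v = z
    w, the vanishing of the three h, and d^2 = Gram determinant. *)
Lemma I0_tpt x y z u v w d h : h \in app7 I0g (tpt x y z u v w d) ->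
  in_ideal [:: x * u - y * v; y * v - z * w; h3 x u v w d; h3 y v w u d; h3 z w u v d;
    d ^+ 2 - gram x y z u v w] h.
Proof.
rewrite /app7 /I0g /pBg /qBg /= !inE => /or4P[/eqP->|/eqP->|/eqP->|/or3P[/eqP->|/eqP->|/eqP->]].
- by apply: (@in_ideal_mul _ (d ^+ 2 - gram x y z u v w) 4%:R); [rewrite /gram; ring | rewrite !inE eqxx ?orbT].
- by apply: (@in_ideal_mul _ (x * u - y * v) (- 4%:R)); [ring | rewrite !inE eqxx ?orbT].
- by apply: (@in_ideal_mul _ (y * v - z * w) (- 4%:R)); [ring | rewrite !inE eqxx ?orbT].
- by apply: (@in_ideal_mul _ (h3 x u v w d) (- 4%:R)); [rewrite /h3; ring | rewrite !inE eqxx ?orbT].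
- by apply: (@in_ideal_mul _ (h3 y v w u d) (- 4%:R)); [rewrite /h3; ring | rewrite !inE eqxx ?orbT].
- by apply: (@in_ideal_mul _ (h3 z w u v d) (- 4%:R)); [rewrite /h3; ring | rewrite !inE eqxx ?orbT].
Qed.

Lemma Ia_tpt s x y z u v w h :
  [/\ h \in app7 (Iag s) (tpt s y z u 0 0 0) -> h = 0,
      h \in app7 (fun a b c ab ac bc => Iag s b a c ab bc ac) (tpt x s z 0 v 0 0) -> h = 0
    & h \in app7 (fun a b c ab ac bc => Iag s c a b ac bc ab) (tpt x y s 0 0 w 0) -> h = 0].
Proof.
rewrite /app7 /Iag /= !inE.
by split=> /or4P[] /eqP ->; ring.
Qed.

End GenericGenerators.

Section MapGenerators.
Variables (T U : comNzRingType) (phi : {rmorphism T -> U}).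
Let rmE := (rmorphD phi, rmorphN phi, rmorphM phi, rmorphXn phi, rmorph1 phi,
            fun n => rmorph_nat phi n).

Lemma map_Iag s a b c ab ac bc abc : map phi (Iag s a b c ab ac bc abc) =
  Iag (phi s) (phi a) (phi b) (phi c) (phi ab) (phi ac) (phi bc) (phi abc).
Proof. by rewrite /Iag /= !rmE. Qed.

Lemma map_Insg a b c ab ac bc abc : map phi (Insg a b c ab ac bc abc) =
  Insg (phi a) (phi b) (phi c) (phi ab) (phi ac) (phi bc) (phi abc).
Proof. by rewrite /Insg /pBg /= !rmE. Qed.

Lemma map_I0g a b c ab ac bc abc : map phi (I0g a b c ab ac bc abc) =
  I0g (phi a) (phi b) (phi c) (phi ab) (phi ac) (phi bc) (phi abc).
Proof. by rewrite /I0g /pBg /qBg /= !rmE. Qed.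

End MapGenerators.

Section EvalGenerators.
Variables (R : realType) (U : comNzRingType).
Local Notation K := (CC R).
Variable f : {rmorphism K -> U}.
Implicit Type s : seq U.

Lemma evs_sgn s b : evs f 7 s (sgn R b) = if b then 1 else -1.
Proof. by rewrite /sgn; case: b; rewrite ?rmorphN1 ?rmorph1. Qed.

Lemma evs_t s : (evs f 7 s (ta R) = s`_0) * (evs f 7 s (tb R) = s`_1) *
  (evs f 7 s (tc R) = s`_2) * (evs f 7 s (tab R) = s`_3) * (evs f 7 s (tac R) = s`_4) *
  (evs f 7 s (tbc R) = s`_5) * (evs f 7 s (tabc R) = s`_6).
Proof. by do ![split]; apply: evsX. Qed.

Lemma evs_Ins s : map (evs f 7 s) (Ins R) = app7 (@Insg U) s.
Proof.
transitivity (map (evs f 7 s) (Insg (ta R) (tb R) (tc R) (tab R) (tac R) (tbc R) (tabc R))) => //.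
by rewrite map_Insg !evs_t.
Qed.

Lemma evs_I0 s : map (evs f 7 s) (I0 R) = app7 (@I0g U) s.
Proof.
transitivity (map (evs f 7 s) (I0g (ta R) (tb R) (tc R) (tab R) (tac R) (tbc R) (tabc R))) => //.
by rewrite map_I0g !evs_t.
Qed.

Lemma evs_Ia s b : map (evs f 7 s) (Ia R b) = app7 (Iag (if b then 1 else -1)) s.
Proof.
transitivity (map (evs f 7 s)
  (Iag (sgn R b) (ta R) (tb R) (tc R) (tab R) (tac R) (tbc R) (tabc R))) => //.
by rewrite map_Iag !evs_t evs_sgn.
Qed.

Lemma evs_Ib s b : map (evs f 7 s) (Ib R b) =
  app7 (fun a b' c ab ac bc => Iag (if b then 1 else -1) b' a c ab bc ac) s.
Proof.
transitivity (map (evs f 7 s)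
  (Iag (sgn R b) (tb R) (ta R) (tc R) (tab R) (tbc R) (tac R) (tabc R))) => //.
by rewrite map_Iag !evs_t evs_sgn.
Qed.

Lemma evs_Ic s b : map (evs f 7 s) (Ic R b) =
  app7 (fun a b' c ab ac bc => Iag (if b then 1 else -1) c a b' ac bc ab) s.
Proof.
transitivity (map (evs f 7 s)
  (Iag (sgn R b) (tc R) (ta R) (tb R) (tac R) (tbc R) (tab R) (tabc R))) => //.
by rewrite map_Iag !evs_t evs_sgn.
Qed.

End EvalGenerators.

Lemma in_ideal_map (T U : comNzRingType) (phi : {rmorphism T -> U}) gs hs f :
  (forall h, h \in map phi gs -> in_ideal hs h) -> in_ideal gs f -> in_ideal hs (phi f).
Proof. by move=> h; apply: in_ideal_morph => g gin; apply: h; apply: map_f. Qed.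

Lemma in_ideal_map0 (T U : comNzRingType) (phi : {rmorphism T -> U}) gs f :
  (forall h, h \in map phi gs -> h = 0) -> in_ideal gs f -> phi f = 0.
Proof. by move=> h; apply: in_ideal_ker => g gin; apply: h; apply: map_f. Qed.

Lemma evs_eq (K S : comNzRingType) (f g : {rmorphism K -> S}) n s p :
  f =1 g -> evs f n s p = evs g n s p.
Proof. by move=> e; apply: mpoly_rmorph_eq => [c|i]; rewrite ?evsC ?evsXi ?e. Qed.

Lemma map_tpt (T U : comNzRingType) (g : {rmorphism T -> U}) x y z u v w d :
  map g (tpt x y z u v w d) = tpt (g x) (g y) (g z) (g u) (g v) (g w) (g d).
Proof. by rewrite /tpt /= !(rmorphM, rmorphB, rmorph_nat). Qed.

Lemma trseq_qmx (S : comNzRingType) (x y z : S) a b c :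
  trseq (qmx x a) (qmx y b) (qmx z c)
  = tpt x y z (dot b c) (dot a c) (dot a b) (dot (cross a b) c).
Proof.
by rewrite /trseq /tpt !qmx_tr !qmx_mul_tr qmx_mul3_tr; congr [:: _; _; _; _; _; _; _]; ring.
Qed.

Lemma qmx_of_mx (S : comNzRingType) (h : S) (A : 'M[S]_2) : 2%:R * h = 1 ->
  exists x a, A = qmx x a.
Proof.
move=> h2; exists (h * (A 0 0 + A 1 1)), (h * (A 0 0 - A 1 1), h * A 0 1, A 1 0).
rewrite [LHS]mx2_eta /qmx /=; congr mx2.
- by transitivity ((2%:R * h) * A 0 0); [rewrite h2 mul1r | ring].
- by rewrite mulrA h2 mul1r.
- by transitivity ((2%:R * h) * A 1 1); [rewrite h2 mul1r | ring].
Qed.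

Section Splitting.
Variables (T : comNzRingType) (x y z u v w d : T).

Lemma Ins_ideal_split p : in_ideal
    [:: Nbc y z u; Nac x z v; Nab x y w; d; Mab z u v w; Mac y u v w; Mbc x u v w] p ->
  exists n1 n2 n3 g, in_ideal (d :: gram_ideal x y z u v w) g /\
    p = g + (n1 * Nbc y z u + n2 * Nac x z v + n3 * Nab x y w).
Proof.
move=> /in_ideal_cons[n1 [_ [/in_ideal_cons[n2 [_ [/in_ideal_cons[n3 [g [hg ->]]] ->]]] ->]]].
exists n1, n2, n3, g; split; last by ring.
apply: in_ideal_trans hg => t tin; apply: in_ideal_gen; move: tin.
by rewrite !inE => /or4P[] ->; rewrite ?orbT.
Qed.

Lemma I0_ideal_split p : in_ideal [:: x * u - y * v; y * v - z * w; h3 x u v w d;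
    h3 y v w u d; h3 z w u v d; d ^+ 2 - gram x y z u v w] p ->
  exists c1 c2 c3 c4 c5 c6,
  p = c1 * (x * u - y * v) + c2 * (y * v - z * w) + c3 * h3 x u v w d
    + c4 * h3 y v w u d + c5 * h3 z w u v d + c6 * (d ^+ 2 - gram x y z u v w).
Proof.
move=> /in_ideal_cons[c1 [_ [/in_ideal_cons[c2 [_ [/in_ideal4[c3 [c4 [c5 [c6 ->]]]] ->]]] ->]]].
by exists c1, c2, c3, c4, c5, c6; ring.
Qed.

End Splitting.

Ltac mod_vars cong := apply: (cong) => /=; rewrite ?opprK ?subrr ?subr0;
  first [exact: in_ideal0 | by apply: in_ideal_gen; rewrite !inE eqxx ?orbT].

(** * Assembling the inclusion of I_Bor in the kernel *)

Section AbstractReverse.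
Variables (T : comNzRingType) (x y z u v w d : T) (sub : seq T -> {rmorphism T -> T}).
Hypothesis T_integral : integral T.
Hypothesis two_neq0 : 2%:R != 0 :> T.
Hypothesis sub_cong : forall gs s, in_ideal gs (x - s`_0) -> in_ideal gs (y - s`_1) ->
  in_ideal gs (z - s`_2) -> in_ideal gs (u - s`_3) -> in_ideal gs (v - s`_4) ->
  in_ideal gs (w - s`_5) -> in_ideal gs (d - s`_6) -> forall p, in_ideal gs (p - sub s p).
Hypothesis sub_gen : forall s, [/\ sub s x = s`_0, sub s y = s`_1, sub s z = s`_2 & sub s u = s`_3] /\
  [/\ sub s v = s`_4, sub s w = s`_5 & sub s d = s`_6].
Hypotheses (u0 : u != 0) (v0 : v != 0) (w0 : w != 0).
Hypotheses (Nbc0 : Nbc y z u != 0) (Nac0 : Nac x z v != 0) (Nab0 : Nab x y w != 0).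
Hypothesis (diag0 : (1 - x ^+ 2) * (1 - y ^+ 2) * (1 - z ^+ 2) != 0).

(** On X_a^+ and X_a^- the elements d, the M, the Gram determinant and two of the N vanish, while
    the third N restricts to a nonzero polynomial; the restriction of f is therefore that of n1
    times a nonzero factor. *)
Lemma section_eq0 (e : {rmorphism T -> T}) g n1 n2 n3 (N1 N2 N3 : T) :
  in_ideal (d :: gram_ideal x y z u v w) g ->
  e d = 0 -> e (Mab z u v w) = 0 -> e (Mac y u v w) = 0 -> e (Mbc x u v w) = 0 ->
  e (gram x y z u v w) = 0 -> e N2 = 0 -> e N3 = 0 -> e N1 != 0 ->
  e (g + (n1 * N1 + n2 * N2 + n3 * N3)) = 0 -> e n1 = 0.
Proof.
move=> hg ed e1 e2 e3 e4 eN2 eN3 eN1.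
have -> : e (g + (n1 * N1 + n2 * N2 + n3 * N3)) = e n1 * e N1.
  rewrite !rmorphD !rmorphM eN2 eN3 (_ : e g = 0); first by ring.
  apply: in_ideal_ker hg => t; rewrite inE => /orP[/eqP -> //|].
  by rewrite !inE => /or4P[] /eqP ->.
by move/T_integral; apply.
Qed.

Lemma reverse_abstract (Q : comNzRingType) (q : {rmorphism T -> Q}) f
    n1 n2 n3 g c1 c2 c3 c4 c5 c6 :
  bor_eq (q x) (q y) (q z) (q u) (q v) (q w) (q d) ->
  in_ideal (d :: gram_ideal x y z u v w) g ->
  f = g + (n1 * Nbc y z u + n2 * Nac x z v + n3 * Nab x y w) ->
  f = c1 * (x * u - y * v) + c2 * (y * v - z * w) + c3 * h3 x u v w d
    + c4 * h3 y v w u d + c5 * h3 z w u v d + c6 * (d ^+ 2 - gram x y z u v w) ->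
  (forall s, s = 1 \/ s = -1 -> [/\ sub [:: s; y; z; u; 0; 0; 0] f = 0,
     sub [:: x; s; z; 0; v; 0; 0] f = 0 & sub [:: x; y; s; 0; 0; w; 0] f = 0]) ->
  q f = 0.
Proof.
move=> bor hg f7 f8 fs.
have sa s : s = 1 \/ s = -1 -> sub [:: s; y; z; u; 0; 0; 0] n1 = 0.
  move=> hs; have [ef _ _] := fs s hs; rewrite f7 in ef.
  have [/= [ex ey ez eu] [ev ew ed]] := sub_gen [:: s; y; z; u; 0; 0; 0].
  apply: (section_eq0 hg ed _ _ _ _ _ _ _ ef);
    rewrite /Mab /Mac /Mbc /gram /Nac /Nab /Nbc !(rmorphD, rmorphN, rmorphM, rmorphXn, rmorph1, rmorph_nat);
    rewrite ?ex ?ey ?ez ?eu ?ev ?ew; first [exact: Nbc0 | ring | case: hs => ->; ring].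
have sb s : s = 1 \/ s = -1 -> sub [:: x; s; z; 0; v; 0; 0] n2 = 0.
  move=> hs; have [_ ef _] := fs s hs; rewrite f7 [_ + n2 * _]addrC in ef.
  have [/= [ex ey ez eu] [ev ew ed]] := sub_gen [:: x; s; z; 0; v; 0; 0].
  apply: (section_eq0 hg ed _ _ _ _ _ _ _ ef);
    rewrite /Mab /Mac /Mbc /gram /Nac /Nab /Nbc !(rmorphD, rmorphN, rmorphM, rmorphXn, rmorph1, rmorph_nat);
    rewrite ?ex ?ey ?ez ?eu ?ev ?ew; first [exact: Nac0 | ring | case: hs => ->; ring].
have sc s : s = 1 \/ s = -1 -> sub [:: x; y; s; 0; 0; w; 0] n3 = 0.
  move=> hs; have [_ _ ef] := fs s hs; rewrite f7 [_ + n3 * _]addrC [X in g + X]addrA in ef.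
  have [/= [ex ey ez eu] [ev ew ed]] := sub_gen [:: x; y; s; 0; 0; w; 0].
  apply: (section_eq0 hg ed _ _ _ _ _ _ _ ef);
    rewrite /Mab /Mac /Mbc /gram /Nac /Nab /Nbc !(rmorphD, rmorphN, rmorphM, rmorphXn, rmorph1, rmorph_nat);
    rewrite ?ex ?ey ?ez ?eu ?ev ?ew; first [exact: Nab0 | ring | case: hs => ->; ring].
have i1 : in_ideal [:: x ^+ 2 - 1; v; w; d] n1.
  apply: (@two_sections _ x v w d (sub [:: 1; y; z; u; 0; 0; 0]) (sub [:: -1; y; z; u; 0; 0; 0]));
    rewrite ?sa //; first 3 last.
  - by left.
  - by right.
  - by mod_vars sub_cong.
  - by mod_vars sub_cong.
  - by have [/= [-> _ _ _] [-> -> ->]] := sub_gen [:: -1; y; z; u; 0; 0; 0].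
have i2 : in_ideal [:: y ^+ 2 - 1; u; w; d] n2.
  apply: (@two_sections _ y u w d (sub [:: x; 1; z; 0; v; 0; 0]) (sub [:: x; -1; z; 0; v; 0; 0]));
    rewrite ?sb //; first 3 last.
  - by left.
  - by right.
  - by mod_vars sub_cong.
  - by mod_vars sub_cong.
  - by have [/= [_ -> _ ->] [_ -> ->]] := sub_gen [:: x; -1; z; 0; v; 0; 0].
have i3 : in_ideal [:: z ^+ 2 - 1; u; v; d] n3.
  apply: (@two_sections _ z u v d (sub [:: x; y; 1; 0; 0; w; 0]) (sub [:: x; y; -1; 0; 0; w; 0]));
    rewrite ?sc //; first 3 last.
  - by left.
  - by right.
  - by mod_vars sub_cong.
  - by mod_vars sub_cong.
  - by have [/= [_ _ -> ->] [-> _ ->]] := sub_gen [:: x; y; -1; 0; 0; w; 0].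
have f7' := seven_components f7 hg i1 i2 i3.
apply: (@eighth_component _ x y z u v w d T_integral Q q (sub [:: x; y; z; u; v; w; 0])
  (sub [:: x; y; z; 0; 0; 0; d]) (sub [:: x; y; z; u; 0; 0; d]) (sub [:: x; y; z; u; v; 0; d])
  f c1 c2 c3 c4 c5 c6) => //.
1-4: by mod_vars sub_cong.
all: by have [/= [? ? ? ?] [? ? ?]] := sub_gen [:: x; y; z; u; v; w; 0];
  have [/= [? ? ? ?] [? ? ?]] := sub_gen [:: x; y; z; 0; 0; 0; d];
  have [/= [? ? ? ?] [? ? ?]] := sub_gen [:: x; y; z; u; 0; 0; d];
  have [/= [? ? ? ?] [? ? ?]] := sub_gen [:: x; y; z; u; v; 0; d].
Qed.

End AbstractReverse.

Section ComponentEvaluation.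
Variables (R : realType) (U : comNzRingType) (f : {rmorphism CC R -> U}).

Lemma evs_Ia0 b p y z u : in_ideal (Ia R b) p ->
  evs f 7 (tpt (if b then 1 else -1) y z u 0 0 0) p = 0.
Proof.
apply: in_ideal_map0 => h; rewrite evs_Ia.
by case: (Ia_tpt (if b then 1 else -1) 0 y z u 0 0 h).
Qed.

Lemma evs_Ib0 b p x z v : in_ideal (Ib R b) p ->
  evs f 7 (tpt x (if b then 1 else -1) z 0 v 0 0) p = 0.
Proof.
apply: in_ideal_map0 => h; rewrite evs_Ib.
by case: (Ia_tpt (if b then 1 else -1) x 0 z 0 v 0 h).
Qed.

Lemma evs_Ic0 b p x y w : in_ideal (Ic R b) p ->
  evs f 7 (tpt x y (if b then 1 else -1) 0 0 w 0) p = 0.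
Proof.
apply: in_ideal_map0 => h; rewrite evs_Ic.
by case: (Ia_tpt (if b then 1 else -1) x y 0 0 0 w h).
Qed.

End ComponentEvaluation.

Lemma diag_neq0 (T U : comNzRingType) (phi : {rmorphism T -> U}) x y z : phi x = 0 ->
  phi y = 0 -> phi z = 0 ->
  (1 - x ^+ 2) * (1 - y ^+ 2) * (1 - z ^+ 2) != 0 /\ Nbc x y z != 0.
Proof.
move=> hx hy hz; have neq0 t : phi t = 1 -> t != 0.
  by move=> e; apply: contra_eq_neq e => ->; rewrite rmorph0 eq_sym oner_neq0.
by split; apply: neq0; rewrite /Nbc !(rmorphD, rmorphN, rmorphM, rmorphXn, rmorph1) hx hy hz; ring.
Qed.

Section KernelReverse.
Variable R : realType.
Local Notation K := (CC R).
Local Notation T := (P7 R).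
Local Notation X k := ('X_(inord k) : T).

Let sub (s : seq T) : {rmorphism T -> T} := evs (@mpolyC 7 K) 7 s.

Lemma sub_cong (gs s : seq T) :
  (forall k, (k < 7)%N -> in_ideal gs (X k - s`_k)) ->
  forall p, in_ideal gs (p - sub s p).
Proof.
move=> h p; apply: (mpoly_rmorph_cong (phi := idfun) (psi := sub s)) => [c|i].
  by rewrite evsC.
by rewrite evsXi /=; have := h i (ltn_ord i); rewrite inord_val.
Qed.

(** The seven variables of the trace ring are reused as Gram coordinates, and [cg] substitutes the
    traces written in them. *)
Let x : T := X 0. Let y : T := X 1. Let z : T := X 2. Let u : T := X 3.
Let v : T := X 4. Let w : T := X 5. Let d : T := X 6.
Let cg : {rmorphism T -> T} := sub (tpt x y z u v w d).

Lemma sub_gen s : [/\ sub s x = s`_0, sub s y = s`_1, sub s z = s`_2 & sub s u = s`_3] /\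
  [/\ sub s v = s`_4, sub s w = s`_5 & sub s d = s`_6].
Proof. by do ![split]; apply: evsX. Qed.

Lemma sub_cg s f : sub s (cg f) = sub (tpt s`_0 s`_1 s`_2 s`_3 s`_4 s`_5 s`_6) f.
Proof.
have e := evs_comp (@mpolyC 7 K) (sub s) (tpt x y z u v w d) f.
apply: etrans e _.
have e1 : map (sub s) (tpt x y z u v w d) = tpt s`_0 s`_1 s`_2 s`_3 s`_4 s`_5 s`_6.
  apply: etrans (map_tpt (sub s) x y z u v w d) _.
  by congr (tpt _ _ _ _ _ _ _); apply: evsX.
rewrite e1.
by apply: evs_eq => c /=; apply: evsC.
Qed.

Lemma P7_integral : integral T.
Proof. by move=> a b /eqP; rewrite mulf_eq0 => /orP[/eqP //|->]. Qed.

Lemma Ins_cg f : in_ideal (Ins R) f -> exists n1 n2 n3 g,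
  in_ideal (d :: gram_ideal x y z u v w) g /\
  cg f = g + (n1 * Nbc y z u + n2 * Nac x z v + n3 * Nab x y w).
Proof.
move=> /(@in_ideal_map _ _ cg) => h.
have := h [:: Nbc y z u; Nac x z v; Nab x y w; d; Mab z u v w; Mac y u v w; Mbc x u v w].
rewrite evs_Ins => /(_ (fun h => @Ins_tpt T x y z u v w d h)).
exact: Ins_ideal_split.
Qed.

Lemma I0_cg f : in_ideal (I0 R) f -> exists c1 c2 c3 c4 c5 c6,
  cg f = c1 * (x * u - y * v) + c2 * (y * v - z * w) + c3 * h3 x u v w d
    + c4 * h3 y v w u d + c5 * h3 z w u v d + c6 * (d ^+ 2 - gram x y z u v w).
Proof.
move=> /(@in_ideal_map _ _ cg) => h.
have := h [:: x * u - y * v; y * v - z * w; h3 x u v w d; h3 y v w u d; h3 z w u v d;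
    d ^+ 2 - gram x y z u v w].
rewrite evs_I0 => /(_ (fun h => @I0_tpt T x y z u v w d h)).
exact: I0_ideal_split.
Qed.

Lemma sub_generators f : in_IBor f ->
  forall s, s = 1 \/ s = -1 -> [/\ sub [:: s; y; z; u; 0; 0; 0] (cg f) = 0,
     sub [:: x; s; z; 0; v; 0; 0] (cg f) = 0 & sub [:: x; y; s; 0; 0; w; 0] (cg f) = 0].
Proof.
move=> hf s hs.
have [b def_s] : exists b : bool, s = if b then 1 else -1.
  by case: hs => ->; [exists true | exists false].
have [ia [ib ic]] : in_ideal (Ia R b) f /\ in_ideal (Ib R b) f /\ in_ideal (Ic R b) f.
  split; [|split].
  - by case: (b); [have := hf (@Ordinal 8 1 isT) | have := hf (@Ordinal 8 2 isT)].
  - by case: (b); [have := hf (@Ordinal 8 3 isT) | have := hf (@Ordinal 8 4 isT)].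
  - by case: (b); [have := hf (@Ordinal 8 5 isT) | have := hf (@Ordinal 8 6 isT)].
rewrite {}def_s; split.
- apply: etrans (sub_cg _ f) _; exact: evs_Ia0.
- apply: etrans (sub_cg _ f) _; exact: evs_Ib0.
- apply: etrans (sub_cg _ f) _; exact: evs_Ic0.
Qed.

Lemma sub_cong7 gs s : in_ideal gs (x - s`_0) -> in_ideal gs (y - s`_1) ->
  in_ideal gs (z - s`_2) -> in_ideal gs (u - s`_3) -> in_ideal gs (v - s`_4) ->
  in_ideal gs (w - s`_5) -> in_ideal gs (d - s`_6) -> forall p, in_ideal gs (p - sub s p).
Proof. by move=> ? ? ? ? ? ? ?; apply: sub_cong => -[|[|[|[|[|[|[|//]]]]]]]. Qed.

Lemma mpoly_neq0_at (g : T) (s : seq K) c : evs (@idfun K) 7 s g = c -> c != 0 -> g != 0.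
Proof. by move=> <-; apply: contraNneq => ->; rewrite rmorph0. Qed.

(** In the quotient by [Jbor] the universal matrices are quaternions over a ring containing 1/2.
    Their Gram data satisfy [bor_eq], and the image of tau f is the value of [cg f] at these
    data. *)
Theorem kernel_reverse f : in_IBor f -> in_ideal (Jbor R) (tau f).
Proof.
move=> hf; have [J1|/quotient_ring[Q [pr prP]]] := pselect (in_ideal (Jbor R) 1).
  by rewrite -[tau f]mulr1; apply: in_idealM.
apply/prP; have : forall g, g \in Jbor R -> pr g = 0 by move=> g /in_ideal_gen/prP.
move=> /Jbor_ker; have := tau_ev pr f.
set A := map_mx _ _; set B := map_mx _ _; set C := map_mx _ _ => -> [[dA dB dC] [r1 r2 r3]].
set io := (X in evs X).
have h2 : 2%:R * io (2%:R^-1) = 1.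
  rewrite -(rmorph_nat io 2) -rmorphM divff ?rmorph1 //.
  by rewrite pnatr_eq0.
have [x' [a eA]] := qmx_of_mx A h2; have [y' [b eB]] := qmx_of_mx B h2.
have [z' [c eC]] := qmx_of_mx C h2.
rewrite eA eB eC in dA dB dC r1 r2 r3 *.
have bor := bor_eq_of_relators h2 dA dB dC r1 r2 r3.
rewrite trseq_qmx; move: bor.
move: (dot b c) (dot a c) (dot a b) (dot (cross a b) c) => u' v' w' d' bor.
pose q : {rmorphism T -> Q} := evs io 7 [:: x'; y'; z'; u'; v'; w'; d'].
have [qx qy qz qu] : [/\ q x = x', q y = y', q z = z' & q u = u'].
  by split; apply: evsX.
have [qv qw qd] : [/\ q v = v', q w = w' & q d = d'] by split; apply: evsX.
have e1 : map q (tpt x y z u v w d) = tpt x' y' z' u' v' w' d'.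
  by rewrite (map_tpt q x y z u v w d); congr (tpt _ _ _ _ _ _ _).
have -> : evs io 7 (tpt x' y' z' u' v' w' d') f = q (cg f).
  have := evs_comp (@mpolyC 7 K) q (tpt x y z u v w d) f; rewrite e1 => e2.
  by apply: etrans (esym e2); apply: evs_eq => c0; rewrite /= [RHS]evsC.
have [n1 [n2 [n3 [g [hg f7]]]]] := Ins_cg (hf (@Ordinal 8 0 isT)).
have [c1 [c2 [c3 [c4 [c5 [c6 f8]]]]]] := I0_cg (hf (@Ordinal 8 7 isT)).
have bor' : bor_eq (q x) (q y) (q z) (q u) (q v) (q w) (q d).
  by rewrite qx qy qz qu qv qw qd.
have n1K : 1 != 0 :> K by exact: oner_neq0.
(* The nonvanishing hypotheses are checked at points: u, v, w equal 1 here, and the three N and the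
   diagonal product equal 1 at the origin. *)
have evX k : (k < 7)%N -> evs (@idfun K) 7 [:: 0; 0; 0; 1; 1; 1; 1] (X k) = [:: 0; 0; 0; 1; 1; 1; 1]`_k.
  exact: evsX.
have evX0 k : (k < 7)%N -> evs (@idfun K) 7 [::] (X k) = [::]`_k by exact: evsX.
apply: (@reverse_abstract T x y z u v w d sub P7_integral _ sub_cong7 sub_gen _ _ _ _ _ _ _ Q q (cg f)
  n1 n2 n3 g c1 c2 c3 c4 c5 c6 bor' hg f7 f8 (sub_generators hf)).
- by apply: (@mpoly_neq0_at _ [::] 2%:R); rewrite ?rmorph_nat // pnatr_eq0.
- exact: (mpoly_neq0_at (evX 3 isT)).
- exact: (mpoly_neq0_at (evX 4 isT)).
- exact: (mpoly_neq0_at (evX 5 isT)).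
- exact: (diag_neq0 (evX0 1 isT) (evX0 2 isT) (evX0 3 isT)).2.
- exact: (diag_neq0 (evX0 0 isT) (evX0 2 isT) (evX0 4 isT)).2.
- exact: (diag_neq0 (evX0 0 isT) (evX0 1 isT) (evX0 5 isT)).2.
- exact: (diag_neq0 (evX0 0 isT) (evX0 1 isT) (evX0 2 isT)).1.
Qed.

End KernelReverse.

(** * Covariants of sl_2 *)

Section Covariants.
Variables (P : comNzRingType) (E F H : P -> P).
Hypotheses (ED : forall p q, E (p + q) = E p + E q) (FD : forall p q, F (p + q) = F p + F q)
  (HD : forall p q, H (p + q) = H p + H q).
Hypotheses (EM : forall p q, E (p * q) = E p * q + p * E q)
  (FM : forall p q, F (p * q) = F p * q + p * F q)
  (HM : forall p q, H (p * q) = H p * q + p * H q).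
Hypothesis EF : forall p, E (F p) = F (E p) + H p.
Hypothesis HF : forall p, H (F p) = F (H p) - 2%:R * F p.

(* S is a ring of invariants, V a set of highest weight vectors of weight 2. *)
Variables (S V : P -> Prop).
Hypotheses (S1 : S 1) (SB : forall p q, S p -> S q -> S (p - q))
  (SM : forall p q, S p -> S q -> S (p * q)).
Hypothesis S_inv : forall s, S s -> [/\ E s = 0, F s = 0 & H s = 0].
Hypothesis S_half : forall n, exists c : P, c * n.+1%:R = 1 /\ S c.
Hypothesis V_hw : forall f, V f -> [/\ E f = 0, H f = 2%:R * f & F (F (F f)) = 0].

(** The Clebsch-Gordan projections of two weight 2 vectors: [pair2] is, up to scale, their inner
    product, of weight 0, and [pair1] their cross product, again of weight 2. *)
Definition pair2 (f g : P) : P := F (F f) * g - F f * F g + f * F (F g).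
Definition pair1 (f g : P) : P := F f * g - f * F g.

Hypothesis V_pair2 : forall f g, V f -> V g -> S (pair2 f g).

Inductive Cov : nat -> P -> Prop :=
| Cov_prod s (l : seq P) : S s -> (forall f, f \in l -> V f) ->
    Cov (size l) (s * \prod_(f <- l) f)
| Cov_add m p q : Cov m p -> Cov m q -> Cov m (p + q)
| Cov_zero m : Cov m 0.

Lemma S0 : S 0. Proof. by rewrite -(subrr 1); apply: SB. Qed.

Lemma SN s : S s -> S (- s). Proof. by rewrite -sub0r; apply: SB S0. Qed.

Lemma SD s t : S s -> S t -> S (s + t).
Proof. by move=> hs ht; rewrite -[t]opprK; apply: SB => //; apply: SN. Qed.

Lemma Snat n : S n%:R.
Proof. by elim: n => [|n IH]; [exact: S0 | rewrite -addn1 natrD; apply: SD]. Qed.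

Lemma Cov_scale m s p : S s -> Cov m p -> Cov m (s * p).
Proof.
move=> hs; elim=> [t l ht hl|{}m {}p q _ hp _ hq|{}m].
- by rewrite mulrA; apply: Cov_prod => //; apply: SM.
- by rewrite mulrDr; apply: Cov_add.
- by rewrite mulr0; apply: Cov_zero.
Qed.

Lemma Cov_mul m f p : V f -> Cov m p -> Cov m.+1 (f * p).
Proof.
move=> hf; elim=> [t l ht hl|{}m {}p q _ hp _ hq|{}m].
- rewrite mulrCA (_ : f * _ = \prod_(g <- f :: l) g); last by rewrite big_cons.
  apply: (@Cov_prod t (f :: l)) => // g; rewrite inE => /orP[/eqP -> //|]; exact: hl.
- by rewrite mulrDr; apply: Cov_add.
- by rewrite mulr0; apply: Cov_zero.
Qed.

Lemma Cov_S s : S s -> Cov 0 s.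
Proof.
move=> hs; have := @Cov_prod s [::] hs; rewrite big_nil mulr1; exact.
Qed.

Lemma Cov_list (l : seq P) : (forall f, f \in l -> V f) -> Cov (size l) (\prod_(f <- l) f).
Proof. by move=> hl; rewrite -[\prod_(_ <- _) _]mul1r; apply: Cov_prod. Qed.

Lemma E0 : E 0 = 0. Proof. by case: (S_inv S0). Qed.
Lemma F0 : F 0 = 0. Proof. by case: (S_inv S0). Qed.
Lemma H0 : H 0 = 0. Proof. by case: (S_inv S0). Qed.

Lemma FZ s p : S s -> F (s * p) = s * F p.
Proof. by case/S_inv => _ Fs _; rewrite FM Fs mul0r add0r. Qed.

Lemma FN p : F (- p) = - F p.
Proof. by rewrite -[in LHS]mulN1r FZ ?mulN1r //; apply: SN. Qed.

Lemma Cov_weight m p : Cov m p -> E p = 0 /\ H p = (2 * m)%:R * p.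
Proof.
elim=> [s l hs|{}m {}p q _ [Ep Hp] _ [Eq Hq]|{}m].
- elim: l => [|f l IH] hl.
    by rewrite big_nil mulr1 muln0 mul0r; case: (S_inv hs).
  have [g gl|Ey Hy] := IH; first by apply: hl; rewrite inE gl orbT.
  have [Ef Hf _] : [/\ E f = 0, H f = 2%:R * f & F (F (F f)) = 0].
    by apply/V_hw/hl; rewrite inE eqxx.
  rewrite big_cons mulrCA EM HM Ey Hy Ef Hf mul0r mulr0 addr0; split=> //.
  by rewrite /= mulnS natrD; ring.
- by rewrite ED HD Ep Eq Hp Hq addr0; split=> //; ring.
- by rewrite E0 H0 mulr0.
Qed.

(* [trans1] and [trans2] are the transvectants of a with the product of l. *)
Definition trans1 a (m : P) y := m * F a * y - a * F y.
Definition trans2 a (m : P) y :=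
  m * (2%:R * m - 1) * F (F a) * y - (2%:R * m - 1) * F a * F y + a * F (F y).

(** The Leibniz extension of f -> [pair2 g f] to the product of l. *)
Fixpoint polar (g : P) (l : seq P) : P :=
  if l is f :: l' then pair2 g f * \prod_(h <- l') h + f * polar g l' else 0.

Lemma Cov_polar g (l : seq P) : V g -> (forall f, f \in l -> V f) -> l != [::] ->
  Cov (size l).-1 (polar g l).
Proof.
move=> hg; elim: l => [//|f l IH] hl _ /=.
have hf : V f by apply: hl; rewrite inE eqxx.
have {}hl (h : P) : h \in l -> V h by move=> hh; apply: hl; rewrite inE hh orbT.
apply: Cov_add; first by apply: Cov_scale (V_pair2 hg hf) _; apply: Cov_list.
case: l IH hl => [|f' l] IH hl; first by rewrite mulr0; apply: Cov_zero.
by apply: (Cov_mul hf); apply: IH.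
Qed.

Lemma polar_swap g h l (Y := \prod_(f <- l) f) :
  h * polar g l - g * polar h l =
  (size l)%:R * (F (F g) * h - g * F (F h)) * Y - (F g * h - g * F h) * F Y.
Proof.
rewrite {}/Y; elim: l => [|f l IH] /=.
  by rewrite big_nil; have [_ -> _] := S_inv S1; ring.
rewrite big_cons FM -addn1 natrD; set Y := \prod_(_ <- _) _ in IH *.
transitivity ((h * pair2 g f - g * pair2 h f) * Y + f * (h * polar g l - g * polar h l)).
  by ring.
by rewrite IH /pair2; ring.
Qed.

Lemma trans1_cons a f l (Y := \prod_(h <- l) h) :
  trans1 a (size l).+1%:R (f * Y) = pair1 a f * Y + f * trans1 a (size l)%:R Y.
Proof. by rewrite /trans1 /pair1 FM -addn1 natrD; ring. Qed.

(** The mixed terms, in which one F falls on f or a and the other on the remaining product, are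
    those of [polar_swap]. The second transvectant is thus built by induction from pairings and
    shorter products, which shows that it is a covariant of degree one less than the product. *)
Lemma trans2_cons a f l (Y := \prod_(h <- l) h) :
  trans2 a (size l).+1%:R (f * Y) = f * trans2 a (size l)%:R Y
    + (2%:R * (size l)%:R + 1) * (pair2 a f * Y) + 2%:R * (f * polar a l - a * polar f l).
Proof.
rewrite polar_swap -/Y /trans2 /pair2 !(FM, FD) -addn1 natrD; ring.
Qed.

Section MultiplicationBy.
Variable a : P.
Hypothesis Va : V a.
Hypothesis Va_pair1 : forall f, V f -> Cov 1 (pair1 a f).

Lemma Cov1_mul m f p : Cov 1 f -> Cov m p -> Cov m.+1 (f * p).
Proof.
move=> hf hp; suff gen m1 : Cov m1 f -> m1 = 1%N -> Cov m.+1 (f * p) by apply: gen hf _.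
elim=> [s l hs hl e|m' p1 p2 _ h1 _ h2 em|m' _]; last by rewrite mul0r; apply: Cov_zero.
  case: l hl e => [//|g [|//]] hl _; rewrite big_seq1 -mulrA.
  by apply: Cov_scale => //; apply: Cov_mul => //; apply: hl; rewrite inE eqxx.
by rewrite mulrDl; apply: Cov_add; auto.
Qed.

Lemma Cov_trans1 (l : seq P) : (forall f, f \in l -> V f) ->
  Cov (size l) (trans1 a (size l)%:R (\prod_(f <- l) f)).
Proof.
elim: l => [|f l IH] hl /=.
  by rewrite big_nil /trans1; have [_ -> _] := S_inv S1; rewrite !mul0r mulr0 subrr; apply: Cov_zero.
have hf : V f by apply: hl; rewrite inE eqxx.
have {}hl (h : P) : h \in l -> V h by move=> hh; apply: hl; rewrite inE hh orbT.
rewrite big_cons trans1_cons; apply: Cov_add; last by apply: Cov_mul => //; apply: IH.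
by apply: Cov1_mul; [apply: Va_pair1 | apply: Cov_list].
Qed.

Lemma Cov_trans2 (l : seq P) : (forall f, f \in l -> V f) -> l != [::] ->
  Cov (size l).-1 (trans2 a (size l)%:R (\prod_(f <- l) f)).
Proof.
elim: l => [//|f l IH] hl _ /=.
have hf : V f by apply: hl; rewrite inE eqxx.
have {}hl (h : P) : h \in l -> V h by move=> hh; apply: hl; rewrite inE hh orbT.
rewrite big_cons trans2_cons.
have step g : V g -> Cov (size l) (f * polar a l - a * polar f l + 0 * g).
  move=> _; rewrite mul0r addr0.
  case: l hl {IH} => [|f' l] hl; first by rewrite /= !mulr0 subrr; apply: Cov_zero.
  apply: Cov_add; first by apply: (Cov_mul hf); apply: (@Cov_polar a (f' :: l)).
  rewrite -mulN1r; apply: Cov_scale; first exact: SN.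
  by apply: (Cov_mul Va); apply: (@Cov_polar f (f' :: l)).
apply: Cov_add; last first.
  by apply: Cov_scale (Snat 2) _; have := step a Va; rewrite mul0r addr0.
apply: Cov_add; last first.
  apply: Cov_scale; first by apply: SD => //; apply: SM; apply: Snat.
  by apply: Cov_scale (V_pair2 Va hf) _; apply: Cov_list.
case: l hl IH {step} => [|f' l] hl IH; last by apply: (Cov_mul hf); apply: IH.
rewrite big_nil /trans2; have [_ F1 _] := S_inv S1.
by rewrite F1 F0 !mul0r !mulr0 subrr addr0 mulr0; apply: Cov_zero.
Qed.

Lemma iterF0 k : iter k F 0 = 0.
Proof. by elim: k => //= k ->; rewrite F0. Qed.

Lemma iterFD k p q : iter k F (p + q) = iter k F p + iter k F q.
Proof. by elim: k => //= k ->; rewrite FD. Qed.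

Lemma iterFZ k s p : S s -> iter k F (s * p) = s * iter k F p.
Proof. by move=> hs; elim: k => //= k ->; rewrite FZ. Qed.

Lemma iterFN k p : iter k F (- p) = - iter k F p.
Proof. by elim: k => //= k ->; rewrite FN. Qed.

Lemma iterF_a2 k y : iter k F (F (F a) * y) = F (F a) * iter k F y.
Proof. by elim: k => //= k ->; rewrite FM; have [_ _ ->] := V_hw Va; rewrite mul0r add0r. Qed.

Lemma iterF_a1 k y : iter k.+1 F (F a * y) =
  F a * iter k.+1 F y + k.+1%:R * (F (F a) * iter k F y).
Proof.
elim: k => [|k IH] /=; first by rewrite FM; ring.
rewrite [F (iter k F _)]IH /= !(FD, FM); have [_ -> _] := S_inv (Snat k.+1).
have [_ _ ->] := V_hw Va; rewrite -(addn1 k.+1) natrD.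
move: (F (F (iter k F y))) (F (iter k F y)) (F (F a)) (iter k F y) (F a) => ? ? ? ? ?; ring.
Qed.

Lemma iterF_a0 k y : iter k.+2 F (a * y) = a * iter k.+2 F y
  + k.+2%:R * (F a * iter k.+1 F y) + 'C(k.+2, 2)%:R * (F (F a) * iter k F y).
Proof.
elim: k => [|k IH] /=; first by rewrite !(FD, FM) binn; ring.
rewrite -[LHS]/(F (iter k.+2 F (a * y))) IH /= 2!FD !(FZ _ (Snat _)) (FM a) (FM (F a)).
rewrite (FM (F (F a))); have [_ _ ->] := V_hw Va.
rewrite [in RHS]binS bin1 natrD -[k.+3]addn1 natrD.
move: (F (F (F (iter k F y)))) (F (F (iter k F y))) (F (iter k F y)) (F (F a)) (iter k F y) (F a).
move=> ? ? ? ? ? ?; ring.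
Qed.

Lemma iterF_a0F k y : iter k.+1 F (a * F y) = a * iter k.+2 F y
  + k.+1%:R * (F a * iter k.+1 F y) + 'C(k.+1, 2)%:R * (F (F a) * iter k F y).
Proof.
case: k => [|k]; first by rewrite /= FM bin_small //; ring.
by rewrite iterF_a0 -!iterSr.
Qed.

Lemma iterF_a0FF k y : iter k F (a * F (F y)) = a * iter k.+2 F y
  + k%:R * (F a * iter k.+1 F y) + 'C(k, 2)%:R * (F (F a) * iter k F y).
Proof.
case: k => [|k]; first by rewrite bin0n /=; ring.
by rewrite iterF_a0F -!iterSr.
Qed.

Lemma iterF_a1F k y : iter k F (F a * F y) =
  F a * iter k.+1 F y + k%:R * (F (F a) * iter k F y).
Proof.
case: k => [|k]; first by rewrite /=; ring.
by rewrite iterF_a1 -!iterSr.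
Qed.

(* Clebsch-Gordan: [a * F^k y] in terms of [F^k (a y)] and the two transvectants. *)
Lemma mul_iterF (m : nat) k y (M := m%:R) (K : P := k%:R) :
  2%:R * M * (2%:R * M + 1) * (2%:R * M + 2%:R) * (a * iter k.+2 F y) =
  2%:R * M * (2%:R * M - K - 1) * (2%:R * M - K) * iter k.+2 F (a * y)
  - 2%:R * (K + 2%:R) * (2%:R * M - K - 1) * (2%:R * M + 1) * iter k.+1 F (trans1 a M y)
  + (K + 2%:R) * (K + 1) * (2%:R * M + 2%:R) * iter k F (trans2 a M y).
Proof.
have SM' : S M by apply: Snat.
have S2M : S (2%:R * M - 1) by apply: SB => //; apply: SM => //; apply: (Snat 2).
have -> : iter k.+1 F (trans1 a M y) = M * iter k.+1 F (F a * y) - iter k.+1 F (a * F y).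
  rewrite /trans1 iterFD -mulrA iterFZ //; congr (_ + _).
  exact: iterFN.
have -> : iter k F (trans2 a M y) = M * (2%:R * M - 1) * iter k F (F (F a) * y)
    - (2%:R * M - 1) * iter k F (F a * F y) + iter k F (a * F (F y)).
  rewrite /trans2 !iterFD; congr (_ + _ + _); first by rewrite -[in LHS]mulrA iterFZ //; apply: SM.
  by rewrite iterFN -mulrA iterFZ.
rewrite iterF_a0 iterF_a0F iterF_a0FF iterF_a1 iterF_a1F iterF_a2.
have c2 : 2%:R * 'C(k, 2)%:R - K ^+ 2 + K = 0.
  have e : (2 * 'C(k, 2) + k = k * k)%N.
    by elim: (k) => [//|j IH]; rewrite binS bin1; nia.
  have := congr1 (fun n => n%:R : P) e; rewrite /= natrD !natrM -/K => e'.
  by rewrite expr2 -e'; ring.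
have -> : 'C(k.+2, 2)%:R = 'C(k, 2)%:R + 2%:R * K + 1 :> P.
  by rewrite !binS !bin1 bin0 !natrD /K; ring.
have -> : 'C(k.+1, 2)%:R = 'C(k, 2)%:R + K :> P by rewrite binS bin1 natrD.
have -> : k.+2%:R = K + 2%:R :> P by rewrite -addn2 natrD.
have -> : k.+1%:R = K + 1 :> P by rewrite -addn1 natrD.
move: ('C(k, 2)%:R) c2 => c c2.
move: (a * iter k.+2 F y) (F a * iter k.+1 F y) (F (F a) * iter k F y) => X0 X1 X2.
rewrite -/K; clearbody M K; apply: subr0_eq.
transitivity (- (M * (2%:R * M - K - 1) * (2%:R * M - K) + (K + 2%:R) * (2%:R * M - K - 1) * (2%:R * M + 1)
   + (K + 2%:R) * (K + 1) * (M + 1)) * X2 * (2%:R * c - K ^+ 2 + K)); last by rewrite c2 mulr0.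
ring.
Qed.

(** Goal: this span is stable under multiplication by every matrix entry, hence is the whole
    ring. *)
Inductive Span : P -> Prop :=
| Span_gen m k p : Cov m p -> Span (iter k F p)
| Span_add p q : Span p -> Span q -> Span (p + q)
| Span_zero : Span 0.

Lemma Span_scale s p : S s -> Span p -> Span (s * p).
Proof.
move=> hs; elim=> [m k q hq|q r _ hq _ hr|].
- by rewrite -iterFZ //; apply: (Span_gen k (Cov_scale hs hq)).
- by rewrite mulrDr; apply: Span_add.
- by rewrite mulr0; apply: Span_zero.
Qed.

Lemma Span_opp p : Span p -> Span (- p).
Proof. by rewrite -[- p]mulN1r; apply: Span_scale; apply: SN. Qed.

Lemma Span_F p : Span p -> Span (F p).
Proof.
elim=> [m k q hq|q r _ hq _ hr|]; first exact: (Span_gen k.+1 hq).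
- by rewrite FD; apply: Span_add.
- by rewrite F0; apply: Span_zero.
Qed.

Lemma Span_div n p : Span (n.+1%:R * p) -> Span p.
Proof.
have [c [c1 Sc]] := S_half n; move=> /(Span_scale Sc).
by rewrite mulrA c1 mul1r.
Qed.

(** Multiplication by a sends F^k y into the span of the F-images of a y and of its two
    transvectants, because the Clebsch-Gordan denominators are units in characteristic 0. The cases
    k = 0 and k = 1 involve fewer terms and are done by hand. *)
Lemma Span_mul_gen l k : (forall f, f \in l -> V f) ->
  Span (a * iter k F (\prod_(f <- l) f)).
Proof.
move=> hl; case: (eqVneq l [::]) => [->|l0].
  rewrite big_nil; case: k => [|k]; last first.
    by rewrite iterSr; have [_ -> _] := S_inv S1; rewrite iterF0 mulr0; apply: Span_zero.
  by rewrite -[iter _ _ _]/(1 : P) -[a * 1]/(iter 0 F _); apply: Span_gen (Cov_mul Va (Cov_S S1)).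
have [m em] : exists m, size l = m.+1 by case: (l) l0 => // f l' _; exists (size l').
set y := \prod_(_ <- _) _.
have cy : Cov m.+2 (a * y) by rewrite -em; apply: Cov_mul => //; apply: Cov_list.
have c1 : Cov m.+1 (trans1 a m.+1%:R y) by rewrite -em; apply: Cov_trans1.
have c2 : Cov m (trans2 a m.+1%:R y) by rewrite -[m]/(m.+1.-1) -em; apply: Cov_trans2.
case: k => [|[|k]]; first exact: (Span_gen 0 cy).
  apply: (@Span_div m.+1).
  have -> : m.+2%:R * (a * iter 1 F y) = m.+1%:R * F (a * y) - trans1 a m.+1%:R y.
    by rewrite /trans1 FM /= -[m.+2]addn1 natrD; ring.
  apply: Span_add; first by apply: Span_scale; [apply: Snat | apply: (Span_gen 1 cy)].
  exact: Span_opp (Span_gen 0 c1).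
(* With M = m + 1 the three integers divided out are 2 M, 2 M + 1 and 2 M + 2. *)
apply: (@Span_div (2 * m + 1)); apply: (@Span_div (2 * m + 2)); apply: (@Span_div (2 * m + 3)).
have -> : (2 * m + 3).+1%:R * ((2 * m + 2).+1%:R * ((2 * m + 1).+1%:R * (a * iter k.+2 F y))) =
   2%:R * m.+1%:R * (2%:R * m.+1%:R + 1) * (2%:R * m.+1%:R + 2%:R) * (a * iter k.+2 F y) :> P.
  have e j : (2 * m + j).+1%:R = 2%:R * m%:R + j%:R + 1 :> P.
    by rewrite -[_.+1]addn1 natrD natrD natrM.
  by rewrite !e -[m.+1]addn1 natrD; ring.
rewrite mul_iterF; have S2 := Snat 2; have Sk := Snat k; have Sm := Snat m.+1.
by apply: Span_add; [apply: Span_add; [|apply: Span_opp]|]; apply: Span_scale;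
  do ?[apply: SM | apply: SD | apply: SB | apply: SN] => //;
  [exact: (Span_gen k.+2 cy) | exact: (Span_gen k.+1 c1) | exact: (Span_gen k c2)].
Qed.

Lemma Span_mul p : Span p -> Span (a * p).
Proof.
elim=> [m k q|q r _ hq _ hr|]; last 2 first.
- by rewrite mulrDr; apply: Span_add.
- by rewrite mulr0; apply: Span_zero.
elim=> [s l hs hl|{}m {}p {}q _ hp _ hq|{}m].
- by rewrite iterFZ // mulrCA; apply: Span_scale => //; apply: Span_mul_gen.
- by rewrite iterFD mulrDr; apply: Span_add.
- by rewrite iterF0 mulr0; apply: Span_zero.
Qed.

Lemma Span_mulF p : Span p -> Span (F a * p).
Proof.
move=> hp; have -> : F a * p = F (a * p) - a * F p by rewrite FM; ring.
by apply: Span_add; [apply/Span_F/Span_mul | apply/Span_opp/Span_mul/Span_F].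
Qed.

Lemma Span_mulFF p : Span p -> Span (F (F a) * p).
Proof.
move=> hp; have -> : F (F a) * p = F (F a * p) - F a * F p by rewrite FM; ring.
by apply: Span_add; [apply/Span_F/Span_mulF | apply/Span_opp/Span_mulF/Span_F].
Qed.

End MultiplicationBy.

(** Normalised so that a highest weight vector of weight 2 m has eigenvalue 2 m (2 m + 2), which is
    zero for m = 0 and invertible for m > 0. *)
Definition Casimir p := 4%:R * F (E p) + H (H p) + 2%:R * H p.

Lemma H_iterF m k p : Cov m p ->
  H (iter k F p) = (2%:R * m%:R - 2%:R * k%:R) * iter k F p.
Proof.
move=> /Cov_weight[_ Hp]; elim: k => [|k IH]; first by rewrite /= Hp natrM; ring.
rewrite iterS HF IH FM -iterS.
have -> : F (2%:R * m%:R - 2%:R * k%:R) = 0.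
  have : S (2%:R * m%:R - 2%:R * k%:R) by apply: SB; apply: SM; apply: Snat.
  by case/S_inv.
have ek : k.+1%:R = k%:R + 1 :> P by rewrite -addn1 natrD.
by rewrite ek; ring.
Qed.

Lemma E_iterF m k p : Cov m p ->
  E (iter k.+1 F p) = (k%:R + 1) * (2%:R * m%:R - k%:R) * iter k F p.
Proof.
move=> hp; elim: k => [|k IH].
  by rewrite /= EF; have [-> ->] := Cov_weight hp; rewrite F0 natrM; ring.
rewrite iterS EF IH (H_iterF _ hp) FZ; last first.
  by apply: SM; [apply: SD => //; apply: Snat | apply: SB; [apply: SM|]; apply: Snat].
have ek : k.+1%:R = k%:R + 1 :> P by rewrite -addn1 natrD.
by rewrite -iterS ek; ring.
Qed.

Lemma Casimir_iterF m k p : Cov m p ->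
  Casimir (iter k F p) = (4 * m ^ 2 + 4 * m)%:R * iter k F p.
Proof.
move=> hp; rewrite /Casimir !(H_iterF _ hp).
have HZ s q : S s -> H (s * q) = s * H q by case/S_inv => _ _ Hs; rewrite HM Hs mul0r add0r.
rewrite HZ; last by apply: SB; apply: SM; apply: Snat.
rewrite (H_iterF _ hp) natrD !natrM.
case: k => [|k]; first by rewrite /=; have [-> _] := Cov_weight hp; rewrite F0; ring.
rewrite (E_iterF _ hp) FZ; last first.
  by apply: SM; [apply: SD => //; apply: Snat | apply: SB; [apply: SM|]; apply: Snat].
have ek : k.+1%:R = k%:R + 1 :> P by rewrite -addn1 natrD.
by rewrite -iterS ek; ring.
Qed.

Lemma CasimirD p q : Casimir (p + q) = Casimir p + Casimir q.
Proof. by rewrite /Casimir !(ED, FD, HD); ring. Qed.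

Lemma CasimirZ s p : S s -> Casimir (s * p) = s * Casimir p.
Proof.
move=> hs; have [Es _ Hs] := S_inv hs.
have HZ q : H (s * q) = s * H q by rewrite HM Hs mul0r add0r.
have EZ q : E (s * q) = s * E q by rewrite EM Es mul0r add0r.
by rewrite /Casimir EZ !HZ FZ //; ring.
Qed.

Lemma Cov0_S p : Cov 0 p -> S p.
Proof.
suff gen m : Cov m p -> m = 0%N -> S p by move=> /gen; apply.
elim=> [s l hs _ /size0nil ->|{}m q r _ hq _ hr em|{}m _].
- by rewrite big_nil mulr1.
- by apply: SD; auto.
- exact: S0.
Qed.

(** The stored index is the degree minus one, so every eigenvalue in the list is a positive
    integer. *)
Definition Dec p := exists (s : P) (ws : seq (nat * P)), [/\ S s,
  forall x, x \in ws -> Casimir x.2 = (4 * x.1.+1 ^ 2 + 4 * x.1.+1)%:R * x.2 &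
  p = s + \sum_(x <- ws) x.2].

Lemma Span_Dec p : Span p -> Dec p.
Proof.
elim=> [[|m] k q hq|q r _ [s [ws [hs hw ->]]] _ [t [vs [ht hv ->]]]|].
- exists (iter k F q), [::]; rewrite big_nil addr0; split=> //.
  have hs := Cov0_S hq; case: k => // k; rewrite iterSr.
  by have [_ -> _] := S_inv hs; rewrite iterF0; apply: S0.
- exists 0, [:: (m, iter k F q)]; rewrite big_seq1 add0r; split=> // [|x]; first exact: S0.
  by rewrite inE => /eqP ->; apply: Casimir_iterF.
- exists (s + t), (ws ++ vs); split; first exact: SD.
    by move=> x; rewrite mem_cat => /orP[/hw|/hv].
  by rewrite big_cat /= addrACA.
- by exists 0, [::]; rewrite big_nil addr0; split=> //; exact: S0.
Qed.

Lemma Casimir0 : Casimir 0 = 0.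
Proof. by rewrite /Casimir E0 H0 F0 H0; ring. Qed.

Lemma Casimir_sum (ws : seq (nat * P)) : Casimir (\sum_(x <- ws) x.2) = \sum_(x <- ws) Casimir x.2.
Proof. by elim: ws => [|x ws IH]; rewrite ?big_nil ?Casimir0 // !big_cons CasimirD IH. Qed.

(* Subtracting a multiple of the image under the Casimir operator removes one
   eigenvector at a time without changing the class modulo J. *)
Lemma Dec_invariant (J : P -> Prop) p :
  (forall q r, J q -> J r -> J (q + r)) -> (forall q r, J r -> J (q * r)) ->
  (forall q, J q -> J (Casimir q)) -> Dec p -> J (Casimir p) ->
  exists s, S s /\ J (p - s).
Proof.
move=> JD JM JC [s [ws [hs hw ->]]]; move: {2}(size ws) (erefl (size ws)) => n.
elim: n => [|n IH] in s ws hs hw *.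
  move/size0nil => -> h; exists s; split=> //; rewrite big_nil addr0 subrr.
  by have := JM 0 _ h; rewrite mul0r.
case: ws hw => [//|[m w] ws] hw [sz]; rewrite big_cons /=; set q := s + _ => Jq.
have [c [c1 Sc]] := S_half (4 * m.+1 ^ 2 + 4 * m.+1).-1.
rewrite prednK ?addn_gt0 ?muln_gt0 ?expn_gt0 // in c1.
pose N (x : nat * P) : P := (4 * x.1.+1 ^ 2 + 4 * x.1.+1)%:R.
have hw' x : x \in ws -> Casimir x.2 = N x * x.2 by move=> hx; apply: hw; rewrite inE hx orbT.
have Cw : Casimir w = (4 * m.+1 ^ 2 + 4 * m.+1)%:R * w by apply: (hw (m, w)); rewrite inE eqxx.
have Cs : Casimir s = 0.
  by have [Es _ Hs] := S_inv hs; rewrite /Casimir Es Hs H0 F0; ring.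
pose ws' := [seq (x.1, (1 - c * N x) * x.2) | x <- ws].
have def_q' : q - c * Casimir q = s + \sum_(x <- ws') x.2.
  rewrite /q !CasimirD Cs Cw Casimir_sum big_map.
  have -> : \sum_(x <- ws) Casimir x.2 = \sum_(x <- ws) N x * x.2.
    by rewrite big_seq [RHS]big_seq; apply: eq_bigr => x /hw'.
  have -> : \sum_(x <- ws) (x.1, (1 - c * N x) * x.2).2 =
     \sum_(x <- ws) x.2 - c * \sum_(x <- ws) N x * x.2.
    by rewrite mulr_sumr -sumrB; apply: eq_bigr => x _ /=; ring.
  rewrite add0r mulrDr mulrA c1; ring.
have [||||s' [Ss' Js']] := IH s ws' => //.
- move=> _ /mapP[x hx ->] /=; rewrite CasimirZ; last first.
    by apply: SB => //; apply: SM => //; apply: Snat.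
  by rewrite hw' // /N; ring.
- by rewrite size_map.
- rewrite -def_q' CasimirD -mulNr CasimirZ; last exact: SN.
  by apply: JD => //; apply: JM; apply: JC.
exists s'; split=> //; rewrite -def_q' in Js'.
have -> : q - s' = q - c * Casimir q - s' + c * Casimir q by ring.
by apply: JD => //; apply: JM.
Qed.

End Covariants.

(** * Derivations by infinitesimal conjugation *)

Section Derivations.
Variables (K : comNzRingType) (n : nat) (e : 'I_n -> {mpoly K[n]}).
Implicit Types p q : {mpoly K[n]}.

Definition vfield p := \sum_i e i * p^`M(i).

Lemma vfieldD p q : vfield (p + q) = vfield p + vfield q.
Proof. by rewrite -big_split; apply: eq_bigr => i _; rewrite mderivD mulrDr. Qed.

Lemma vfieldM p q : vfield (p * q) = vfield p * q + p * vfield q.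
Proof.
rewrite mulr_suml mulr_sumr -big_split; apply: eq_bigr => i _.
by rewrite mderivM /=; ring.
Qed.

Lemma vfieldC c : vfield c%:MP = 0.
Proof. by apply: big1 => i _; rewrite mderivC mulr0. Qed.

Lemma vfieldX i : vfield 'X_i = e i.
Proof.
rewrite /vfield (bigD1 i) //= big1 => [|j ne]; rewrite mderivX mnm1E.
  by rewrite eqxx scale1r (_ : (U_(i) - U_(i))%MM = 0%MM) ?mpolyX0 ?mulr1 ?addr0 //;
    apply/mnmP => k; rewrite mnmBE mnm0E subnn.
by rewrite eq_sym (negbTE ne) scale0r mulr0.
Qed.

End Derivations.

Section Equivariant.
Variables (T : comNzRingType) (D : T -> T).
Hypothesis DD : forall p q, D (p + q) = D p + D q.
Hypothesis DM : forall p q, D (p * q) = D p * q + p * D q.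
Variable G : 'M[T]_2.
Implicit Types M N : 'M[T]_2.

Lemma D0 : D 0 = 0.
Proof. by apply: (addIr (D 0)); rewrite -DD !add0r. Qed.

Lemma D1 : D 1 = 0.
Proof. by apply: (addIr (D 1)); rewrite add0r -{3}[1]mulr1 DM mulr1 mul1r. Qed.

Lemma DN p : D (- p) = - D p.
Proof. by apply: (addIr (D p)); rewrite -DD !addNr D0. Qed.

Definition lie M := G *m M - M *m G.
Definition equivariant M := map_mx D M = lie M.

Lemma map_DM M N : map_mx D (M *m N) = map_mx D M *m N + M *m map_mx D N.
Proof.
apply/matrixP => i j; rewrite !mxE !big_ord_recl !big_ord0 !mxE !DD !DM D0.
by ring.
Qed.

Lemma equivariantM M N : equivariant M -> equivariant N -> equivariant (M *m N).
Proof.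
rewrite /equivariant map_DM /lie => -> ->.
by rewrite mulmxBl mulmxBr !mulmxA addrA subrK.
Qed.

Lemma mx2_map M : map_mx D M = mx2 (D (M 0 0)) (D (M 0 1)) (D (M 1 0)) (D (M 1 1)).
Proof. by rewrite {1}(mx2_eta M) map_mx2. Qed.

Lemma equivariantE M : equivariant M ->
  let g := G in
  [/\ D (M 0 0) = g 0 1 * M 1 0 - M 0 1 * g 1 0,
      D (M 0 1) = (g 0 0 - g 1 1) * M 0 1 + g 0 1 * (M 1 1 - M 0 0),
      D (M 1 0) = (g 1 1 - g 0 0) * M 1 0 + g 1 0 * (M 0 0 - M 1 1)
    & D (M 1 1) = g 1 0 * M 0 1 - M 1 0 * g 0 1].
Proof.
rewrite /equivariant mx2_map /lie /=; move: (mx2_eta M) (mx2_eta G).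
move: (M 0 0) (M 0 1) (M 1 0) (M 1 1) (G 0 0) (G 0 1) (G 1 0) (G 1 1).
move=> a b c d ga gb gc gd -> ->; rewrite !mx2E => /mx2_inj[-> -> -> ->].
by split; ring.
Qed.

Lemma equivariant_tr M : equivariant M -> D (\tr M) = 0.
Proof.
by move=> /equivariantE[e1 _ _ e4]; rewrite [in LHS](mx2_eta M) mx2_tr DD e1 e4; ring.
Qed.

Lemma equivariant_det M : equivariant M -> D (\det M) = 0.
Proof.
move=> /equivariantE[e1 e2 e3 e4]; rewrite [in LHS](mx2_eta M) mx2_det DD DN !DM e1 e2 e3 e4; ring.
Qed.

Lemma equivariant_minv M : equivariant M -> equivariant (minv M).
Proof.
move=> /equivariantE; rewrite /equivariant /lie; move: (mx2_eta M) (mx2_eta G).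
move: (M 0 0) (M 0 1) (M 1 0) (M 1 1) (G 0 0) (G 0 1) (G 1 0) (G 1 1).
move=> a b c d ga gb gc gd -> -> /= [e1 e2 e3 e4].
by rewrite !mx2E map_mx2 !DN e1 e2 e3 e4; congr mx2; ring.
Qed.

Lemma equivariant_mcomm M N : equivariant M -> equivariant N -> equivariant (mcomm M N).
Proof.
by move=> hM hN; do !apply: equivariantM => //; apply: equivariant_minv.
Qed.

(** The derivation acts on M as the bracket with G, which annihilates the identity matrix, so it
    maps M - 1 to G (M - 1) - (M - 1) G. *)
Lemma D_entries M g : equivariant M -> g \in mxentries (M - 1%:M) ->
  in_ideal (mxentries (M - 1%:M)) (D g).
Proof.
move=> hM; set N := M - 1%:M.
have key i j : in_ideal (mxentries N) (N i j).
  by apply: in_ideal_gen; rewrite /mxentries !inE;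
     case: i => [[|[|//]] ?]; case: j => [[|[|//]] ?];
     apply/or4P; [constructor 1|constructor 2|constructor 3|constructor 4];
     apply/eqP; congr (N _ _); apply: val_inj.
have DN' : map_mx D N = G *m N - N *m G.
  have : map_mx D N = map_mx D M.
    apply/matrixP => i j; rewrite !mxE DD DN.
    by case: eqP => _; rewrite ?mulr1n ?mulr0n ?D1 ?D0 oppr0 addr0.
  move=> ->; rewrite hM /lie /N mulmxBr mulmxBl mulmx1 mul1mx.
  by rewrite opprB addrA subrK.
have D_key i j : in_ideal (mxentries N) (D (N i j)).
  have /matrixP/(_ i j) := DN'; rewrite !mxE => ->.
  apply: in_idealB; apply: in_ideal_sum => k _; first exact: in_idealM.
  by rewrite mulrC; apply: in_idealM.
by rewrite {1}/mxentries !inE => /or4P[] /eqP ->.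
Qed.

End Equivariant.

Section IdealStability.
Variables (T : comNzRingType) (D : T -> T).
Hypothesis DD : forall p q, D (p + q) = D p + D q.
Hypothesis DM : forall p q, D (p * q) = D p * q + p * D q.

Lemma D_ideal gs p : (forall g, g \in gs -> in_ideal gs (D g)) -> in_ideal gs p ->
  in_ideal gs (D p).
Proof.
move=> h; move: p; apply: (in_ideal_ind (gs := gs)) => [|p q hp hq|c g gin].
- by rewrite (D0 DD); apply: in_ideal0.
- by rewrite DD; apply: in_idealD.
- by rewrite DM; apply: in_idealD; apply: in_idealM; [exact: in_ideal_gen | exact: h].
Qed.

Lemma relator_ideal_D (G MA MB MC : 'M[T]_2)
    (gs := [:: \det MA - 1; \det MB - 1; \det MC - 1]
     ++ mxentries (mcomm MA (mcomm MB (minv MC)) - 1%:M)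
     ++ mxentries (mcomm MB (mcomm MC (minv MA)) - 1%:M)
     ++ mxentries (mcomm MC (mcomm MA (minv MB)) - 1%:M)) :
  equivariant D G MA -> equivariant D G MB -> equivariant D G MC ->
  forall p, in_ideal gs p -> in_ideal gs (D p).
Proof.
move=> hA hB hC p; apply: D_ideal => g.
have eD M : equivariant D G M -> in_ideal gs (D (\det M - 1)).
  move=> hM; rewrite DD (DN DD) (D1 DM) (equivariant_det DD DM hM) oppr0 addr0.
  exact: in_ideal0.
have eR M N Q : equivariant D G M -> equivariant D G N -> equivariant D G Q ->
    equivariant D G (mcomm M (mcomm N (minv Q))).
  move=> hM hN hQ; apply: (equivariant_mcomm DD DM) => //; apply: (equivariant_mcomm DD DM) => //.
  exact: (equivariant_minv DD).
have sub hs : (forall x, x \in hs -> x \in gs) -> forall x, in_ideal hs x -> in_ideal gs x.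
  by move=> h x; apply: in_ideal_trans => y /h; apply: in_ideal_gen.
rewrite {1}/gs !mem_cat => /or4P[].
- by rewrite !inE => /or3P[] /eqP ->; apply: eD.
- move=> /(D_entries DD DM (eR _ _ _ hA hB hC)); apply: sub => x.
  by rewrite !mem_cat => h; apply/or4P; constructor 2.
- move=> /(D_entries DD DM (eR _ _ _ hB hC hA)); apply: sub => x.
  by rewrite !mem_cat => h; apply/or4P; constructor 3.
- move=> /(D_entries DD DM (eR _ _ _ hC hA hB)); apply: sub => x.
  by rewrite !mem_cat => h; apply/or4P; constructor 4.
Qed.

End IdealStability.

(** * Covariants of three generic matrices *)

Section MatrixCovariants.
Variables (P : comNzRingType) (E F H : P -> P).
Hypotheses (ED : forall p q, E (p + q) = E p + E q) (FD : forall p q, F (p + q) = F p + F q)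
  (HD : forall p q, H (p + q) = H p + H q).
Hypotheses (EM : forall p q, E (p * q) = E p * q + p * E q)
  (FM : forall p q, F (p * q) = F p * q + p * F q)
  (HM : forall p q, H (p * q) = H p * q + p * H q).
Hypothesis EF : forall p, E (F p) = F (E p) + H p.
Hypothesis HF : forall p, H (F p) = F (H p) - 2%:R * F p.

Variables MA MB MC : 'M[P]_2.
Definition gen M := [\/ M = MA, M = MB | M = MC].
Hypothesis gen_E : forall M, gen M -> equivariant E (mx2 0 1 0 0) M.
Hypothesis gen_F : forall M, gen M -> equivariant F (mx2 0 0 1 0) M.
Hypothesis gen_H : forall M, gen M -> equivariant H (mx2 (-1) 0 0 1) M.

(** To be instantiated by congruence to a trace polynomial modulo the relations. Determinants
    qualify because they are congruent to 1; through Cayley-Hamilton they give the traces of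
    squares. *)
Variable TR : P -> Prop.
Hypotheses (TR1 : TR 1) (TRB : forall p q, TR p -> TR q -> TR (p - q))
  (TRM : forall p q, TR p -> TR q -> TR (p * q)).
Hypothesis half : forall n, exists c : P, [/\ c * n.+1%:R = 1, E c = 0, F c = 0 & TR c].
Hypothesis TR_tr : forall M, gen M -> TR (\tr M).
Hypothesis TR_det : forall M, gen M -> TR (\det M).
Hypotheses (TR_AB : TR (\tr (MA *m MB))) (TR_AC : TR (\tr (MA *m MC)))
  (TR_BC : TR (\tr (MB *m MC))) (TR_ABC : TR (\tr (MA *m MB *m MC))).

Definition low (M : 'M[P]_2) := M 1 0.

Lemma low_F M : gen M -> F (low M) = M 0 0 - M 1 1 /\ F (M 0 0 - M 1 1) = - 2%:R * M 0 1.
Proof.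
move=> /gen_F/equivariantE[]; rewrite !mxE /= => f1 f2 f3 f4.
by rewrite /low f3 FD (DN FD) f1 f4; split; ring.
Qed.

Lemma low_FF M : gen M -> F (F (low M)) = - 2%:R * M 0 1.
Proof. by move=> hM; have [-> ->] := low_F hM. Qed.

Let FN p : F (- p) = - F p := DN FD p.
Let F0 : F 0 = 0 := D0 FD.
Let E0 : E 0 = 0 := D0 ED.

Definition hw f := [/\ E f = 0, H f = 2%:R * f & F (F (F f)) = 0].

Lemma low_hw M : gen M -> hw (low M).
Proof.
move=> hM; have [_ _ e3 _] := equivariantE (gen_E hM).
have [_ _ h3 _] := equivariantE (gen_H hM); have [_ f2 _ _] := equivariantE (gen_F hM).
move: e3 h3 f2; rewrite !mxE /= => e3 h3 f2; rewrite /hw low_FF // /low e3 h3.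
split; [by ring | by ring |].
rewrite mulNr FN (_ : 2%:R = 1 + 1) // FM FD (D1 FM) f2; ring.
Qed.

Let F2 : F 2%:R = 0. Proof. by rewrite (_ : 2%:R = 1 + 1) // FD (D1 FM) addr0. Qed.

Lemma hw_E f : hw f -> E (F f) = 2%:R * f /\ E (F (F f)) = 2%:R * F f.
Proof.
move=> [Ef Hf _]; have e1 : E (F f) = 2%:R * f by rewrite EF Ef F0 Hf add0r.
by split=> //; rewrite EF e1 HF Hf FM F2; ring.
Qed.

Lemma hw_pair1 f g : hw f -> hw g -> hw (pair1 F f g).
Proof.
move=> hf hg; have [Ef Hf f3] := hf; have [Eg Hg g3] := hg.
have [ef1 ef2] := hw_E hf; have [eg1 eg2] := hw_E hg.
have HFf : H (F f) = 0 by rewrite HF Hf FM F2; ring.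
have HFg : H (F g) = 0 by rewrite HF Hg FM F2; ring.
rewrite /hw /pair1; split.
- by rewrite ED (DN ED) !EM ef1 eg1 Ef Eg; ring.
- by rewrite HD (DN HD) !HM HFf HFg Hf Hg; ring.
- by rewrite !(FD, FN, FM) f3 g3 F0; ring.
Qed.

Lemma hw_pair2 f g : hw f -> hw g -> E (pair2 F f g) = 0 /\ F (pair2 F f g) = 0.
Proof.
move=> hf hg; have [Ef Hf f3] := hf; have [Eg Hg g3] := hg.
have [ef1 ef2] := hw_E hf; have [eg1 eg2] := hw_E hg.
rewrite /pair2; split.
- by rewrite !ED (DN ED) !EM ef1 eg1 ef2 eg2 Ef Eg; ring.
- by rewrite !FD FN !FM f3 g3; ring.
Qed.

(** Four times the inner product of the traceless parts. *)
Lemma pair2_low X Y : gen X -> gen Y ->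
  pair2 F (low X) (low Y) = \tr X * \tr Y - 2%:R * \tr (X *m Y).
Proof.
move=> hX hY; rewrite /pair2 !low_FF // (proj1 (low_F hX)) (proj1 (low_F hY)) /low.
move: (mx2_eta X) (mx2_eta Y); move: (X 0 0) (X 0 1) (X 1 0) (X 1 1) (Y 0 0) (Y 0 1) (Y 1 0) (Y 1 1).
by move=> ? ? ? ? ? ? ? ? -> ->; rewrite !mx2E; ring.
Qed.

(** The triple product of the traceless parts, times -8; this is where the trace of XYZ enters. *)
Lemma pair2_low3 X Y Z : gen X -> gen Y -> gen Z ->
  pair2 F (low X) (pair1 F (low Y) (low Z)) =
  - 2%:R * (\tr X * \tr (Y *m Z) + \tr Y * \tr (X *m Z) + \tr Z * \tr (X *m Y)
    - \tr X * \tr Y * \tr Z - 2%:R * \tr (X *m Y *m Z)).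
Proof.
move=> hX hY hZ; rewrite /pair2 /pair1 !(FD, FN, FM) !low_FF //.
rewrite (proj1 (low_F hX)) (proj1 (low_F hY)) (proj1 (low_F hZ)).
have [_ _ x3] := low_hw hX; have [_ _ y3] := low_hw hY; have [_ _ z3] := low_hw hZ.
rewrite !low_FF // in x3 y3 z3; rewrite ?x3 ?y3 ?z3 /low.
move: (mx2_eta X) (mx2_eta Y) (mx2_eta Z) {x3 y3 z3}.
move: (X 0 0) (X 0 1) (X 1 0) (X 1 1) (Y 0 0) (Y 0 1) (Y 1 0) (Y 1 1) (Z 0 0) (Z 0 1) (Z 1 0) (Z 1 1).
by move=> ? ? ? ? ? ? ? ? ? ? ? ? -> -> ->; rewrite !mx2E; ring.
Qed.

(** The double cross product formula; the next lemma is the Binet-Cauchy formula for (f x g).(h x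
    k). *)
Lemma pair1_low3 f g h : pair1 F f (pair1 F g h) = pair2 F f h * g - pair2 F f g * h.
Proof. by rewrite /pair1 /pair2 !(FD, FN, FM); ring. Qed.

Lemma pair2_low4 f g h k : F (F (F f)) = 0 -> F (F (F g)) = 0 -> F (F (F h)) = 0 -> F (F (F k)) = 0 ->
  pair2 F (pair1 F f g) (pair1 F h k) = 
  pair2 F f h * pair2 F g k - pair2 F f k * pair2 F g h.
Proof.
move=> f3 g3 h3 k3.
rewrite /pair1 /pair2 !(FD, FN, FM) f3 g3 h3 k3.
by ring.
Qed.

Lemma TR0 : TR 0. Proof. by rewrite -(subrr 1); apply: TRB. Qed.
Lemma TRN p : TR p -> TR (- p). Proof. by rewrite -sub0r; apply: TRB TR0. Qed.
Lemma TRD p q : TR p -> TR q -> TR (p + q).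
Proof. by move=> hp hq; rewrite -[q]opprK; apply: TRB => //; apply: TRN. Qed.
Lemma TR2 : TR 2%:R. Proof. by rewrite (_ : 2%:R = 1 + 1) //; apply: TRD. Qed.

Lemma TR_trM X Y : gen X -> gen Y -> TR (\tr (X *m Y)).
Proof.
have sq X0 : gen X0 -> TR (\tr (X0 *m X0)).
  move=> hX; have -> : \tr (X0 *m X0) = \tr X0 * \tr X0 - 2%:R * \det X0.
    move: (mx2_eta X0); move: (X0 0 0) (X0 0 1) (X0 1 0) (X0 1 1) => ? ? ? ? ->.
    by rewrite !mx2E; ring.
  by apply: TRB; apply: TRM; rewrite ?TR2 //; [exact: TR_tr | exact: TR_tr | exact: TR2 | exact: TR_det].
move=> hX hY; case: (hX) => eX; case: (hY) => eY; rewrite eX eY ?sq //; rewrite ?eX ?eY in hX hY *;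
  first [exact: sq | done | by rewrite mxtrace_mulC].
Qed.

Lemma TR_pair2_low X Y : gen X -> gen Y -> TR (pair2 F (low X) (low Y)).
Proof.
move=> hX hY; rewrite pair2_low //; apply: TRB; apply: TRM; try exact: TR_tr; first exact: TR2.
exact: TR_trM.
Qed.

Definition triple f g h := pair2 F f (pair1 F g h).

Lemma triple_swap f g h : triple f h g = - triple f g h.
Proof. by rewrite /triple /pair2 /pair1 !(FD, FN, FM); ring. Qed.

Lemma triple_rot f g h : F (F (F f)) = 0 -> F (F (F g)) = 0 -> F (F (F h)) = 0 ->
  triple g h f = triple f g h.
Proof. by move=> f3 g3 h3; rewrite /triple /pair2 /pair1 !(FD, FN, FM) f3 g3 h3; ring. Qed.

Lemma triple_diag f g : triple f g g = 0.
Proof. by rewrite /triple /pair2 /pair1 !(FD, FN, FM); ring. Qed.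

Lemma TR_triple X Y Z : gen X -> gen Y -> gen Z -> TR (triple (low X) (low Y) (low Z)).
Proof.
have gA : gen MA by constructor 1. have gB : gen MB by constructor 2.
have gC : gen MC by constructor 3.
have rot U V W : gen U -> gen V -> gen W ->
    triple (low V) (low W) (low U) = triple (low U) (low V) (low W).
  move=> hU hV hW; have [_ _ u3] := low_hw hU; have [_ _ v3] := low_hw hV.
  by have [_ _ w3] := low_hw hW; apply: triple_rot.
have base : TR (triple (low MA) (low MB) (low MC)).
  rewrite /triple pair2_low3 // mulNr; apply: TRN; apply: TRM; first exact: TR2.
  by apply: TRB; [apply: TRB; [do 2?apply: TRD|]|]; do ?apply: TRM;
     try exact: TR_tr; try exact: TR2.
have diag13 U V : gen U -> gen V -> TR (triple (low U) (low V) (low U)).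
  by move=> hU hV; rewrite -rot // triple_diag; apply: TR0.
have diag12 U V : gen U -> gen V -> TR (triple (low U) (low U) (low V)).
  by move=> hU hV; rewrite rot // triple_diag; apply: TR0.
have diag23 U V : TR (triple (low U) (low V) (low V)).
  by rewrite triple_diag; apply: TR0.
move=> hX hY hZ; case: (hX) => ->; case: (hY) => ->; case: (hZ) => ->;
  first [exact: diag23 | exact: diag13 | exact: diag12 | exact: base
  | by rewrite rot // | by rewrite -rot //
  | by rewrite triple_swap; apply: TRN; first [exact: base | by rewrite rot // | by rewrite -rot //]].
Qed.

Definition sl2inv p := [/\ E p = 0, F p = 0 & TR p].
(** The traceless parts and their cross products, given by highest weight vectors. By the double
    cross product formula nothing new of weight 2 arises beyond combinations with invariant
    coefficients. *)
Definition cov1 f := (exists2 X, gen X & f = low X) \/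
  (exists X Y, [/\ gen X, gen Y & f = pair1 F (low X) (low Y)]).

Lemma cov1_hw f : cov1 f -> hw f.
Proof.
by case=> [[X hX ->]|[X [Y [hX hY ->]]]]; [apply: low_hw | apply: hw_pair1; apply: low_hw].
Qed.

Lemma inv_pair2 f g : cov1 f -> cov1 g -> sl2inv (pair2 F f g).
Proof.
move=> hf hg; have [e1 e2] := hw_pair2 (cov1_hw hf) (cov1_hw hg); split=> //.
have comm p q : pair2 F p q = pair2 F q p by rewrite /pair2; ring.
case: hf hg {e1 e2} => [[X hX ->]|[X [Y [hX hY ->]]]] [[Z hZ ->]|[Z [W [hZ hW ->]]]].
- exact: TR_pair2_low.
- exact: TR_triple.
- by rewrite comm; apply: TR_triple.
have f3 U : gen U -> F (F (F (low U))) = 0 by case/low_hw.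
rewrite pair2_low4 ?f3 //; apply: TRB; apply: TRM; exact: TR_pair2_low.
Qed.

Lemma inv1 : sl2inv 1. Proof. by split; rewrite ?(D1 EM) ?(D1 FM). Qed.

Lemma invB p q : sl2inv p -> sl2inv q -> sl2inv (p - q).
Proof.
move=> [e1 f1 t1] [e2 f2 t2].
by split; [rewrite ED (DN ED) e1 e2 subrr | rewrite FD FN f1 f2 subrr | apply: TRB].
Qed.

Lemma invM p q : sl2inv p -> sl2inv q -> sl2inv (p * q).
Proof.
move=> [e1 f1 t1] [e2 f2 t2].
by split; [rewrite EM e1 e2; ring | rewrite FM f1 f2; ring | apply: TRM].
Qed.

Lemma inv_inv p : sl2inv p -> [/\ E p = 0, F p = 0 & H p = 0].
Proof.
by move=> [e f _]; split=> //; have := EF p; rewrite f e E0 F0 add0r.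
Qed.

Lemma inv_half n : exists c : P, c * n.+1%:R = 1 /\ sl2inv c.
Proof. by have [c [c1 Ec Fc TRc]] := half n; exists c. Qed.

Lemma low_pair1 X f : gen X -> cov1 f -> Cov sl2inv cov1 1 (pair1 F (low X) f).
Proof.
move=> hX.
have one g : cov1 g -> Cov sl2inv cov1 1 g.
  by move=> hg; rewrite -[g]mulr1; apply: Cov_mul => //; apply: Cov_S inv1.
case=> [[Y hY ->]|[Y [Z [hY hZ ->]]]]; first by apply: one; right; exists X, Y.
have cX : cov1 (low X) by left; exists X.
have cY : cov1 (low Y) by left; exists Y.
have cZ : cov1 (low Z) by left; exists Z.
rewrite pair1_low3 -mulNr; apply: Cov_add; apply: (Cov_scale invM); try exact: one.
  exact: inv_pair2.
by rewrite -sub0r; apply: invB (inv_pair2 cX cY); rewrite -(subrr 1); apply: invB inv1 inv1.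
Qed.

(** The entries of M are combinations of its trace and of [low M], F([low M]) = M00 - M11 and
    F(F([low M])) = -2 M01. *)
Lemma Span_entries M p i j : gen M -> Span F sl2inv cov1 p -> Span F sl2inv cov1 (M i j * p).
Proof.
move=> hM hp.
have cM : cov1 (low M) by left; exists M.
have scale s q : sl2inv s -> Span F sl2inv cov1 q -> Span F sl2inv cov1 (s * q).
  by apply: (@Span_scale P E F H) => //; [apply: invM | apply: inv_inv].
have m1 : Span F sl2inv cov1 (low M * p).
  apply: (@Span_mul P E F H) => //; [exact: inv1|exact: invB|exact: invM|exact: inv_inv
   |exact: inv_half|exact: cov1_hw|exact: inv_pair2|]; by move=> f; apply: low_pair1.
have m2 : Span F sl2inv cov1 (F (low M) * p).
  apply: (@Span_mulF P E F H) => //; [exact: inv1|exact: invB|exact: invM|exact: inv_inv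
   |exact: inv_half|exact: cov1_hw|exact: inv_pair2|]; by move=> f; apply: low_pair1.
have m3 : Span F sl2inv cov1 (F (F (low M)) * p).
  apply: (@Span_mulFF P E F H) => //; [exact: inv1|exact: invB|exact: invM|exact: inv_inv
   |exact: inv_half|exact: cov1_hw|exact: inv_pair2|]; by move=> f; apply: low_pair1.
have mt : Span F sl2inv cov1 (\tr M * p).
  apply: scale => //; split; last exact: TR_tr.
  - exact: (equivariant_tr ED (gen_E hM)).
  - exact: (equivariant_tr FD (gen_F hM)).
have [c [c2 ic]] := inv_half 1.
have iNc : sl2inv (- c) by rewrite -sub0r; apply: invB => //; rewrite -(subrr 1); apply: invB inv1 inv1.
rewrite (low_FF hM) in m3; rewrite (proj1 (low_F hM)) in m2.
have tM : \tr M = M 0 0 + M 1 1 by rewrite {1}(mx2_eta M) mx2_tr.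
rewrite tM in mt.
have e00 : M 0 0 * p = c * ((M 0 0 + M 1 1) * p) + c * ((M 0 0 - M 1 1) * p).
  by transitivity ((c * 2%:R) * (M 0 0 * p)); [rewrite c2 mul1r | ring].
have e11 : M 1 1 * p = c * ((M 0 0 + M 1 1) * p) + - c * ((M 0 0 - M 1 1) * p).
  by transitivity ((c * 2%:R) * (M 1 1 * p)); [rewrite c2 mul1r | ring].
have e01 : M 0 1 * p = - c * (- 2%:R * M 0 1 * p).
  by transitivity ((c * 2%:R) * (M 0 1 * p)); [rewrite c2 mul1r | ring].
have s00 : Span F sl2inv cov1 (M 0 0 * p) by rewrite e00; apply: Span_add; apply: scale.
have s11 : Span F sl2inv cov1 (M 1 1 * p) by rewrite e11; apply: Span_add; apply: scale.
have s01 : Span F sl2inv cov1 (M 0 1 * p) by rewrite e01; apply: scale.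
have ord2 (k : 'I_2) : k = 0 \/ k = 1.
  by case: k => [[|[|//]] ?]; [left | right]; apply: val_inj.
by case: (ord2 i) => ->; case: (ord2 j) => ->.
Qed.

(** Invariance is given only modulo J. Stability of J under E and F, together with H = EF - FE, puts
    the Casimir image of p into J, and the eigenvector elimination then stays within the class of
    p. *)
Lemma invariant_mod_J (J : P -> Prop) p : Span F sl2inv cov1 p ->
  (forall q r, J q -> J r -> J (q + r)) -> (forall q r, J r -> J (q * r)) ->
  (forall q, J q -> J (E q)) -> (forall q, J q -> J (F q)) ->
  J (E p) -> J (F p) -> exists s, TR s /\ J (p - s).
Proof.
move=> hp JD JM JE JF Ep Fp.
have HE q : H q = E (F q) - F (E q) by rewrite EF; ring.
have JN q : J q -> J (- q) by rewrite -mulN1r; apply: JM.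
have JH q : J q -> J (H q).
  by move=> hq; rewrite HE; apply: JD; [apply/JE/JF | apply/JN/JF/JE].
have Hp : J (H p) by rewrite HE; apply: JD; [apply: JE | apply/JN/JF].
have [|||s [[_ _ ts] Js]] := @Dec_invariant P E F H ED FD HD EM FM HM sl2inv inv1 invB invM
  inv_inv inv_half J p JD JM.
- move=> q hq; rewrite /Casimir.
  by apply: (JD); [apply: (JD); [apply: (JM)|]|apply: (JM)]; do ?[apply: (JH) | apply: (JF) | apply: (JE)].
- apply: (@Span_Dec P E F H) hp => //; [exact: inv1|exact: invB|exact: invM|exact: inv_inv|exact: cov1_hw].
- rewrite /Casimir; apply: (JD); [apply: (JD); [apply: (JM)|]|apply: (JM)];
  by do ?[exact: Hp | apply: (JH) | apply: (JF) | exact: Ep].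
by exists s.
Qed.

Lemma invariant_mod_ideal (gs : seq P) p :
  (forall Q : P -> Prop, (forall s, sl2inv s -> Q s) -> (forall M i j, gen M -> Q (M i j)) ->
    (forall q r, Q q -> Q r -> Q (q + r)) -> (forall q r, Q q -> Q r -> Q (q * r)) ->
    forall q, Q q) ->
  (forall q, in_ideal gs q -> in_ideal gs (E q)) ->
  (forall q, in_ideal gs q -> in_ideal gs (F q)) ->
  in_ideal gs (E p) -> in_ideal gs (F p) -> exists s, TR s /\ in_ideal gs (p - s).
Proof.
move=> hind JE JF Ep Fp; apply: (@invariant_mod_J (in_ideal gs)) JE JF Ep Fp; last first.
- exact: in_idealM.
- exact: in_idealD.
have mulSp q : forall r, Span F sl2inv cov1 r -> Span F sl2inv cov1 (q * r).
  move: q; apply: hind => [s hs|M i j hM|q1 q2 h1 h2|q1 q2 h1 h2] r hr.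
  - by apply: (@Span_scale P E F H) => //; [apply: invM | apply: inv_inv].
  - exact: Span_entries.
  - by rewrite mulrDl; apply: Span_add; auto.
  - by rewrite -mulrA; auto.
rewrite -[p]mulr1; apply: mulSp; apply: (@Span_gen P F sl2inv cov1 0 0); apply: Cov_S.
exact: inv1.
Qed.

End MatrixCovariants.

Section Sl2OnEntries.
Variables (T : comNzRingType) (E F H : T -> T) (M : 'M[T]_2).
Hypotheses (ED : forall p q, E (p + q) = E p + E q) (FD : forall p q, F (p + q) = F p + F q)
  (HD : forall p q, H (p + q) = H p + H q).
Hypotheses (hE : equivariant E (mx2 0 1 0 0) M) (hF : equivariant F (mx2 0 0 1 0) M)
  (hH : equivariant H (mx2 (-1) 0 0 1) M).

Lemma sl2_relations_entries i j : E (F (M i j)) = F (E (M i j)) + H (M i j) /\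
  H (F (M i j)) = F (H (M i j)) - 2%:R * F (M i j).
Proof.
have [] := equivariantE hE; rewrite !mxE /= => e1 e2 e3 e4.
have [] := equivariantE hF; rewrite !mxE /= => f1 f2 f3 f4.
have [] := equivariantE hH; rewrite !mxE /= => g1 g2 g3 g4.
have {}e1 : E (M 0 0) = M 1 0 by rewrite e1; ring.
have {}e2 : E (M 0 1) = M 1 1 - M 0 0 by rewrite e2; ring.
have {}e3 : E (M 1 0) = 0 by rewrite e3; ring.
have {}e4 : E (M 1 1) = - M 1 0 by rewrite e4; ring.
have {}f1 : F (M 0 0) = - M 0 1 by rewrite f1; ring.
have {}f2 : F (M 0 1) = 0 by rewrite f2; ring.
have {}f3 : F (M 1 0) = M 0 0 - M 1 1 by rewrite f3; ring.
have {}f4 : F (M 1 1) = M 0 1 by rewrite f4; ring.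
have {}g1 : H (M 0 0) = 0 by rewrite g1; ring.
have {}g2 : H (M 0 1) = - (M 0 1 + M 0 1) by rewrite g2; ring.
have {}g3 : H (M 1 0) = M 1 0 + M 1 0 by rewrite g3; ring.
have {}g4 : H (M 1 1) = 0 by rewrite g4; ring.
have ord2 (k : 'I_2) : k = 0 \/ k = 1.
  by case: k => [[|[|//]] ?]; [left | right]; apply: val_inj.
have rE := (ED, DN ED, D0 ED); have rF := (FD, DN FD, D0 FD); have rH := (HD, DN HD, D0 HD).
case: (ord2 i) => ->; case: (ord2 j) => ->;
rewrite ?(e1, e2, e3, e4, f1, f2, f3, f4, g1, g2, g3, g4, rE, rF, rH);
rewrite ?(e1, e2, e3, e4, f1, f2, f3, f4, g1, g2, g3, g4); by split; ring.
Qed.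

End Sl2OnEntries.

Section Sl2Closure.
Variables (T : comNzRingType) (E F H : T -> T).
Hypotheses (ED : forall p q, E (p + q) = E p + E q) (FD : forall p q, F (p + q) = F p + F q)
  (HD : forall p q, H (p + q) = H p + H q).
Hypotheses (EM : forall p q, E (p * q) = E p * q + p * E q)
  (FM : forall p q, F (p * q) = F p * q + p * F q)
  (HM : forall p q, H (p * q) = H p * q + p * H q).

Definition sl2_at p := E (F p) = F (E p) + H p /\ H (F p) = F (H p) - 2%:R * F p.

Lemma sl2_const c : E c = 0 -> F c = 0 -> H c = 0 -> sl2_at c.
Proof.
by move=> e f h; rewrite /sl2_at e f h (D0 ED) (D0 FD) (D0 HD) addr0 mulr0 subr0.
Qed.

Lemma sl2_add p q : sl2_at p -> sl2_at q -> sl2_at (p + q).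
Proof.
by move=> [p1 p2] [q1 q2]; rewrite /sl2_at !(ED, FD, HD) p1 p2 q1 q2; split; ring.
Qed.

Lemma sl2_mul p q : sl2_at p -> sl2_at q -> sl2_at (p * q).
Proof.
move=> [p1 p2] [q1 q2]; rewrite /sl2_at !(EM, FM, HM) !(ED, FD, HD) !(EM, FM, HM) p1 p2 q1 q2.
by split; ring.
Qed.

End Sl2Closure.

(** * The action of sl_2 on the universal matrices *)

Section UniversalMatrices.
Variable R : realType.
Local Notation K := (CC R).
Local Notation P := (P12 R).

Lemma univX (i : 'I_12) : 'X_i = (cvec (Ma R) (Mb R) (Mc R))`_i.
Proof.
case: i => -[|[|[|[|[|[|[|[|[|[|[|[|//]]]]]]]]]]]] hk /=; rewrite mxE;
  by congr ('X__); apply: val_inj; rewrite /= inordK.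
Qed.

Definition univ (M : 'M[P]_2) := gen (Ma R) (Mb R) (Mc R) M.

Lemma univX_entry (i : 'I_12) : exists M a b, univ M /\ 'X_i = M a b.
Proof.
rewrite univX; have gA : univ (Ma R) by constructor 1.
have gB : univ (Mb R) by constructor 2. have gC : univ (Mc R) by constructor 3.
case: i => -[|[|[|[|[|[|[|[|[|[|[|[|//]]]]]]]]]]]] hk.
- by exists (Ma R), 0, 0.
- by exists (Ma R), 0, 1.
- by exists (Ma R), 1, 0.
- by exists (Ma R), 1, 1.
- by exists (Mb R), 0, 0.
- by exists (Mb R), 0, 1.
- by exists (Mb R), 1, 0.
- by exists (Mb R), 1, 1.
- by exists (Mc R), 0, 0.
- by exists (Mc R), 0, 1.
- by exists (Mc R), 1, 0.
- by exists (Mc R), 1, 1.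
Qed.

Definition dconj (G : 'M[P]_2) : P -> P :=
  vfield (fun i : 'I_12 => (cvec (lie G (Ma R)) (lie G (Mb R)) (lie G (Mc R)))`_i).

Lemma dconjD G p q : dconj G (p + q) = dconj G p + dconj G q.
Proof. exact: vfieldD. Qed.

Lemma dconjM G p q : dconj G (p * q) = dconj G p * q + p * dconj G q.
Proof. exact: vfieldM. Qed.

Lemma dconjC G c : dconj G c%:MP = 0.
Proof. exact: vfieldC. Qed.

Lemma dconj_equivariant G M : univ M -> equivariant (dconj G) G M.
Proof.
have [hA hB hC] := @univ_map R _ (dconj G) (lie G (Ma R)) (lie G (Mb R)) (lie G (Mc R))
  (fun i => vfieldX _ i).
by case=> ->; [exact: hA | exact: hB | exact: hC].
Qed.

Lemma univ_ind (Q : P -> Prop) :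
  (forall c, Q c%:MP) -> (forall M i j, univ M -> Q (M i j)) ->
  (forall p q, Q p -> Q q -> Q (p + q)) -> (forall p q, Q p -> Q q -> Q (p * q)) ->
  forall p, Q p.
Proof.
move=> hC hX hD hM; apply: mpoly_ring_ind => // i.
by have [M [a [b [hu ->]]]] := univX_entry i; apply: hX.
Qed.

Definition dE := dconj (mx2 0 1 0 0).
Definition dF := dconj (mx2 0 0 1 0).
(** The sign is forced: G -> [dconj G] reverses brackets, so the commutator of [dE] and [dF] comes
    from diag(-1, 1). *)
Definition dH := dconj (mx2 (-1) 0 0 1).

Lemma dsl2 p : sl2_at dE dF dH p.
Proof.
elim/univ_ind: p => [c|M i j hM|p q hp hq|p q hp hq].
- by apply: sl2_const; try exact: dconjC; exact: dconjD.
- by apply: sl2_relations_entries; do ?[exact: dconjD | exact: dconj_equivariant].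
- exact: (sl2_add (dconjD _) (dconjD _) (dconjD _) hp hq).
- exact: (sl2_mul (dconjD _) (dconjD _) (dconjD _) (dconjM _) (dconjM _) (dconjM _) hp hq).
Qed.

End UniversalMatrices.

Section ImageModIdeal.
Variables (T U : comNzRingType) (phi : {rmorphism T -> U}) (gs : seq U).

Definition mod_image (p : U) := exists f : T, in_ideal gs (p - phi f).

Lemma mod_image_morph f : mod_image (phi f).
Proof. by exists f; rewrite subrr; apply: in_ideal0. Qed.

Lemma mod_image1 : mod_image 1.
Proof. by have := mod_image_morph 1; rewrite rmorph1. Qed.

Lemma mod_image_gen p : p - 1 \in gs -> mod_image p.
Proof. by move=> h; exists 1; rewrite rmorph1; apply: in_ideal_gen. Qed.

Lemma mod_imageB p q : mod_image p -> mod_image q -> mod_image (p - q).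
Proof.
move=> [f hf] [g hg]; exists (f - g); rewrite rmorphB.
have -> : p - q - (phi f - phi g) = (p - phi f) - (q - phi g) by ring.
exact: in_idealB.
Qed.

Lemma mod_imageM p q : mod_image p -> mod_image q -> mod_image (p * q).
Proof.
move=> [f hf] [g hg]; exists (f * g); rewrite rmorphM.
have -> : p * q - phi f * phi g = q * (p - phi f) + phi f * (q - phi g) by ring.
by apply: in_idealD; apply: in_idealM.
Qed.

Lemma mod_image_trans p s : in_ideal gs (p - s) -> mod_image s -> mod_image p.
Proof.
move=> hp [f hf]; exists f.
have -> : p - phi f = (p - s) + (s - phi f) by ring.
exact: in_idealD.
Qed.

End ImageModIdeal.

Section TraceRing.
Variable R : realType.
Local Notation K := (CC R).
Local Notation P := (P12 R).

Definition tauh : {rmorphism P7 R -> P} := comp_mpoly (trtuple R).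

Definition trace_mod : P -> Prop := mod_image tauh (Jbor R).

Lemma trace_mod_tau f : trace_mod (tau f).
Proof. exact: (mod_image_morph tauh (Jbor R) f). Qed.

Lemma trace_mod1 : trace_mod 1.
Proof. exact: mod_image1. Qed.

Lemma trace_modB p q : trace_mod p -> trace_mod q -> trace_mod (p - q).
Proof. exact: mod_imageB. Qed.

Lemma trace_modM p q : trace_mod p -> trace_mod q -> trace_mod (p * q).
Proof. exact: mod_imageM. Qed.

Lemma trace_modC c : trace_mod c%:MP.
Proof. by have := trace_mod_tau c%:MP; rewrite /tau comp_mpolyC. Qed.

Lemma tauX k : (k < 7)%N -> tau ('X_(inord k)) = (trtuple R)`_k.
Proof. by move=> lt_k; rewrite /tau comp_mpolyXU inordK. Qed.

Lemma trace_mod_nth k : (k < 7)%N -> trace_mod (trtuple R)`_k.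
Proof. by move=> /tauX <-; apply: trace_mod_tau. Qed.

Lemma trace_mod_det M : univ M -> trace_mod (\det M).
Proof.
have det1 N : \det N - 1 \in Jbor R -> trace_mod (\det N).
  exact: mod_image_gen.
case=> ->; apply: det1.
- exact: mem_head.
- by rewrite in_cons; apply/orP; right; apply: mem_head.
- by rewrite !in_cons; apply/orP; right; apply/orP; right; apply/orP; left.
Qed.

Lemma invariant_is_trace p : in_ideal (Jbor R) (dE p) -> in_ideal (Jbor R) (dF p) ->
  trace_mod p.
Proof.
move=> Ep Fp.
have hE M : univ M -> equivariant (@dE R) (mx2 0 1 0 0) M by apply: dconj_equivariant.
have hF M : univ M -> equivariant (@dF R) (mx2 0 0 1 0) M by apply: dconj_equivariant.
have hH M : univ M -> equivariant (@dH R) (mx2 (-1) 0 0 1) M by apply: dconj_equivariant.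
have EF (q : P) : dE (dF q) = dF (dE q) + dH q by case: (dsl2 q).
have HF (q : P) : dH (dF q) = dF (dH q) - 2%:R * dF q by case: (dsl2 q).
have gA : univ (Ma R) by constructor 1. have gB : univ (Mb R) by constructor 2.
have gC : univ (Mc R) by constructor 3.
have half n : exists c : P, [/\ c * n.+1%:R = 1, dE c = 0, dF c = 0 & trace_mod c].
  exists (n.+1%:R^-1)%:MP; split; try exact: dconjC; last exact: trace_modC.
  have -> : n.+1%:R = (n.+1%:R)%:MP :> P by rewrite (rmorph_nat (@mpolyC 12 K)).
  by rewrite -mpolyCM mulVf ?mpolyC1 // pnatr_eq0.
have TR_tr M : univ M -> trace_mod (\tr M).
  by case=> ->; [exact: (@trace_mod_nth 0) | exact: (@trace_mod_nth 1) | exact: (@trace_mod_nth 2)].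
have TR_AB : trace_mod (\tr (Ma R *m Mb R)) by exact: (@trace_mod_nth 3).
have TR_AC : trace_mod (\tr (Ma R *m Mc R)) by exact: (@trace_mod_nth 4).
have TR_BC : trace_mod (\tr (Mb R *m Mc R)) by exact: (@trace_mod_nth 5).
have TR_ABC : trace_mod (\tr (Ma R *m Mb R *m Mc R)) by exact: (@trace_mod_nth 6).
have ED := dconjD (mx2 0 1 0 0 : 'M[P]_2). have FD := dconjD (mx2 0 0 1 0 : 'M[P]_2).
have HD := dconjD (mx2 (-1) 0 0 1 : 'M[P]_2).
have EM := dconjM (mx2 0 1 0 0 : 'M[P]_2). have FM := dconjM (mx2 0 0 1 0 : 'M[P]_2).
have HM := dconjM (mx2 (-1) 0 0 1 : 'M[P]_2).
have [|q|q|s [[f hf] Js]] := @invariant_mod_ideal P (@dE R) (@dF R) (@dH R) ED FD HD EM FM HM EF HF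
  (Ma R) (Mb R) (Mc R) hE hF hH trace_mod trace_mod1 trace_modB trace_modM half TR_tr trace_mod_det
    TR_AB TR_AC TR_BC TR_ABC (Jbor R) p _ _ _ Ep Fp.
- move=> Q hC hX hD hM; apply: univ_ind => // c; apply: (hC).
  by split; [exact: dconjC | exact: dconjC | exact: trace_modC].
- apply: (@relator_ideal_D P (@dE R) ED EM (mx2 0 1 0 0) (Ma R) (Mb R) (Mc R)); exact: hE.
- apply: (@relator_ideal_D P (@dF R) FD FM (mx2 0 0 1 0) (Ma R) (Mb R) (Mc R)); exact: hF.
- apply: (mod_image_trans (s := s)).
  + exact: Js.
  + by exists f.
Qed.

End TraceRing.

(** * From invariance under the group to invariance under sl_2 *)

Section Vandermonde.
Variables (K : numFieldType) (T : comNzRingType) (iota : {rmorphism K -> T}) (gs : seq T).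

(* Replacing d(X) by d(2X) - 2^n d(X) kills the top coefficient. *)
Lemma in_ideal_coef (d : {poly T}) :
  (forall s : K, in_ideal gs d.[iota s]) -> forall k, in_ideal gs d`_k.
Proof.
elim: {d}_.+1 {-2}d (ltnSn (size d)) => // n IHn d; rewrite ltnS => size_d hd.
case: n IHn size_d => [|n] IHn size_d k.
  by move: size_d; rewrite size_poly_leq0 => /eqP ->; rewrite coef0; apply: in_ideal0.
have low j : (j < n)%N -> in_ideal gs d`_j.
  move=> lt_j.
  pose a i : K := 2%:R ^+ i - 2%:R ^+ n.
  have := IHn (\poly_(i < n) (iota (a i) * d`_i)) _ _ j.
  rewrite coef_poly lt_j => /(_ _ _)/wrap[||h].
  - by rewrite ltnS; apply: size_poly.
  - move=> s.
    have -> : (\poly_(i < n) (iota (a i) * d`_i)).[iota s] =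
        d.[iota (2%:R * s)] - iota (2%:R ^+ n) * d.[iota s].
      rewrite horner_poly !(horner_coef_wide _ size_d) mulr_sumr -sumrB big_ord_recr /=.
      rewrite [X in _ + X](_ : _ = 0) ?addr0; last first.
        by rewrite rmorphM exprMn !rmorphXn; ring.
      by apply: eq_bigr => i _; rewrite rmorphM exprMn rmorphB !rmorphXn /=; ring.
    by apply: in_idealB; [apply: hd | apply: in_idealM].
  have a0 : a j != 0.
    rewrite subr_eq0 -!natrX eqr_nat; apply/eqP => /eqP.
    by rewrite eqn_exp2l // => /eqP e; rewrite e ltnn in lt_j.
  have := in_idealM (iota (a j)^-1) h.
  by rewrite mulrA -rmorphM mulVf // rmorph1 mul1r.
case: (ltngtP k n) => [|lt_k|->]; first exact: low.
  by rewrite nth_default; [apply: in_ideal0 | apply: leq_trans lt_k].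
have := hd 1; rewrite (horner_coef_wide _ size_d) big_ord_recr /= rmorph1 expr1n mulr1 => h.
rewrite -[d`_n](addKr (\sum_(i < n) d`_i * 1 ^+ i)) addrC; apply: in_idealB => //.
by apply: in_ideal_sum => i _; rewrite expr1n mulr1; apply: low.
Qed.

(** Differentiation at s = 0 of a congruence known for every scalar s. *)
Lemma in_ideal_coef1 (d : {poly T}) :
  (forall s : K, in_ideal gs (d.[iota s] - d`_0)) -> in_ideal gs d`_1.
Proof.
move=> h; have := @in_ideal_coef (d - (d`_0)%:P) _ 1.
rewrite coefB coefC /= subr0; apply => s.
by rewrite hornerD hornerN hornerC.
Qed.

End Vandermonde.

(** As G has trace 0, the adjugate of 1 + t G is 1 - t G; the conjugate is quadratic in t, with
    linear coefficient the bracket of G and M. *)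
Lemma conj_unipotent (T : comNzRingType) (t b c : T) (M G : 'M[T]_2) (i j : 'I_2) :
  G = mx2 0 b c 0 ->
  ((1%:M + t *: G) *m M *m minv (1%:M + t *: G)) i j =
  ((M i j)%:P + (lie G M i j)%:P * 'X - ((G *m M *m G) i j)%:P * 'X^2).[t].
Proof.
move=> eG; rewrite eG; clear G eG.
have -> : (1%:M + t *: mx2 0 b c 0) = mx2 1 (t * b) (t * c) 1.
  apply/matrixP => -[[|[|//]] ?] [[|[|//]] ?]; rewrite !mxE /=; ring.
have -> : minv (mx2 1 (t * b) (t * c) 1) = 1%:M - t *: mx2 0 b c 0.
  rewrite mx2_adj; apply/matrixP => -[[|[|//]] ?] [[|[|//]] ?]; rewrite !mxE /=; ring.
have -> : mx2 1 (t * b) (t * c) 1 = 1%:M + t *: mx2 0 b c 0.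
  apply/matrixP => -[[|[|//]] ?] [[|[|//]] ?]; rewrite !mxE /=; ring.
set G := mx2 0 b c 0.
rewrite mulmxDl mul1mx mulmxBr mulmx1 mulmxDl /lie -!scalemxAl -!scalemxAr.
move: (G *m M *m G) (G *m M) (M *m G) => X Y Z; rewrite !hornerE !mxE /=; ring.
Qed.

Lemma coef_quadratic (T : comNzRingType) (x y z : T) (d := x%:P + y%:P * 'X - z%:P * 'X^2) :
  d`_0 = x /\ d`_1 = y.
Proof. by rewrite /d; split; rewrite !coefE /= ?mulr0n ?mulr1n; ring. Qed.

Lemma trseq_conj (T : comNzRingType) (g A B C : 'M[T]_2) (cj := fun A => g *m A *m minv g) :
  \det g = 1 -> trseq (cj A) (cj B) (cj C) = trseq A B C.
Proof.
move=> dg; have gg : minv g *m g = 1%:M by rewrite minvM dg.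
have cjM X Y : cj X *m cj Y = cj (X *m Y).
  by rewrite /cj -!mulmxA (mulmxA (minv g)) gg mul1mx.
have cj_tr X : \tr (cj X) = \tr X by rewrite /cj mxtrace_mulC mulmxA gg mul1mx.
by rewrite /trseq !cjM !cj_tr.
Qed.

Section Conjugation.
Variable R : realType.
Local Notation K := (CC R).
Local Notation P := (P12 R).
Implicit Types (g : 'M[K]_2) (M : 'M[P]_2).

Definition conjP g M : 'M[P]_2 := map_mx (@mpolyC 12 K) g *m M *m minv (map_mx (@mpolyC 12 K) g).

Definition conjh g : {rmorphism P -> P} := comp_mpoly (conj_tuple g).

Lemma ent_nth (A B C : 'M[P]_2) k : (k < 12)%N -> ent A B C k = (cvec A B C)`_k.
Proof.
by move: k => -[|[|[|[|[|[|[|[|[|[|[|[|//]]]]]]]]]]]] _; rewrite /ent /=; congr (_ _ _);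
  apply: val_inj; rewrite /= inordK.
Qed.

Lemma conjh_univ g M : univ M -> map_mx (conjh g) M = conjP g M.
Proof.
have [hA hB hC] := @univ_map _ P (conjh g) (conjP g (Ma R)) (conjP g (Mb R)) (conjP g (Mc R))
  (fun i => etrans (comp_mpolyXU _ _) (etrans (esym (tnth_nth 0 (conj_tuple g) i))
     (etrans (tnth_mktuple _ i) (ent_nth _ _ _ (ltn_ord i))))).
by case=> ->; [exact: hA | exact: hB | exact: hC].
Qed.

Lemma conjhC g c : conjh g c%:MP = c%:MP.
Proof. exact: comp_mpolyC. Qed.

Lemma tau_ev_eq (S : comNzRingType) (phi psi : {rmorphism P -> S}) f :
  (forall c, phi c%:MP = psi c%:MP) ->
  trseq (map_mx phi (Ma R)) (map_mx phi (Mb R)) (map_mx phi (Mc R)) =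
  trseq (map_mx psi (Ma R)) (map_mx psi (Mb R)) (map_mx psi (Mc R)) ->
  phi (tau f) = psi (tau f).
Proof. by move=> hC e; rewrite !tau_ev e; apply: evs_eq => c; apply: hC. Qed.

Lemma conj_tau g f : \det g = 1 -> conjh g (tau f) = tau f.
Proof.
move=> dg; have dgP : \det (map_mx (@mpolyC 12 K) g) = 1.
  by rewrite det_map_mx dg rmorph1.
have e (M : 'M[P]_2) : map_mx (@idfun P) M = M by apply/matrixP => i j; rewrite mxE.
have hA := conjh_univ g (Or31 _ _ (erefl (Ma R))).
have hB := conjh_univ g (Or32 _ _ (erefl (Mb R))).
have hC := conjh_univ g (Or33 _ _ (erefl (Mc R))).
apply: (@tau_ev_eq P (conjh g) (@idfun P) f (conjhC g)).
rewrite hA hB hC !e; exact: (trseq_conj (Ma R) (Mb R) (Mc R) dgP).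
Qed.

Lemma conj_expansion (b c : K) (bc : b * c = 0) p : exists d : {poly P},
  [/\ d`_0 = p, d`_1 = dconj (mx2 0 b%:MP c%:MP 0) p
    & forall s, conjh (1%:M + s *: mx2 0 b c 0) p = d.[s%:MP]].
Proof.
have eG : map_mx (@mpolyC 12 K) (mx2 0 b c 0) = mx2 0 b%:MP c%:MP 0 by rewrite map_mx2 rmorph0.
elim/univ_ind: p => [k|M i j hM|p q [d [d0 d1 hd]] [e [e0 e1 he]]|p q [d [d0 d1 hd]] [e [e0 e1 he]]].
- by exists k%:MP%:P; split=> [||s]; rewrite ?coefC ?dconjC ?conjhC ?hornerC.
- exists ((M i j)%:P + (lie (mx2 0 b%:MP c%:MP 0) M i j)%:P * 'X
     - ((mx2 0 b%:MP c%:MP 0 *m M *m mx2 0 b%:MP c%:MP 0) i j)%:P * 'X^2).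
  have hD : dconj (mx2 0 b%:MP c%:MP 0) (M i j) = lie (mx2 0 b%:MP c%:MP 0) M i j.
    by have /matrixP/(_ i j) := dconj_equivariant (mx2 0 b%:MP c%:MP 0) hM; rewrite mxE.
  split=> [||s].
  + exact: (proj1 (coef_quadratic _ _ _)).
  + by rewrite hD; exact: (proj2 (coef_quadratic _ _ _)).
  + have /matrixP/(_ i j) := conjh_univ (1%:M + s *: mx2 0 b c 0) hM; rewrite mxE => ->.
    rewrite /conjP map_mxD map_mx1 map_mxZ eG.
    exact: conj_unipotent.
- exists (d + e); split=> [||s]; first by rewrite coefD d0 e0.
    by rewrite coefD d1 e1 dconjD.
  by rewrite rmorphD hd he hornerD.
- exists (d * e); split=> [||s]; first by rewrite coefM big_ord_recl big_ord0 addr0 d0 e0.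
    by rewrite coefM !big_ord_recl big_ord0 addr0 d0 e0 d1 e1 dconjM addrC.
  by rewrite rmorphM hd he hornerM.
Qed.

(** The condition b c = 0 makes s -> 1 + s G a curve in SL_2, in fact a one-parameter subgroup,
    whose derivative at 0 is the derivation attached to G. *)
Lemma Binv_dconj (b c : K) p : b * c = 0 -> Binv p ->
  in_ideal (Jbor R) (dconj (mx2 0 b%:MP c%:MP 0) p).
Proof.
move=> bc hp; have [d [d0 d1 hd]] := conj_expansion bc p.
rewrite -d1; apply: (@in_ideal_coef1 K P (@mpolyC 12 K) (Jbor R) d) => s.
rewrite -hd d0; apply: hp.
have -> : 1%:M + s *: mx2 0 b c 0 = mx2 1 (s * b) (s * c) 1.
  by apply/matrixP => -[[|[|//]] ?] [[|[|//]] ?]; rewrite !mxE /=; ring.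
by rewrite mx2_det mulrACA bc mulr0 subr0 mulr1.
Qed.

Lemma trace_surjective p : Binv p -> exists f : P7 R, in_ideal (Jbor R) (p - tau f).
Proof.
move=> hp; apply: invariant_is_trace.
- have := Binv_dconj (mulr0 1) hp; rewrite rmorph0 rmorph1; exact.
- have := Binv_dconj (mul0r 1) hp; rewrite rmorph0 rmorph1; exact.
Qed.

Lemma trace_invariant (f : P7 R) : Binv (tau f).
Proof.
move=> g dg; have e := conj_tau f dg; rewrite (_ : _ - _ = 0); first exact: in_ideal0.
by apply/eqP; rewrite subr_eq0; apply/eqP; exact: e.
Qed.

End Conjugation.

(** * The component X_0 *)

Section ToricMonomials.
Variables (Q : comNzRingType) (a b c ab ac bc abc : Q).
Hypotheses (r1 : a * bc = b * ac) (r2 : b * ac = c * ab) (r3 : a * abc = ab * ac)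
  (r4 : b * abc = ab * bc) (r5 : c * abc = ac * bc).

Definition mon7 i0 i1 i2 i3 i4 i5 i6 : Q :=
  a ^+ i0 * b ^+ i1 * c ^+ i2 * ab ^+ i3 * ac ^+ i4 * bc ^+ i5 * abc ^+ i6.

(* The standard monomials are those supported on a cone of the pentagonal fan with rays
   a, b, bc, abc, ac (in this cyclic order), times monomials in c and ab. *)
Definition std_mon (k x y z : nat) : Q :=
  let u := (k - (y + z))%N in let u' := (y + z - k)%N in
  let w := (k - (x + z))%N in let w' := (x + z - k)%N in
  mon7 u w (z - maxn u' w') (x - u - w') (w' - u') (u' - w') (minn u' w').

(** The five relations rewrite the five products of two non-adjacent rays of the pentagon, and each
    rewriting lowers the total exponent of the rays, which is the quantity bounded by n. *)
Lemma mon7_std n i0 i1 i2 i3 i4 i5 i6 : (i0 + i1 + i4 + i5 + i6 <= n)%N ->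
  mon7 i0 i1 i2 i3 i4 i5 i6 =
  std_mon (i0 + i1 + i2 + i3 + i4 + i5 + i6) (i0 + i3 + i4 + i6) (i1 + i3 + i5 + i6)
    (i2 + i4 + i5 + i6).
Proof.
elim: n i0 i1 i2 i3 i4 i5 i6 => [|n IHn] i0 i1 i2 i3 i4 i5 i6 hn.
  by rewrite /std_mon; congr mon7; lia.
have step j0 j1 j2 j3 j4 j5 j6 : (j0 + j1 + j4 + j5 + j6 <= n)%N ->
    (j0 + j1 + j2 + j3 + j4 + j5 + j6 = i0 + i1 + i2 + i3 + i4 + i5 + i6)%N ->
    (j0 + j3 + j4 + j6 = i0 + i3 + i4 + i6)%N -> (j1 + j3 + j5 + j6 = i1 + i3 + i5 + i6)%N ->
    (j2 + j4 + j5 + j6 = i2 + i4 + i5 + i6)%N ->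
    mon7 i0 i1 i2 i3 i4 i5 i6 = mon7 j0 j1 j2 j3 j4 j5 j6 ->
    mon7 i0 i1 i2 i3 i4 i5 i6 = std_mon (i0 + i1 + i2 + i3 + i4 + i5 + i6)
      (i0 + i3 + i4 + i6) (i1 + i3 + i5 + i6) (i2 + i4 + i5 + i6).
  by move=> h e1 e2 e3 e4 ->; rewrite IHn // e1 e2 e3 e4.
case: (boolP ((0 < i0) && (0 < i5)))%N => [/andP[]|h1].
  case: i0 i5 hn step => [|i0] [|i5] //= hn step _ _.
  apply: (step i0 i1 i2.+1 i3.+1 i4 i5 i6); try lia.
  have e : a * bc = c * ab by rewrite r1.
  rewrite /mon7 !exprS; move: (a ^+ i0) (bc ^+ i5) (c ^+ i2) (ab ^+ i3) => A BC C AB.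
  by transitivity ((a * bc) * (A * b ^+ i1 * C * AB * ac ^+ i4 * BC * abc ^+ i6));
    [ring | rewrite e; ring].
case: (boolP ((0 < i1) && (0 < i4)))%N => [/andP[]|h2].
  case: i1 i4 hn step h1 => [|i1] [|i4] //= hn step _ _ _.
  apply: (step i0 i1 i2.+1 i3.+1 i4 i5 i6); try lia.
  rewrite /mon7 !exprS; move: (b ^+ i1) (ac ^+ i4) (c ^+ i2) (ab ^+ i3) => B AC C AB.
  by transitivity ((b * ac) * (a ^+ i0 * B * C * AB * AC * bc ^+ i5 * abc ^+ i6));
    [ring | rewrite r2; ring].
case: (boolP ((0 < i0) && (0 < i6)))%N => [/andP[]|h3].
  case: i0 i6 hn step h1 h2 => [|i0] [|i6] //= hn step _ _ _ _.
  apply: (step i0 i1 i2 i3.+1 i4.+1 i5 i6); try lia.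
  rewrite /mon7 !exprS; move: (a ^+ i0) (abc ^+ i6) (ac ^+ i4) (ab ^+ i3) => A ABC AC AB.
  by transitivity ((a * abc) * (A * b ^+ i1 * c ^+ i2 * AB * AC * bc ^+ i5 * ABC));
    [ring | rewrite r3; ring].
case: (boolP ((0 < i1) && (0 < i6)))%N => [/andP[]|h4].
  case: i1 i6 hn step h1 h2 h3 => [|i1] [|i6] //= hn step _ _ _ _ _.
  apply: (step i0 i1 i2 i3.+1 i4 i5.+1 i6); try lia.
  rewrite /mon7 !exprS; move: (b ^+ i1) (abc ^+ i6) (bc ^+ i5) (ab ^+ i3) => B ABC BC AB.
  by transitivity ((b * abc) * (a ^+ i0 * B * c ^+ i2 * AB * ac ^+ i4 * BC * ABC));
    [ring | rewrite r4; ring].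
case: (boolP ((0 < i4) && (0 < i5)))%N => [/andP[]|h5].
  case: i4 i5 hn step h1 h2 h3 h4 => [|i4] [|i5] //= hn step _ _ _ _ _ _.
  apply: (step i0 i1 i2.+1 i3 i4 i5 i6.+1); try lia.
  rewrite /mon7 !exprS; move: (ac ^+ i4) (abc ^+ i6) (bc ^+ i5) (c ^+ i2) => AC ABC BC C.
  by transitivity ((ac * bc) * (a ^+ i0 * b ^+ i1 * C * ab ^+ i3 * AC * BC * ABC));
    [ring | rewrite -r5; ring].
(* With no two non-adjacent rays left, the exponents are determined by the multidegree. *)
by rewrite /std_mon; congr mon7; lia.
Qed.

End ToricMonomials.

Section MonomialSpan.
Variables (K : comNzRingType) (n d : nat) (Q : comNzRingType) (h : {rmorphism K -> Q})
  (w : 'X_{1..n} -> Q).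

Definition mono_span (g : {mpoly K[n]}) : Q := \sum_(m : 'X_{1..n < d}) h g@_m * w m.

Lemma mono_span_sum (I : Type) (r : seq I) (g : I -> {mpoly K[n]}) :
  mono_span (\sum_(i <- r) g i) = \sum_(i <- r) mono_span (g i).
Proof.
rewrite exchange_big /=; apply: eq_bigr => m _.
by rewrite linear_sum rmorph_sum mulr_suml.
Qed.

Lemma mono_spanX c (e : 'X_{1..n}) : (mdeg e < d)%N -> mono_span (c *: 'X_[e]) = h c * w e.
Proof.
move=> lt_e; rewrite /mono_span (bigD1 (BMultinom lt_e)) //= mcoeffZ mcoeffX eqxx mulr1.
rewrite big1 ?addr0 // => m ne_m; rewrite mcoeffZ mcoeffX.
have /negbTE -> : e != m by rewrite eq_sym; exact: ne_m.
by rewrite mulr0 rmorph0 mul0r.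
Qed.

End MonomialSpan.

Lemma toric_monomial (T : comNzRingType) (k x y z : T) n0 n1 n2 n3 n4 n5 n6 :
  (k * x) ^+ n0 * (k * y) ^+ n1 * (k * z) ^+ n2 * (k * (x * y)) ^+ n3 * (k * (x * z)) ^+ n4 *
    (k * (y * z)) ^+ n5 * (k * (x * y * z)) ^+ n6 =
  k ^+ (n0 + n1 + n2 + n3 + n4 + n5 + n6) * x ^+ (n0 + n3 + n4 + n6) *
    y ^+ (n1 + n3 + n5 + n6) * z ^+ (n2 + n4 + n5 + n6).
Proof. by rewrite !exprMn !exprD; ring. Qed.

Section ToricKernel.
Variables (K Q : comNzRingType) (psi : {rmorphism {mpoly K[7]} -> Q}).
Local Notation t i := (psi 'X_(inord i)).

Definition toric4 (T : comNzRingType) (k x y z : T) : seq T :=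
  [:: k * x; k * y; k * z; k * (x * y); k * (x * z); k * (y * z); k * (x * y * z)].

Definition toric_map : {rmorphism {mpoly K[7]} -> {mpoly K[4]}} :=
  evs (@mpolyC 4 K) 7 (toric4 'X_(inord 0) 'X_(inord 1) 'X_(inord 2) 'X_(inord 3)).

Definition toric_exp (m : 'X_{1..7}) : 'X_{1..4} :=
  let m i := m (inord i) in
  [multinom nth 0 [:: m 0 + m 1 + m 2 + m 3 + m 4 + m 5 + m 6;
     m 0 + m 3 + m 4 + m 6; m 1 + m 3 + m 5 + m 6; m 2 + m 4 + m 5 + m 6] i | i < 4]%N.

Lemma prod7 (S : comNzRingType) (g : 'I_7 -> S) :
  \prod_i g i = g (inord 0) * g (inord 1) * g (inord 2) * g (inord 3) * g (inord 4) *
    g (inord 5) * g (inord 6).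
Proof.
rewrite !big_ord_recl big_ord0 mulr1 !mulrA.
by do ![congr (_ * _)]; congr g; apply: val_inj; rewrite /= inordK.
Qed.

Lemma prod4 (S : comNzRingType) (g : 'I_4 -> S) :
  \prod_i g i = g (inord 0) * g (inord 1) * g (inord 2) * g (inord 3).
Proof.
rewrite !big_ord_recl big_ord0 mulr1 !mulrA.
by do ![congr (_ * _)]; congr g; apply: val_inj; rewrite /= inordK.
Qed.

Lemma toric_mapX m : toric_map 'X_[m] = 'X_[toric_exp m].
Proof.
rewrite /toric_map [LHS]mmapX /mmap1 prod7 [RHS]mpolyXE_id prod4 !mnmE !inordK //=.
exact: toric_monomial.
Qed.

Local Notation a := (t 0). Local Notation b := (t 1). Local Notation c := (t 2).
Local Notation ab := (t 3). Local Notation ac := (t 4). Local Notation bc := (t 5).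
Local Notation abc := (t 6).

(** The image of a monomial under [psi] depends only on its toric multidegree, so [psi] factors
    through the toric map. The factorisation is [mono_span], cut off above the degrees that occur so
    as to be a finite sum. *)
Lemma toric_kernel f : a * bc = b * ac -> b * ac = c * ab -> a * abc = ab * ac ->
  b * abc = ab * bc -> c * abc = ac * bc -> toric_map f = 0 -> psi f = 0.
Proof.
move=> r1 r2 r3 r4 r5 hf.
pose w (e : 'X_{1..4}) := std_mon a b c ab ac bc abc (e (inord 0)) (e (inord 1)) (e (inord 2))
  (e (inord 3)).
have psiX m : psi 'X_[m] = w (toric_exp m).
  rewrite [in LHS]mpolyXE_id rmorph_prod prod7 !rmorphXn /w !mnmE !inordK //=.
  exact: (mon7_std r1 r2 r3 r4 r5 _ _ (leqnn _)).
pose d := (\max_(m <- msupp f) mdeg (toric_exp m)).+1.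
have e1 : psi f = mono_span d (psi \o @mpolyC 7 K) w (toric_map f).
  rewrite [f in RHS]mpolyE [f in LHS]mpolyE !rmorph_sum mono_span_sum big_seq [RHS]big_seq.
  apply: eq_bigr => m hm; rewrite -mul_mpolyC !rmorphM /= psiX toric_mapX.
  have -> : toric_map (f@_m)%:MP = (f@_m)%:MP by exact: evsC.
  by rewrite mul_mpolyC mono_spanX // ltnS; apply: leq_bigmax_seq.
rewrite e1 hf /mono_span big1 // => m _.
by rewrite mcoeff0 rmorph0 mul0r.
Qed.

End ToricKernel.

(** * Curves in the direction of k, and lifting of quotients *)

Section X0Curve.
Variable T : comNzRingType.
Implicit Types k x y z : T.

Definition X0eq k x y z : T :=
  k ^+ 2 * ((1 - k) ^+ 2 * (x * y * z) ^+ 2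
    + (1 - k) * ((x * y) ^+ 2 + (x * z) ^+ 2 + (y * z) ^+ 2) + (x ^+ 2 + y ^+ 2 + z ^+ 2)) - 4%:R.

Lemma I0g_toric k x y z : app7 (@I0g T) (toric4 k x y z) = [:: X0eq k x y z; 0; 0; 0; 0; 0].
Proof. by rewrite /app7 /I0g /pBg /qBg /X0eq /=; congr [:: _; _; _; _; _; _]; ring. Qed.

End X0Curve.

Section ToricCurves.
Variable K : numFieldType.
Implicit Types (f : {mpoly K[7]}) (x y z k : K).

Definition curve x y z : {rmorphism {mpoly K[7]} -> {poly K}} :=
  evs (@polyC K) 7 (toric4 'X x%:P y%:P z%:P).

Lemma curve_eval x y z k f : (curve x y z f).[k] = evs (@idfun K) 7 (toric4 k x y z) f.
Proof.
rewrite -[LHS]/(horner_eval k _) (evs_comp (@polyC K) (horner_eval k)).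
have -> : map (horner_eval k) (toric4 'X x%:P y%:P z%:P) = toric4 k x y z.
  by rewrite /toric4 /= /horner_eval !hornerE.
by apply: evs_eq => c /=; rewrite /horner_eval hornerC.
Qed.

Lemma toric_map_eval (v : 'I_4 -> K) f : (toric_map K f).@[v] =
  (curve (v (inord 1)) (v (inord 2)) (v (inord 3)) f).[v (inord 0)].
Proof.
rewrite curve_eval /toric_map (evs_comp (@mpolyC 4 K) (meval v)).
have -> : map (meval v) (toric4 'X_(inord 0) 'X_(inord 1) 'X_(inord 2) 'X_(inord 3)) =
    toric4 (v (inord 0)) (v (inord 1)) (v (inord 2)) (v (inord 3)).
  by rewrite /toric4 /= !mevalM !mevalXU.
by apply: evs_eq => c /=; rewrite mevalC.
Qed.

Definition trunc n f : {mpoly K[7]} := \sum_(m <- msupp f | (mdeg m < n)%N) f@_m *: 'X_[m].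

Lemma curveX x y z (m : 'X_{1..7}) : exists c, curve x y z 'X_[m] = c *: 'X^(mdeg m).
Proof.
have dm : mdeg m = (m (inord 0) + m (inord 1) + m (inord 2) + m (inord 3) + m (inord 4) +
    m (inord 5) + m (inord 6))%N.
  rewrite mdegE !big_ord_recl big_ord0 addn0 !addnA.
  by do ![congr addn]; congr (m _); apply: val_inj; rewrite /= inordK.
rewrite [curve _ _ _ _]mmapX /mmap1 prod7 !inordK //=.
rewrite toric_monomial -dm -!polyC_exp -!mulrA -!polyCM mulrC mul_polyC; by eexists.
Qed.

Lemma curve_sum x y z f :
  curve x y z f = \sum_(m <- msupp f) f@_m *: curve x y z 'X_[m].
Proof.
rewrite [in LHS](mpolyE f) rmorph_sum; apply: eq_bigr => m _ /=.
by rewrite -mul_mpolyC rmorphM /= -mul_polyC; congr (_ * _); exact: evsC.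
Qed.

Lemma take_polyX (c : K) n j : take_poly n (c *: 'X^j) = if (j < n)%N then c *: 'X^j else 0.
Proof.
apply/polyP => i; rewrite coef_take_poly coefZ coefXn.
case: (ltnP j n) => h; rewrite ?coefZ ?coefXn ?coef0; case: (ltnP i n) => // hi.
- by rewrite gtn_eqF ?mulr0 //; apply: leq_trans hi.
- by rewrite ltn_eqF ?mulr0 //; apply: leq_trans h.
Qed.

Lemma curve_trunc n x y z f : curve x y z (trunc n f) = take_poly n (curve x y z f).
Proof.
rewrite (curve_sum x y z f) take_poly_sum /trunc rmorph_sum big_mkcond /=.
apply: eq_bigr => m _; have [c e] := curveX x y z m.
rewrite e scalerA take_polyX; case: ifP => // _.
rewrite -mul_mpolyC rmorphM /= e -scalerA -[RHS]mul_polyC; congr (_ * _); exact: evsC.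
Qed.

Lemma size_curve x y z f : (size (curve x y z f) <= msize f)%N.
Proof.
rewrite curve_sum; apply: leq_trans (size_sum _ _ _) _; apply/bigmax_leqP_seq => m hm _.
have [c ->] := curveX x y z m; rewrite scalerA.
apply: leq_trans (size_scale_leq _ _) _; rewrite size_polyXn.
exact: msize_mdeg_lt.
Qed.

End ToricCurves.

Section Criterion.
Variables (K : numFieldType) (gs : seq {mpoly K[7]}) (F7 : {mpoly K[7]}).
Local Notation t i := ('X_(inord i) : {mpoly K[7]}).
Hypotheses (hF : in_ideal gs F7)
  (h1 : in_ideal gs (t 0 * t 5 - t 1 * t 4)) (h2 : in_ideal gs (t 1 * t 4 - t 2 * t 3))
  (h3 : in_ideal gs (t 0 * t 6 - t 3 * t 4)) (h4 : in_ideal gs (t 1 * t 6 - t 3 * t 5))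
  (h5 : in_ideal gs (t 2 * t 6 - t 4 * t 5)).

Definition X0poly (x y z : K) : {poly K} := X0eq 'X x%:P y%:P z%:P.
Hypothesis curveF : forall x y z, curve x y z F7 = X0poly x y z.

Lemma in_ideal_toric f : toric_map K f = 0 -> in_ideal gs f.
Proof.
move=> f0; have [one|none] := EM (in_ideal gs 1).
  by rewrite -[f]mulr1; apply: in_idealM.
have [Q [pr prP]] := quotient_ring none; apply/prP.
by apply: (toric_kernel (psi := pr)) f0; apply/eqP; rewrite -subr_eq0 -!rmorphM -rmorphB;
  apply/eqP/prP.
Qed.

Lemma X0poly_at0 x y z : (X0poly x y z).[0] = - 4%:R.
Proof. by rewrite /X0poly /X0eq -(rmorph_nat (@polyC K)) !hornerE; ring. Qed.

Lemma four_neq0 : 4%:R != 0 :> K. Proof. by rewrite pnatr_eq0. Qed.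

(** The restriction of s to the curve is divisible by k, so G restricts to H modulo k^n, n exceeds
    the degree of H, and truncation recovers H exactly. *)
Lemma quotient_trunc x y z n (f G : {mpoly K[7]}) (s := 1 + (4%:R^-1)%:MP * F7)
    (H : {poly K}) :
  F7 * G = f - s ^+ n * f -> (size (curve x y z f) <= n)%N ->
  curve x y z f = H * X0poly x y z -> curve x y z (trunc n G) = H.
Proof.
move=> eG size_f eH; set phi := curve x y z; set P := X0poly x y z.
have P0 : P.[0] != 0 by rewrite X0poly_at0 oppr_eq0 four_neq0.
have Pn0 : P != 0 by apply: contraNneq P0 => ->; rewrite horner0.
have size_H : (size H <= n)%N.
  have [->|H0] := eqVneq H 0; first by rewrite size_poly0.
  apply: leq_trans size_f; rewrite eH size_proper_mul ?mulf_neq0 ?lead_coef_eq0 //.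
  have := size_poly_gt0 P; rewrite Pn0; case: (size P) => // m _.
  by rewrite addnS leq_addr.
have s0 : (phi s).[0] = 0.
  have -> : phi s = 1 + (4%:R^-1)%:P * P.
    by rewrite /s rmorphD rmorph1 rmorphM /phi curveF; congr (_ + _ * _); exact: evsC.
  rewrite hornerD hornerM !hornerC X0poly_at0.
  by have := four_neq0; move: (4%:R : K) => c hc; rewrite mulrN mulVf // subrr.
have dvd : 'X^n %| (phi G - H).
  have co : coprimep 'X^n P.
    by rewrite coprimep_sym; apply: coprimep_expr; rewrite coprimepX.
  rewrite -(Gauss_dvdpr _ co).
  have -> : P * (phi G - H) = - (phi s ^+ n * phi f).
    rewrite mulrBr /P -curveF -/phi -rmorphM eG rmorphB rmorphM rmorphXn /phi curveF eH; ring.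
  rewrite dvdpNr; apply: dvdp_mulr; apply: dvdp_exp2r.
  by rewrite -['X]subr0 -polyC0 -[X in _ %| X]/(phi s) dvdp_XsubCl; apply/rootP.
rewrite curve_trunc -[H in RHS](take_poly_id size_H) -/phi.
apply/eqP; rewrite -subr_eq0 -[take_poly n H]opprK opprK -linearB /=.
by move/dvdpP: dvd => [q ->]; rewrite take_polyMXn_0.
Qed.

(** The lift [trunc n G] of the quotient does not depend on (x, y, z), so f - F7 * [trunc n G]
    vanishes at all generic toric points and belongs to the toric part of the ideal. *)
Lemma X0_criterion (d : {mpoly K[4]}) f : d != 0 ->
  (forall v : 'I_4 -> K, d.@[v] != 0 ->
    X0poly (v (inord 1)) (v (inord 2)) (v (inord 3)) %|
    curve (v (inord 1)) (v (inord 2)) (v (inord 3)) f) -> in_ideal gs f.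
Proof.
move=> d0 hf; set s := 1 + (4%:R^-1)%:MP * F7; pose n := msize f.
(* A partial sum of the geometric series for f / F7, since F7 = -4 (1 - s). *)
pose G : {mpoly K[7]} := - ((4%:R^-1)%:MP * (\sum_(i < n) s ^+ i * f)).
have eG : F7 * G = f - s ^+ n * f.
  transitivity ((1 - s ^+ n) * f); last by rewrite mulrBl mul1r.
  rewrite -opprB (subrX1 s n) /G.
  rewrite -mulr_suml /s; ring.
have : toric_map K (f - F7 * trunc n G) = 0.
  apply: (mpoly_eq0_generic d0) => v /hf /dvdpP[H eH]; rewrite toric_map_eval.
  rewrite rmorphB rmorphM curveF (quotient_trunc eG _ eH) ?size_curve //.
  by rewrite eH mulrC subrr horner0.
move=> /in_ideal_toric h; rewrite -(subrK (F7 * trunc n G) f).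
by apply: in_idealD h _; rewrite mulrC; apply: in_idealM.
Qed.

End Criterion.

Lemma dvdp_expr_roots (K : closedFieldType) (p q : {poly K}) n : p != 0 -> (size p <= n.+1)%N ->
  (forall k, root p k -> root q k) -> p %| q ^+ n.
Proof.
move=> p0 size_p hr; have [rs ers] := closed_field_poly_normal p.
have lp0 : lead_coef p != 0 by rewrite lead_coef_eq0.
have size_rs : (size rs <= n)%N.
  by rewrite -ltnS; apply: leq_trans size_p; rewrite ers size_scale // size_prod_XsubC.
apply: dvdp_trans (dvdp_exp2l _ size_rs).
rewrite ers dvdpZl //; have : all (root q) rs.
  by apply/allP => k kin; apply: hr; rewrite ers rootZ // root_prod_XsubC.
elim: rs {ers size_rs} => [|k rs IH] /=; first by rewrite big_nil dvd1p.
move=> /andP[hk /IH h]; rewrite big_cons exprS; apply: dvdp_mul => //.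
by rewrite dvdp_XsubCl.
Qed.

(** * Generic points of X_0 and their representations *)

Section Genericity.
Variable T : comNzRingType.
Implicit Types k x y z : T.

(* X0eq at k = 2 / x, up to the factor 4 / x^3 *)
Definition at_two_x x y z : T :=
  x * (x - 2%:R) ^+ 2 * (y * z) ^+ 2 + (x - 2%:R) * (x ^+ 2 * (y ^+ 2 + z ^+ 2) + (y * z) ^+ 2)
  + x * (y ^+ 2 + z ^+ 2).

(** The factors exclude, in order: zero coordinates; common zeros of P and Q (x^2 = 1 or y^2 = 1);
    the root k = 1; the root k = 2; and k x = 2 or k x = -2, where the traceless part of a would
    have norm 0. *)
Definition X0generic x y z : T :=
  x * y * z * (x ^+ 2 - 1) * (y ^+ 2 - 1) * (x ^+ 2 + y ^+ 2 + z ^+ 2 - 4%:R) *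
  ((x * y * z) ^+ 2 - ((x * y) ^+ 2 + (x * z) ^+ 2 + (y * z) ^+ 2) + (x ^+ 2 + y ^+ 2 + z ^+ 2) - 1)
  * at_two_x x y z * at_two_x (- x) y z.

Definition X0P k x y : T := k ^+ 2 * (1 + (1 - k) * x ^+ 2) * (1 + (1 - k) * y ^+ 2).
Definition X0Q k x y : T :=
  k ^+ 2 * ((1 - k) * (x * y) ^+ 2 + x ^+ 2 + y ^+ 2) - 4%:R.

Lemma X0eqE k x y z : X0eq k x y z = X0P k x y * z ^+ 2 + X0Q k x y.
Proof. by rewrite /X0eq /X0P /X0Q; ring. Qed.

End Genericity.

Section GenericRoots.
Variable K : numFieldType.
Implicit Types k x y z : K.

Lemma X0generic_neq0 x y z : X0generic x y z != 0 ->
  [/\ x != 0, y != 0, z != 0, x ^+ 2 != 1 & y ^+ 2 != 1] /\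
  [/\ x ^+ 2 + y ^+ 2 + z ^+ 2 != 4%:R,
   (x * y * z) ^+ 2 - ((x * y) ^+ 2 + (x * z) ^+ 2 + (y * z) ^+ 2) + (x ^+ 2 + y ^+ 2 + z ^+ 2) != 1,
   at_two_x x y z != 0 & at_two_x (- x) y z != 0].
Proof.
rewrite /X0generic !mulf_eq0 !negb_or !subr_eq0 => /andP[/andP[/andP[/andP[/andP[/andP[/andP[/andP[
  x0 y0] z0] x1] y1] h4] h1] hx] hx'].
by [].
Qed.

Lemma X0P_coprime k x y z : X0generic x y z != 0 -> X0eq k x y z = 0 -> X0P k x y != 0.
Proof.
move=> /X0generic_neq0[[x0 y0 z0 x1 y1] _] e; apply/eqP => P0.
have Q0 : X0Q k x y = 0 by move: e; rewrite X0eqE P0 mul0r add0r.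
have n4 : 4%:R != 0 :> K by rewrite pnatr_eq0.
have key a b : (1 + (1 - k) * a ^+ 2) = 0 -> X0Q k a b = 0 -> a ^+ 2 = 1.
  move=> ea eq; apply/eqP; rewrite -subr_eq0 -sqrf_eq0; apply/eqP.
  (* An elimination identity: (a^2 - 1)^2 is a combination of Q and 1 + (1 - k) a^2, so that k and b
     disappear. *)
  have -> : (a ^+ 2 - 1) ^+ 2 = a ^+ 2 * X0Q k a b - (1 + (1 - k) * a ^+ 2) *
      (k ^+ 2 * a ^+ 2 * b ^+ 2 - 2%:R * (1 + a ^+ 2) + (1 + (1 - k) * a ^+ 2)).
    by rewrite /X0Q; ring.
  by rewrite ea eq; ring.
have QC : X0Q k y x = 0 by rewrite -Q0 /X0Q; ring.
move/eqP: P0; rewrite /X0P mulf_eq0 => /orP[|/eqP/key/(_ QC) h]; last by rewrite h eqxx in y1.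
rewrite mulf_eq0 => /orP[|/eqP/key/(_ Q0) h]; last by rewrite h eqxx in x1.
rewrite expf_eq0 /= => /eqP k0; move: n4; rewrite -oppr_eq0 -Q0 => /eqP; apply.
by rewrite /X0Q k0; ring.
Qed.

Lemma X0_roots k x y z : X0generic x y z != 0 -> X0eq k x y z = 0 ->
  [/\ k != 0, k != 1, k != 2%:R, 1 - (k * x / 2%:R) ^+ 2 != 0 & X0Q k x y != 0].
Proof.
move=> gen e; have P0 := X0P_coprime gen e; have [[x0 y0 z0 x1 y1] [h4 h1 hx hx']] := X0generic_neq0 gen.
have n4 : 4%:R != 0 :> K by rewrite pnatr_eq0.
have n2 : 2%:R != 0 :> K by rewrite pnatr_eq0.
split.
- apply: contraNneq n4 => k0; rewrite -oppr_eq0; apply/eqP; rewrite -e k0 /X0eq; ring.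
- apply: contraNneq h4 => k1; rewrite -subr_eq0; apply/eqP; rewrite -e k1 /X0eq; ring.
- apply: contraNneq h1 => k2; rewrite -subr_eq0 -(mulrI_eq0 _ (mulfI n4)); apply/eqP.
  rewrite -e k2 /X0eq; ring.
- have two_x t : t != 0 -> X0eq k t y z = 0 -> k * t = 2%:R -> at_two_x t y z = 0.
    move=> t0 et /(canRL (mulfK t0)) ek; move: et; rewrite ek => et.
    transitivity (t ^+ 3 / 4%:R * X0eq (2%:R / t) t y z); last by rewrite et mulr0.
    by rewrite /at_two_x /X0eq; field; rewrite t0.
  rewrite subr_eq0 eq_sym sqrf_eq1; apply/norP; split.
    apply: contraNneq hx => h; apply/eqP/two_x => //.
    by rewrite -(divfK n2 (k * x)) h mul1r.
  apply: contraNneq hx' => h; apply/eqP/two_x; rewrite ?oppr_eq0 //.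
    by rewrite -e /X0eq; ring.
  by rewrite mulrN -(divfK n2 (k * x)) h mulN1r opprK.
- apply: contraNneq P0 => Q0; move/eqP: e; rewrite X0eqE Q0 addr0 mulf_eq0 expf_eq0 (negbTE z0).
  by rewrite orbF.
Qed.

End GenericRoots.

(* Gram data of a generic point of X_0, parametrised by k = 2 l. *)
Section GramData.
Variable T : comNzRingType.
Implicit Types l x y z : T.

Definition X0gram l x y : T := x * y * l * (l - 1).
Definition X0vol l x y z : T := - (l * (l - 1) * (2%:R * l - 1) * (x * y * z)).

Lemma X0_gram l x y z : X0eq (2%:R * l) x y z = 4%:R * (X0vol l x y z ^+ 2 -
   gram (l * x) (l * y) (l * z) (X0gram l y z) (X0gram l x z) (X0gram l x y)).
Proof. by rewrite /gram /X0eq /X0gram /X0vol; ring. Qed.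

Lemma X0_minor l x y : X0Q (2%:R * l) x y =
  - (4%:R * ((1 - (l * x) ^+ 2) * (1 - (l * y) ^+ 2) - X0gram l x y ^+ 2)).
Proof. by rewrite /X0Q /X0gram; ring. Qed.

Lemma X0_tpt l x y z : tpt (l * x) (l * y) (l * z) (X0gram l y z) (X0gram l x z) (X0gram l x y)
  (X0vol l x y z) = toric4 (2%:R * l) x y z.
Proof. by rewrite /tpt /toric4 /X0gram /X0vol; congr [:: _; _; _; _; _; _; _]; ring. Qed.

Lemma X0_relator l x y z :
  (l * y * (l * z) + X0gram l y z) * minorE (l * y) (X0gram l y z) (X0gram l x z) (X0gram l x y)
    + (l * y * X0gram l y z - l * z * (1 - (l * y) ^+ 2)) * X0vol l x y z = 0.
Proof. by rewrite /minorE /X0gram /X0vol; ring. Qed.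

Lemma X0_relator' l x y z :
  (l * y * (l * z) + X0gram l y z) * minorE (l * z) (X0gram l x z) (X0gram l x y) (X0gram l y z)
    + (l * z * X0gram l y z - l * y * (1 - (l * z) ^+ 2)) * X0vol l x y z = 0.
Proof. by rewrite /minorE /X0gram /X0vol; ring. Qed.

Lemma X0gramC l x y : X0gram l x y = X0gram l y x.
Proof. by rewrite /X0gram; ring. Qed.

Lemma X0volC l x y z : X0vol l x y z = X0vol l x z y /\ X0vol l x y z = X0vol l y z x.
Proof. by rewrite /X0vol; split; ring. Qed.

End GramData.

Section GenericPoints.
Variable K : numClosedFieldType.
Implicit Types k x y z : K.

(** At a generic root the triple product, 1 - (l x)^2 and the minor of a, b are all nonzero, which
    is what the Gram realisation and the reduction of the relators to scalar equations require;
    those equations hold identically in l, x, y, z. *)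
Lemma X0_realised k x y z : X0generic x y z != 0 -> X0eq k x y z = 0 ->
  exists A B C : 'M[K]_2, bor_rep A B C /\ trseq A B C = toric4 k x y z.
Proof.
move=> gen e; have [k0 k1 k2 kx Q0] := X0_roots gen e.
have [[x0 y0 z0 _ _] _] := X0generic_neq0 gen.
have n2 : 2%:R != 0 :> K by rewrite pnatr_eq0.
have n4 : 4%:R != 0 :> K by rewrite pnatr_eq0.
pose l := k / 2%:R; have ek : k = 2%:R * l by rewrite /l mulrC divfK.
have el t : k * t / 2%:R = l * t by rewrite /l mulrAC.
rewrite el in kx.
have [l0 l1 l2] : [/\ l != 0, l - 1 != 0 & 2%:R * l - 1 != 0].
  split; first by rewrite /l mulf_neq0 ?invr_eq0.
    rewrite subr_eq0; apply: contraNneq k2 => h; rewrite ek h mulr1; exact: eqxx.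
  by rewrite -ek subr_eq0.
clearbody l; subst k.
have vol0 : X0vol l x y z != 0 by rewrite oppr_eq0 !mulf_neq0.
have [] := @gram_realised K (l * x) (l * y) (l * z) (X0gram l y z) (X0gram l x z)
  (X0gram l x y) (X0vol l x y z).
- by move/eqP: e; rewrite X0_gram mulf_eq0 (negbTE n4) subr_eq0 => /eqP.
- exact: kx.
- by move: Q0; rewrite X0_minor oppr_eq0 mulf_eq0 (negbTE n4).
move=> a [b [c [[aa bb cc] [bc ac ab abc]]]].
exists (qmx (l * x) a), (qmx (l * y) b), (qmx (l * z) c); split; last first.
  by rewrite trseq_qmx bc ac ab abc X0_tpt.
have [v1 v2] := X0volC l y z x; have [v3 v4] := X0volC l x y z.
have bca : dot (cross b c) a = X0vol l y z x by rewrite dot_cross_rot abc.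
have cab : dot (cross c a) b = X0vol l z x y by rewrite 2!dot_cross_rot abc -v2.
have cb : dot c b = X0gram l z y by rewrite dotC bc X0gramC.
have ca : dot c a = X0gram l z x by rewrite dotC ac X0gramC.
have ba : dot b a = X0gram l y x by rewrite dotC ab X0gramC.
have det1 (t : K) : t ^+ 2 + (1 - t ^+ 2) = 1 by ring.
split; split; rewrite ?qmx_det ?aa ?bb ?cc ?det1 //.
- by apply: relator_of_dots; rewrite ?abc ?bb ?cc ?bc ?ac ?ab // (X0_relator, X0_relator').
- by apply: relator_of_dots; rewrite ?bca ?cc ?aa ?ca ?ba ?bc -?v4 // ?v4 (X0_relator, X0_relator').
- by apply: relator_of_dots; rewrite ?cab ?aa ?bb ?ab ?cb ?ca -?v2 -?v4 // ?v4 ?v2 (X0_relator, X0_relator').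
Qed.


End GenericPoints.

(** * Primality of I_0 *)

Section QuadraticExtension.
Variables (S : idomainType) (P Q : S).
Hypothesis anisotropic : forall u v, P * u ^+ 2 + Q * v ^+ 2 = 0 -> u = 0 /\ v = 0.
Local Notation F := (P%:P * 'X^2 + Q%:P : {poly S}).
Implicit Types f g H : {poly S}.

Lemma lead_neq0 : P != 0.
Proof.
apply/eqP => P0; have [] := @anisotropic 1 0; first by rewrite P0 expr0n mul0r mulr0 addr0.
by move/eqP; rewrite oner_eq0.
Qed.

Lemma quadratic_remainder f : exists N H u v,
  (P ^+ N)%:P * f = H * F + u%:P + v%:P * 'X.
Proof.
elim/poly_ind: f => [|f c [N [H [u [v e]]]]].
  by exists 0, 0, 0, 0; rewrite mulr0 mul0r !polyC0 mul0r !addr0.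
exists N.+1, (P%:P * H * 'X + v%:P), (P ^+ N.+1 * c - v * Q), (P * u).
rewrite exprS polyCM mulrDr [P%:P * _ * (f * 'X)](_ : _ = P%:P * ((P ^+ N)%:P * f) * 'X); last by ring.
by rewrite e !(polyCM, polyCD, polyCN); ring.
Qed.

Lemma quadratic_dvd H a b : H * F = a%:P + b%:P * 'X -> a = 0 /\ b = 0.
Proof.
set r := a%:P + b%:P * 'X; move=> e; have size_r : (size r <= 2)%N.
  by apply/leq_sizeP => -[|[|j]] // _; rewrite /r coefD coefC coefMX coefC /= addr0.
have size_F : size F = 3.
  have hP : size (P%:P * 'X^2 : {poly S}) = 3 by rewrite size_mulXn ?polyC_eq0 ?lead_neq0 // size_polyC lead_neq0.
  by rewrite size_polyDl hP // (leq_ltn_trans (size_polyC_leq1 _)).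
have H0 : H = 0.
  apply/eqP; apply: contraTT size_r => H0; rewrite -e -ltnNge size_proper_mul.
    by rewrite size_F; have := size_poly_gt0 H; rewrite H0; case: (size H) => // n _; rewrite addSn /= addn3.
  by rewrite mulf_neq0 ?lead_coef_eq0 // -size_poly_eq0 size_F.
move: e; rewrite H0 mul0r /r => /esym e.
split; [have := congr1 (fun p : {poly S} => p`_0) e | have := congr1 (fun p : {poly S} => p`_1) e];
  by rewrite coefD coefC coefMX coef0 /= ?addr0 ?add0r ?coefC.
Qed.

(** Up to powers of P both factors have linear remainders u + v X modulo F, whose norm is P u^2 + Q
    v^2 up to the factor P. Brahmagupta's identity makes the product of the norms zero, and
    anisotropy kills one remainder. *)
Lemma quadratic_prime f g H : f * g = H * F ->
  (exists N H', (P ^+ N)%:P * f = H' * F) \/ (exists N H', (P ^+ N)%:P * g = H' * F).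
Proof.
have [N1 [H1 [u1 [v1 e1]]]] := quadratic_remainder f.
have [N2 [H2 [u2 [v2 e2]]]] := quadratic_remainder g => e.
have [a0 b0] : P * (u1 * u2) - Q * (v1 * v2) = 0 /\ P * (u1 * v2 + u2 * v1) = 0.
  move: (P ^+ N1)%:P (P ^+ N2)%:P e1 e2 => n1 n2 e1 e2.
  pose A := P%:P * (H1 * (H2 * F + (u2%:P + v2%:P * 'X)) + H2 * (u1%:P + v1%:P * 'X)) + (v1 * v2)%:P.
  apply: (@quadratic_dvd (P%:P * n1 * n2 * H - A)).
  transitivity (P%:P * n1 * n2 * (H * F) - A * F); first by ring.
  rewrite -e; transitivity (P%:P * ((n1 * f) * (n2 * g)) - A * F); first by ring.
  by rewrite e1 e2 /A !(polyCM, polyCD, polyCN); ring.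
have {}b0 : u1 * v2 + u2 * v1 = 0 by apply/(mulfI lead_neq0); rewrite b0 mulr0.
have : (P * u1 ^+ 2 + Q * v1 ^+ 2) * (P * u2 ^+ 2 + Q * v2 ^+ 2) = 0.
  transitivity ((P * (u1 * u2) - Q * (v1 * v2)) ^+ 2 + P * Q * (u1 * v2 + u2 * v1) ^+ 2).
    by ring.
  by rewrite a0 b0 expr0n mulr0 addr0.
move/eqP; rewrite mulf_eq0 => /orP[] /eqP /anisotropic [u0 v0]; [left|right].
- by exists N1, H1; rewrite e1 u0 v0 polyC0 mul0r !addr0.
- by exists N2, H2; rewrite e2 u0 v0 polyC0 mul0r !addr0.
Qed.

End QuadraticExtension.

Section X0Form.
Variable K : fieldType.
Local Notation S1 := {poly K}.
Local Notation S2 := {poly S1}.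
Local Notation S3 := {poly S2}.
Local Notation S4 := {poly S3}.
(** The variables are nested as K[x][k][y], with z on top, so that leading coefficients in y are
    polynomials in k over a domain. *)
Definition pk : S3 := 'X%:P.
Definition px : S3 := 'X%:P%:P.
Definition py : S3 := 'X.

Lemma size_sqr (S : idomainType) (a : {poly S}) : a != 0 -> size (a ^+ 2) = (size a).*2.-1.
Proof. by move=> a0; rewrite expr2 size_mul // addnn. Qed.

Lemma parity_form (S : idomainType) (a b : {poly S}) : (1 - 'X) * a ^+ 2 + b ^+ 2 = 0 -> a = 0.
Proof.
move=> e; apply/eqP; apply/negPn/negP => a0; have := a0; rewrite -size_poly_gt0 => sa.
have {}e : b ^+ 2 = ('X - 1%:P) * a ^+ 2.
  by apply/eqP; rewrite -subr_eq0 -e polyC1; apply/eqP; ring.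
have b0 : b != 0 by rewrite -sqrf_eq0 e mulf_neq0 ?polyXsubC_eq0 // expf_neq0.
have := b0; rewrite -size_poly_gt0 => sb.
have := congr1 (size \o val) e; rewrite /= size_sqr // size_monicM ?monicXsubC ?expf_neq0 //.
by rewrite size_XsubC size_sqr //; lia.
Qed.

Lemma lead_quadratic (S : idomainType) (a b : S) : a != 0 ->
  lead_coef (a%:P * 'X^2 + b%:P) = a.
Proof.
move=> a0; have hP : size (a%:P * 'X^2 : {poly S}) = 3.
  by rewrite size_mulXn ?polyC_eq0 // size_polyC a0.
by rewrite lead_coefDl ?hP ?(leq_ltn_trans (size_polyC_leq1 _)) // lead_coef_Mmonic ?monicXn ?lead_coefC.
Qed.

Lemma quadratic_anisotropic (S : idomainType) (c p q : {poly S}) (u v : {poly {poly S}}) :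
  c != 0 -> ((c * (1 - 'X))%:P * 'X^2 + p%:P) * u ^+ 2 + (c%:P * 'X^2 + q%:P) * v ^+ 2 = 0 ->
  u = 0 /\ v = 0.
Proof.
move=> c0 e; have cX : c * (1 - 'X) != 0.
  by rewrite mulf_neq0 // -opprB oppr_eq0 -polyC1 polyXsubC_eq0.
have lP := lead_quadratic p cX; have lQ := lead_quadratic q c0.
have e' := congr1 lead_coef (canRL (addrK _) e); rewrite sub0r in e'.
rewrite lead_coefN !lead_coefM -!expr2 lP lQ in e'.
have u0 : u = 0.
  apply/eqP; rewrite -lead_coef_eq0; apply/eqP; apply: (@parity_form S _ (lead_coef v)).
  by apply: (mulfI c0); rewrite mulr0 mulrDr mulrA e' addNr.
split=> //; move/eqP: e; rewrite u0 expr0n mulr0 add0r mulf_eq0 sqrf_eq0 -lead_coef_eq0 lQ.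
by rewrite (negbTE c0) => /eqP.
Qed.

(** In y the leading coefficients of P and Q are c (1 - k) and c with the same c. Comparing leading
    terms therefore leaves (1 - k) a^2 + b^2 = 0, which is impossible for a nonzero. *)
Lemma X0_anisotropic (u v : S3) :
  X0P pk px py * u ^+ 2 + X0Q pk px py * v ^+ 2 = 0 -> u = 0 /\ v = 0.
Proof.
pose k : S2 := 'X; pose x : S2 := 'X%:P; pose c : S2 := k ^+ 2 * (1 + (1 - k) * x ^+ 2).
have c0 : c != 0.
  rewrite mulf_neq0 ?expf_neq0 ?polyX_eq0 //; apply/eqP => /(congr1 (horner_eval 1)).
  rewrite /horner_eval /k !(hornerD, hornerM, hornerN, hornerX, hornerC) subrr mul0r addr0.
  by move/eqP; rewrite oner_eq0.
have -> : X0P pk px py = (c * (1 - 'X))%:P * 'X^2 + c%:P.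
  by rewrite /X0P /c /pk /px /py /k /x !(polyCM, polyCD, polyCN); ring.
have -> : X0Q pk px py = c%:P * 'X^2 + (k ^+ 2 * x ^+ 2 - 4%:R)%:P.
  by rewrite /X0Q /c /pk /px /py /k /x !(polyCM, polyCD, polyCN); ring.
exact: quadratic_anisotropic.
Qed.

End X0Form.

Section X0Morphisms.
Variables (T U : comNzRingType) (phi : {rmorphism T -> U}).
Let rmE := (rmorphD phi, rmorphN phi, rmorphM phi, rmorphXn phi, rmorph1 phi,
            fun n => rmorph_nat phi n).

Lemma rmorph_X0generic x y z : phi (X0generic x y z) = X0generic (phi x) (phi y) (phi z).
Proof. by rewrite /X0generic /at_two_x !rmE. Qed.

Lemma rmorph_X0P k x y : phi (X0P k x y) = X0P (phi k) (phi x) (phi y).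
Proof. by rewrite /X0P !rmE. Qed.

Lemma rmorph_X0Q k x y : phi (X0Q k x y) = X0Q (phi k) (phi x) (phi y).
Proof. by rewrite /X0Q !rmE. Qed.

Lemma map_toric4 k x y z : map phi (toric4 k x y z) = toric4 (phi k) (phi x) (phi y) (phi z).
Proof. by rewrite /toric4 /= !rmE. Qed.

End X0Morphisms.

Lemma mem_head_zeros (T : comNzRingType) (a h : T) : h \in [:: a; 0; 0; 0; 0; 0] -> h = a \/ h = 0.
Proof. by rewrite !inE !orbb => /orP[] /eqP; [left | right]. Qed.

Section I0Prime.
Variable K : numClosedFieldType.
Local Notation P7K := {mpoly K[7]}.
Local Notation t i := ('X_(inord i) : P7K).
Local Notation S1 := {poly K}.
Local Notation S2 := {poly S1}.
Local Notation S3 := {poly S2}.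
Local Notation S4 := {poly S3}.

Definition I0K : seq P7K := I0g (t 0) (t 1) (t 2) (t 3) (t 4) (t 5) (t 6).

Lemma evs_I0K (U : comNzRingType) (f : {rmorphism K -> U}) s :
  map (evs f 7 s) I0K = app7 (@I0g U) s.
Proof. by rewrite /I0K map_I0g !evsX. Qed.

Lemma X0_curve_gen x y z : curve x y z I0K`_0 = X0poly x y z.
Proof.
have := evs_I0K (@polyC K) (toric4 'X x%:P y%:P z%:P); rewrite I0g_toric.
by move/(congr1 (fun s => s`_0)).
Qed.

Lemma X0genP : exists2 d : {mpoly K[4]}, d != 0 &
  forall v, d.@[v] = X0generic (v (inord 1)) (v (inord 2)) (v (inord 3)).
Proof.
pose d : {mpoly K[4]} := X0generic 'X_(inord 1) 'X_(inord 2) 'X_(inord 3).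
have dE v : d.@[v] = X0generic (v (inord 1)) (v (inord 2)) (v (inord 3)).
  by apply: etrans (rmorph_X0generic (meval v) _ _ _) _; congr X0generic; exact: mevalXU.
exists d => //; apply/eqP => d0; have := dE (fun _ => 2%:R); rewrite d0 meval0.
(* The numbers are the values of the factors at (2, 2, 2); only the last factor, -720, is
   negative. *)
have -> : X0generic 2%:R 2%:R 2%:R = (8 * 3 * 3 * 8 * 27 * 16 * 720)%N%:R * -1 :> K.
  by rewrite /X0generic /at_two_x !natrM; ring.
by move/esym/eqP; rewrite mulrN1 oppr_eq0 pnatr_eq0.
Qed.

Lemma X0_in_ideal f : (forall x y z, X0generic x y z != 0 -> X0poly x y z %| curve x y z f) ->
  in_ideal I0K f.
Proof.
move=> hf; have [d d0 dE] := X0genP.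
apply: (@X0_criterion K I0K I0K`_0 _ _ _ _ _ _ X0_curve_gen d) => //.
- by apply: in_ideal_gen; rewrite mem_nth.
- by apply: in_ideal_gen; rewrite (mem_nth 0 (_ : 1 < size I0K)%N).
- by apply: in_ideal_gen; rewrite (mem_nth 0 (_ : 2 < size I0K)%N).
- by apply: in_ideal_gen; rewrite (mem_nth 0 (_ : 3 < size I0K)%N).
- by apply: in_ideal_gen; rewrite (mem_nth 0 (_ : 4 < size I0K)%N).
- by apply: in_ideal_gen; rewrite (mem_nth 0 (_ : 5 < size I0K)%N).
- by move=> v; rewrite dE => /hf.
Qed.

Lemma horner_evalC (T : comNzRingType) (c p : T) : horner_eval c p%:P = p.
Proof. exact: hornerC. Qed.

Lemma horner_evalX (T : comNzRingType) (c : T) : horner_eval c 'X = c.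
Proof. exact: hornerX. Qed.

Definition X0univ : {rmorphism P7K -> S4} :=
  evs (@polyC S3 \o (@polyC S2 \o (@polyC S1 \o @polyC K))) 7
    (toric4 (pk K)%:P (px K)%:P (py K)%:P 'X).

Definition X0ev (x y z : K) : {rmorphism S4 -> S1} :=
  map_poly (horner_eval x) \o (horner_eval y%:P%:P \o horner_eval z%:P%:P%:P).

Definition X0ev3 (x y : K) : {rmorphism S3 -> S1} :=
  map_poly (horner_eval x) \o horner_eval y%:P%:P.

Lemma X0evC x y z p : X0ev x y z p%:P = X0ev3 x y p.
Proof. by rewrite /= horner_evalC. Qed.

Lemma X0ev3_var x y : [/\ X0ev3 x y (pk K) = 'X, X0ev3 x y (px K) = x%:P & X0ev3 x y (py K) = y%:P].
Proof.
split; rewrite /= /pk /px /py ?horner_evalC ?horner_evalX.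
- by rewrite map_polyX.
- by rewrite map_polyC /= horner_evalX.
- by rewrite map_polyC /= horner_evalC.
Qed.

Lemma X0ev_univ x y z f : X0ev x y z (X0univ f) = curve x y z f.
Proof.
rewrite (evs_comp _ (X0ev x y z)) /curve map_toric4 !X0evC.
have [-> -> ->] := X0ev3_var x y.
have -> : X0ev x y z 'X = z%:P.
  by rewrite /= horner_evalX horner_evalC map_polyC /= horner_evalC.
by apply: evs_eq => c; rewrite /= !horner_evalC map_polyC /= horner_evalC.
Qed.

Local Notation F4 := ((X0P (pk K) (px K) (py K))%:P * 'X^2 + (X0Q (pk K) (px K) (py K))%:P : S4).

Lemma X0ev_form x y z : X0ev x y z F4 = X0poly x y z.
Proof.
have [ek ex ey] := X0ev3_var x y.
rewrite rmorphD rmorphM rmorphXn !X0evC (rmorph_X0P (X0ev3 x y)) (rmorph_X0Q (X0ev3 x y)) ek ex ey.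
have -> : X0ev x y z 'X = z%:P.
  by rewrite /= horner_evalX horner_evalC map_polyC /= horner_evalC.
by rewrite -X0eqE.
Qed.

Lemma X0univ_ideal f : in_ideal I0K f -> exists H, X0univ f = H * F4.
Proof.
move: f; apply: in_ideal_ind => [|f g [H eH] [H' eH']|c g].
- by exists 0; rewrite rmorph0 mul0r.
- by exists (H + H'); rewrite rmorphD eH eH' mulrDl.
- move=> /(map_f X0univ); rewrite evs_I0K I0g_toric X0eqE => hg.
  have [H eH] : exists H, X0univ g = H * F4.
    have [->|->] := mem_head_zeros hg; last by exists 0; rewrite mul0r.
    by exists 1; rewrite mul1r -(rmorph_X0P (@polyC S3)) -(rmorph_X0Q (@polyC S3)).
  by exists (X0univ c * H); rewrite rmorphM eH mulrA.
Qed.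

Lemma I0K_prime : prime_ideal I0K.
Proof.
split=> [one|f g].
  have [e|/eqP] := boolP (1 == 0 :> K); first by rewrite oner_eq0 in e.
  (* The point k = 1, (x, y, z) = (2, 0, 0) satisfies F = 0, hence I_0 is proper. *)
  apply; rewrite -(rmorph1 (evs (@idfun K) 7 (toric4 1 2%:R 0 0))).
  apply: in_ideal_ker one => g /(map_f (evs (@idfun K) 7 (toric4 1 2%:R 0 0))).
  rewrite evs_I0K I0g_toric (_ : X0eq _ _ _ _ = 0); last by rewrite /X0eq; ring.
  by rewrite !inE !orbb => /eqP.
move=> /X0univ_ideal[H]; rewrite rmorphM.
have fin h : (exists N H', ((X0P (pk K) (px K) (py K)) ^+ N)%:P * X0univ h = H' * F4) ->
    in_ideal I0K h.
  move=> [N [H' e]]; apply: X0_in_ideal => x y z gen.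
  have := congr1 (X0ev x y z) e.
  rewrite 2!rmorphM X0evC rmorphXn X0ev_form X0ev_univ (rmorph_X0P (X0ev3 x y)) => e'.
  have [ek ex ey] := X0ev3_var x y; rewrite ek ex ey in e'.
  have co : coprimep (X0poly x y z) (X0P 'X x%:P y%:P ^+ N).
    apply: coprimep_expr; apply/Pdiv.ClosedField.coprimepP => k /rootP hk.
    have ev t : (t%:P : {poly K}).[k] = t by rewrite hornerC.
    rewrite -[X in X != 0]/(horner_eval k _) rmorph_X0P /= /horner_eval hornerX !ev.
    apply: X0P_coprime gen _; rewrite -hk; rewrite X0eqE /X0poly X0eqE.
    rewrite -[in RHS]/(horner_eval k _) rmorphD rmorphM rmorphXn rmorph_X0P rmorph_X0Q /=.
    by rewrite /horner_eval hornerX !ev.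
  by rewrite -(Gauss_dvdpr _ co) e' dvdp_mull.
by move=> /(quadratic_prime (@X0_anisotropic K)) [] /fin; [left | right].
Qed.

End I0Prime.

Lemma size_X0poly (K : numFieldType) (x y z : K) : (size (X0poly x y z) <= 5)%N.
Proof.
pose a := (x * y * z) ^+ 2; pose b := (x * y) ^+ 2 + (x * z) ^+ 2 + (y * z) ^+ 2.
pose c := x ^+ 2 + y ^+ 2 + z ^+ 2.
have -> : X0poly x y z = Poly [:: - 4%:R; 0; a + b + c; - (2%:R * a + b); a].
  by rewrite /X0poly /X0eq /a /b /c /= !cons_poly_def mul0r add0r; ring.
exact: size_Poly.
Qed.

Lemma X0poly_neq0 (K : numFieldType) (x y z : K) : X0poly x y z != 0.
Proof.
apply/eqP => e; have := X0poly_at0 x y z; rewrite e horner0 => /eqP.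
by rewrite eq_sym oppr_eq0 pnatr_eq0.
Qed.

Lemma X0poly_root (K : numFieldType) (x y z k : K) : root (X0poly x y z) k = (X0eq k x y z == 0).
Proof.
rewrite /root; congr (_ == 0).
rewrite /X0poly !X0eqE -[LHS]/(horner_eval k _) rmorphD rmorphM rmorphXn rmorph_X0P rmorph_X0Q.
by rewrite /= /horner_eval hornerX !hornerC.
Qed.

Lemma in_ideal_prime_exp (T : comNzRingType) (gs : seq T) f n : prime_ideal gs ->
  in_ideal gs (f ^+ n) -> in_ideal gs f.
Proof.
move=> [h1 hp]; elim: n => [/h1 //|n IH]; rewrite exprS => /hp[] //.
Qed.

Lemma I0_forward (R : realType) (f : P7 R) : in_ideal (Jbor R) (tau f) -> in_ideal (I0 R) f.
Proof.
move=> hf; apply: (in_ideal_prime_exp (n := 4) (I0K_prime _)).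
apply: X0_in_ideal => x y z gen; rewrite rmorphXn.
apply: dvdp_expr_roots; [exact: X0poly_neq0 | exact: size_X0poly |] => k.
rewrite X0poly_root => /eqP hk; apply/rootP; rewrite curve_eval.
have [A [B [C [rep tr]]]] := X0_realised gen hk.
by have := tau_of_rep rep hf; rewrite tr.
Qed.

Lemma I0_prime (R : realType) : prime_ideal (I0 R).
Proof. exact: I0K_prime. Qed.

(** * The components X_a, X_b and X_c *)

Lemma rmorph_nth (T U : comNzRingType) (phi : {rmorphism T -> U}) s i :
  (map phi s)`_i = phi s`_i.
Proof.
case: (ltnP i (size s)) => h; first by rewrite (nth_map 0).
by rewrite !nth_default ?size_map // rmorph0.
Qed.

Section AffineComponent.
Variables (K : idomainType) (gs : seq {mpoly K[7]}) (lq : seq {mpoly K[3]})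
  (sec : seq {mpoly K[7]}).
Local Notation phi := (evs (@mpolyC 3 K) 7 lq).
Local Notation sigma := (evs (@mpolyC 7 K) 3 sec).
Hypotheses (phi_sec : map phi sec = [:: 'X_(inord 0); 'X_(inord 1); 'X_(inord 2)])
  (sec_lq : forall i : 'I_7, in_ideal gs ('X_i - (map sigma lq)`_i))
  (phi_gs : forall h, h \in map phi gs -> h = 0).

Lemma affine_section h : phi (sigma h) = h.
Proof.
apply: (mpoly_rmorph_eq (phi := phi \o sigma) (psi := idfun)) => [c|i] /=; first by rewrite !evsC.
have size_sec : size sec = 3 by rewrite -(size_map phi) phi_sec.
rewrite evsXi -(nth_map 0 0) ?size_sec ?ltn_ord // phi_sec.
by case: i => -[|[|[|//]]] hi /=; congr ('X__); apply: val_inj; rewrite /= inordK.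
Qed.

(** The composite of [phi] and [sigma] is congruent to the identity on the variables modulo [gs],
    hence on all polynomials. *)
Lemma affine_kernel f : phi f = 0 <-> in_ideal gs f.
Proof.
split=> [f0|]; last exact: in_ideal_map0.
have := @mpoly_rmorph_cong _ _ _ gs (@idfun {mpoly K[7]}) (sigma \o phi) _ _ f.
rewrite /= f0 rmorph0 subr0; apply=> [c|i]; first by rewrite !evsC.
by rewrite evsXi -rmorph_nth.
Qed.

Lemma affine_prime : prime_ideal gs.
Proof.
split=> [/affine_kernel|f g /affine_kernel]; first by rewrite rmorph1 => /eqP; rewrite oner_eq0.
by rewrite rmorphM => /eqP; rewrite mulf_eq0 => /orP[] /eqP /affine_kernel; [left | right].
Qed.

End AffineComponent.

Section AffineComponents.
Variable T : comNzRingType.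
Implicit Types s x y z : T.

(** The traces of (s, B, C) with s central, in terms of x = tr B, y = tr C, z = tr BC; the other two
    lists put s in the second and third place. *)
Definition lqa s x y z := [:: 2%:R * s; x; y; s * x; s * y; z; s * z].
Definition lqb s x y z := [:: x; 2%:R * s; y; s * x; z; s * y; s * z].
Definition lqc s x y z := [:: x; y; 2%:R * s; z; s * x; s * y; s * z].

Lemma Iag_lq s x y z h :
  [/\ h \in app7 (Iag s) (lqa s x y z) -> h = 0,
      h \in app7 (fun a b c ab ac bc => Iag s b a c ab bc ac) (lqb s x y z) -> h = 0
    & h \in app7 (fun a b c ab ac bc => Iag s c a b ac bc ab) (lqc s x y z) -> h = 0].
Proof. by rewrite /app7 /Iag /= !inE; split=> /or4P[] /eqP ->; ring. Qed.

Lemma lq_Iag s (r : seq T) i : (i < 7)%N ->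
  [/\ in_ideal (app7 (Iag s) r) (r`_i - (lqa s r`_1 r`_2 r`_5)`_i),
      in_ideal (app7 (fun a b c ab ac bc => Iag s b a c ab bc ac) r)
        (r`_i - (lqb s r`_0 r`_2 r`_4)`_i)
    & in_ideal (app7 (fun a b c ab ac bc => Iag s c a b ac bc ab) r)
        (r`_i - (lqc s r`_0 r`_1 r`_3)`_i)].
Proof.
rewrite /app7 /Iag /lqa /lqb /lqc.
move: i => [|[|[|[|[|[|[|i]]]]]]] //= _.
all: split; rewrite ?subrr; try exact: in_ideal0.
all: apply: in_ideal_gen; rewrite !inE ?[2%:R * s]mulrC eqxx ?orbT //.
Qed.

End AffineComponents.

Section CentralRepresentations.
Variable K : numClosedFieldType.
Implicit Types (s x y z : K) (A B C : 'M[K]_2).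

(** B is a companion matrix, C is upper triangular with a chosen eigenvalue l, and its corner entry
    is adjusted to give the trace of BC. *)
Lemma free_pair x y z : exists B C : 'M[K]_2,
  [/\ \det B = 1, \det C = 1, \tr B = x, \tr C = y & \tr (B *m C) = z].
Proof.
have [l el] : exists l : K, l ^+ 2 = y * l - 1.
  have [l el] := @solve_monicpoly K 2 (fun i => if i == 0 then -1 else y) isT.
  by exists l; rewrite el !big_ord_recl big_ord0 /=; ring.
have l0 : l != 0.
  by apply: contra_eqN el => /eqP ->; rewrite expr0n mulr0 sub0r eq_sym oppr_eq0 oner_eq0.
exists (mx2 0 (-1) 1 x), (mx2 l (z - x / l) 0 l^-1); split; rewrite ?mx2E; try by field.
have -> : y = (l ^+ 2 + 1) / l by rewrite el subrK mulfK.
by field.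
Qed.

Lemma minv_scalar s : minv (s%:M : 'M[K]_2) = s%:M.
Proof.
rewrite (mx2_eta s%:M) !mxE /= mx2_adj oppr0.
by apply/matrixP => -[[|[|//]] ?] [[|[|//]] ?]; rewrite !mxE.
Qed.

Lemma bor_rep_central s B C : s ^+ 2 = 1 -> \det B = 1 -> \det C = 1 ->
  [/\ bor_rep s%:M B C, bor_rep B s%:M C & bor_rep B C s%:M].
Proof.
move=> es dB dC; have ds : \det (s%:M : 'M[K]_2) = 1 by rewrite det_scalar.
have c1 X : \det X = 1 -> innerX X s%:M = 1%:M.
  move=> dX; rewrite /innerX minv_scalar !mul_mx_scalar -scalemxAl mulm_minv dX scalerA.
  by rewrite -expr2 es scale1r.
have c2 X : \det X = 1 -> innerX s%:M X = 1%:M.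
  move=> dX; rewrite /innerX minv_scalar mul_scalar_mx mul_mx_scalar scalerA -expr2 es scale1r.
  by rewrite minvM dX.
have comm1 X : s%:M *m X = X *m s%:M by rewrite mul_scalar_mx mul_mx_scalar.
by split; (split; first by []); split; rewrite ?c1 ?c2 ?mulmx1 ?mul1mx.
Qed.

Lemma trseq_central s B C (x := \tr B) (y := \tr C) (z := \tr (B *m C)) :
  [/\ trseq s%:M B C = lqa s x y z, trseq B s%:M C = lqb s x y z & trseq B C s%:M = lqc s x y z].
Proof.
have e2 : \tr (s%:M : 'M[K]_2) = 2%:R * s by rewrite mxtrace_scalar mulr_natl.
by split; rewrite /trseq ?(mul_scalar_mx, mul_mx_scalar) -?scalemxAl ?mxtraceZ e2.
Qed.

End CentralRepresentations.

Section RotatedComponents.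
Variable R : realType.
Local Notation K := (CC R).
Definition sg (T : comNzRingType) (b : bool) : T := if b then 1 else -1.

Lemma rmorph_sg (T U : comNzRingType) (phi : {rmorphism T -> U}) b : phi (sg T b) = sg U b.
Proof. by rewrite /sg; case: b; rewrite ?rmorphN1 ?rmorph1. Qed.

Section MapLq.
Variables (T U : comNzRingType) (phi : {rmorphism T -> U}) (b : bool) (x y z : T).

Lemma map_lq :
  [/\ map phi (lqa (sg T b) x y z) = lqa (sg U b) (phi x) (phi y) (phi z),
      map phi (lqb (sg T b) x y z) = lqb (sg U b) (phi x) (phi y) (phi z)
    & map phi (lqc (sg T b) x y z) = lqc (sg U b) (phi x) (phi y) (phi z)].
Proof. by rewrite /lqa /lqb /lqc /= !rmorphM rmorph_nat rmorph_sg. Qed.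

End MapLq.

Local Notation y i := ('X_(inord i) : P3 R).
Local Notation tseq := [:: ta R; tb R; tc R; tab R; tac R; tbc R; tabc R].

Lemma tseq_nth (i : 'I_7) : 'X_i = tseq`_i.
Proof.
by case: i => -[|[|[|[|[|[|[|//]]]]]]] hi; congr ('X__); apply: val_inj; rewrite /= inordK.
Qed.

Lemma IaE b : Ia R b = app7 (Iag (sg (P7 R) b)) tseq.
Proof. by []. Qed.

Lemma IbE b : Ib R b = app7 (fun a b' c ab ac bc => Iag (sg (P7 R) b) b' a c ab bc ac) tseq.
Proof. by []. Qed.

Lemma IcE b : Ic R b = app7 (fun a b' c ab ac bc => Iag (sg (P7 R) b) c a b' ac bc ab) tseq.
Proof. by []. Qed.

Definition affine_data (I : seq (P7 R)) (lq : seq (P3 R)) (sec : seq (P7 R)) :=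
  [/\ map (evs (@mpolyC 3 K) 7 lq) sec = [:: y 0; y 1; y 2],
      forall i : 'I_7, in_ideal I ('X_i - (map (evs (@mpolyC 7 K) 3 sec) lq)`_i)
    & forall h, h \in map (evs (@mpolyC 3 K) 7 lq) I -> h = 0].

Lemma Ia_data b : affine_data (Ia R b) (lqa (sg _ b) (y 0) (y 1) (y 2)) [:: tb R; tc R; tbc R].
Proof.
split=> [|i|h]; first by rewrite /= !evs_t.
  have [-> _ _] := map_lq (evs (@mpolyC 7 K) 3 [:: tb R; tc R; tbc R]) b (y 0) (y 1) (y 2).
  rewrite !evsX // tseq_nth.
  by rewrite IaE; have [h _ _] := lq_Iag (sg (P7 R) b) tseq (ltn_ord i); exact: h.
have [h' _ _] := Iag_lq (sg (P3 R) b) (y 0) (y 1) (y 2) h; rewrite evs_Ia; exact: h'.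
Qed.

Lemma Ib_data b : affine_data (Ib R b) (lqb (sg _ b) (y 0) (y 1) (y 2)) [:: ta R; tc R; tac R].
Proof.
split=> [|i|h]; first by rewrite /= !evs_t.
  have [_ -> _] := map_lq (evs (@mpolyC 7 K) 3 [:: ta R; tc R; tac R]) b (y 0) (y 1) (y 2).
  rewrite !evsX // tseq_nth.
  by rewrite IbE; have [_ h _] := lq_Iag (sg (P7 R) b) tseq (ltn_ord i); exact: h.
have [_ h' _] := Iag_lq (sg (P3 R) b) (y 0) (y 1) (y 2) h; rewrite evs_Ib; exact: h'.
Qed.

Lemma Ic_data b : affine_data (Ic R b) (lqc (sg _ b) (y 0) (y 1) (y 2)) [:: ta R; tb R; tab R].
Proof.
split=> [|i|h]; first by rewrite /= !evs_t.
  have [_ _ ->] := map_lq (evs (@mpolyC 7 K) 3 [:: ta R; tb R; tab R]) b (y 0) (y 1) (y 2).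
  rewrite !evsX // tseq_nth.
  by rewrite IcE; have [_ _ h] := lq_Iag (sg (P7 R) b) tseq (ltn_ord i); exact: h.
have [_ _ h'] := Iag_lq (sg (P3 R) b) (y 0) (y 1) (y 2) h; rewrite evs_Ic; exact: h'.
Qed.

Lemma affine_forward I lq sec f : affine_data I lq sec ->
  (forall v : 'I_3 -> K, exists A B C, bor_rep A B C /\ trseq A B C = map (meval v) lq) ->
  in_ideal (Jbor R) (tau f) -> in_ideal I f.
Proof.
case=> [h1 h2 h3] reps hf; apply/(affine_kernel h2 h3); apply: mpoly_eq0_eval => v.
have [A [B [C [rep tr]]]] := reps v; have := tau_of_rep rep hf; rewrite tr => <-.
rewrite (evs_comp (@mpolyC 3 K) (meval v)); apply: evs_eq => c /=; exact: mevalC.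
Qed.

Lemma affine_iso I lq sec : affine_data I lq sec -> exists lqt : 7.-tuple (P3 R),
  (forall h : P3 R, exists f : P7 R, f \mPo lqt = h) /\
  (forall f : P7 R, f \mPo lqt = 0 <-> in_ideal I f).
Proof.
case=> [h1 h2 h3]; pose lqt := [tuple lq`_i | i < 7].
have e f : f \mPo lqt = evs (@mpolyC 3 K) 7 lq f.
  apply: (mpoly_rmorph_eq (phi := comp_mpoly lqt)) => [c|i]; first by rewrite evsC [LHS]comp_mpolyC.
  by rewrite evsXi [LHS]comp_mpolyXU -tnth_nth tnth_mktuple.
exists lqt; split=> [h|f]; last by rewrite e; apply: (affine_kernel h2 h3).
by exists (evs (@mpolyC 7 K) 3 sec h); rewrite e (affine_section h1).
Qed.

Lemma sg_sqr (T : comNzRingType) b : sg T b ^+ 2 = 1.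
Proof. by case: b; rewrite /= ?sqrrN expr1n. Qed.

Lemma Iabc_forward b f : in_ideal (Jbor R) (tau f) ->
  [/\ in_ideal (Ia R b) f, in_ideal (Ib R b) f & in_ideal (Ic R b) f].
Proof.
move=> hf; split; [apply: affine_forward (Ia_data b) _ hf | apply: affine_forward (Ib_data b) _ hf
   | apply: affine_forward (Ic_data b) _ hf] => v;
have [B [C [dB dC tB tC tBC]]] := free_pair (v (inord 0)) (v (inord 1)) (v (inord 2));
have [r1 r2 r3] := bor_rep_central (sg_sqr _ b) dB dC;
have [e1 e2 e3] := trseq_central (sg K b) B C; rewrite tB tC tBC in e1 e2 e3;
have [m1 m2 m3] := map_lq (meval v) b (y 0) (y 1) (y 2); 
have ev i : (meval v : {rmorphism P3 R -> K}) (y i) = v (inord i) := mevalXU v _;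
rewrite !ev in m1 m2 m3.
- exists (sg K b)%:M, B, C; exact: (conj r1 (etrans e1 (esym m1))).
- exists B, (sg K b)%:M, C; exact: (conj r2 (etrans e2 (esym m2))).
- exists B, C, (sg K b)%:M; exact: (conj r3 (etrans e3 (esym m3))).
Qed.

End RotatedComponents.

(** * The component X_ns *)

Section DiagonalRelations.
Variable Q : comNzRingType.
Implicit Types h x y z u v w d : Q.

Lemma Ins_relations h x y z u v w d : 2%:R * h = 1 ->
  (forall g, g \in app7 (@Insg Q) (tpt x y z u v w d) -> g = 0) ->
  [/\ w ^+ 2 = (1 - x ^+ 2) * (1 - y ^+ 2), v ^+ 2 = (1 - x ^+ 2) * (1 - z ^+ 2)
    & u ^+ 2 = (1 - y ^+ 2) * (1 - z ^+ 2)] /\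
  [/\ v * w = u * (1 - x ^+ 2), w * u = v * (1 - y ^+ 2), u * v = w * (1 - z ^+ 2) & d = 0].
Proof.
move=> eh hg.
have half4 (t : Q) : 4%:R * t = 0 -> t = 0.
  move=> e; transitivity (h ^+ 2 * (4%:R * t)); last by rewrite e mulr0.
  by transitivity ((2%:R * h) ^+ 2 * t); [rewrite eh expr1n mul1r | ring].
have half8 (t : Q) : 8%:R * t = 0 -> t = 0.
  by move=> e; apply: (half4); apply: (half4); transitivity (2%:R * (8%:R * t)); [ring | rewrite e mulr0].
have get i : (i < 7)%N -> (app7 (@Insg Q) (tpt x y z u v w d))`_i = 0.
  by move=> hi; apply: hg; apply: mem_nth.
have := get 0 isT; have := get 1 isT; have := get 2 isT; have := get 3 isT; have := get 4 isT.
have := get 5 isT; have := get 6 isT; rewrite /app7 /Insg /pBg /= => g6 g5 g4 g3 g2 g1 g0.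
split; split; apply: subr0_eq.
- by apply: (half4); rewrite -[RHS]g0; ring.
- by apply: (half4); rewrite -[RHS]g1; ring.
- by apply: (half4); rewrite -[RHS]g2; ring.
- by apply: (half8); rewrite -[RHS]oppr0 -[in RHS]g3; ring.
- by apply: (half8); rewrite -[RHS]oppr0 -[in RHS]g4; ring.
- by apply: (half8); rewrite -[RHS]oppr0 -[in RHS]g5; ring.
- by apply: (half4); rewrite -[RHS]oppr0 -[in RHS]g6; ring.
Qed.

Lemma tpt_half h a b c ab ac bc abc (x := h * a) (y := h * b) (z := h * c)
    (w := x * y - h * ab) (v := x * z - h * ac) (u := y * z - h * bc) : 2%:R * h = 1 ->
  [:: a; b; c; ab; ac; bc; abc] =
  tpt x y z u v w (x * y * z - x * u - y * v - z * w - h * abc).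
Proof.
move=> eh; have dbl s : 2%:R * (h * s) = s by rewrite mulrA eh mul1r.
rewrite /tpt; congr [:: _; _; _; _; _; _; _]; rewrite ?dbl //.
- by rewrite /w subKr dbl.
- by rewrite /v subKr dbl.
- by rewrite /u subKr dbl.
- by rewrite subKr dbl.
Qed.

End DiagonalRelations.

Section DiagonalPoints.
Variable K : numClosedFieldType.
Implicit Types (x y z a b c : K) (f : {mpoly K[7]}).
Local Notation P7K := {mpoly K[7]}.
Local Notation P3K := {mpoly K[3]}.
Local Notation t i := ('X_(inord i) : P7K).

Definition InsK : seq P7K := Insg (t 0) (t 1) (t 2) (t 3) (t 4) (t 5) (t 6).

Lemma evs_InsK (U : comNzRingType) (f : {rmorphism K -> U}) s :
  map (evs f 7 s) InsK = app7 (@Insg U) s.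
Proof. by rewrite /InsK map_Insg !evsX. Qed.

Definition inv2 : K := 2%:R^-1.
Definition hX : P7K := inv2%:MP * t 0.
Definition hY : P7K := inv2%:MP * t 1.
Definition hZ : P7K := inv2%:MP * t 2.
Definition hW : P7K := hX * hY - inv2%:MP * t 3.
Definition hV : P7K := hX * hZ - inv2%:MP * t 4.
Definition hU : P7K := hY * hZ - inv2%:MP * t 5.

Lemma two_inv2 : 2%:R * inv2 = 1. Proof. by rewrite mulfV // pnatr_eq0. Qed.

Local Notation lift3 := (evs (@mpolyC 7 K) 3 [:: hX; hY; hZ]).

(** Modulo I_ns the elements 1, w, v, u span over the polynomials in the half traces: the rank one
    relations express all products of two of w, v, u. They multiply like 1, ab, ac, bc with a^2 = 1
    - x^2, b^2 = 1 - y^2, c^2 = 1 - z^2. *)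
Lemma Ins_normal_form f : exists f0 f1 f2 f3 : P3K,
  in_ideal InsK (f - (lift3 f0 + lift3 f1 * hW + lift3 f2 * hV + lift3 f3 * hU)).
Proof.
have [one|none] := EM (in_ideal InsK 1).
  by do 4!exists 0; rewrite -[_ - _]mulr1; apply: in_idealM.
have [Q [pr prP]] := quotient_ring none.
suff [f0 [f1 [f2 [f3 e]]]] : exists f0 f1 f2 f3 : P3K,
    pr f = pr (lift3 f0) + pr (lift3 f1) * pr hW + pr (lift3 f2) * pr hV + pr (lift3 f3) * pr hU.
  by exists f0, f1, f2, f3; apply/prP; rewrite rmorphB !rmorphD !rmorphM e subrr.
pose h := pr inv2%:MP.
have eh : 2%:R * h = 1.
  by rewrite -(rmorph_nat pr) -(rmorph_nat (@mpolyC 7 K)) -rmorphM -rmorphM two_inv2 !rmorph1.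
have [hX' hY' hZ'] : [/\ pr hX = h * pr (t 0), pr hY = h * pr (t 1) & pr hZ = h * pr (t 2)].
  by rewrite -!rmorphM.
have [hW' hV' hU'] : [/\ pr hW = pr hX * pr hY - h * pr (t 3),
    pr hV = pr hX * pr hZ - h * pr (t 4) & pr hU = pr hY * pr hZ - h * pr (t 5)].
  by rewrite -!rmorphM -!rmorphB.
have := @tpt_half Q h (pr (t 0)) (pr (t 1)) (pr (t 2)) (pr (t 3)) (pr (t 4)) (pr (t 5)) (pr (t 6)) eh.
rewrite -hX' -hY' -hZ' -hW' -hV' -hU'; move: (_ - h * pr (t 6)) => D tE.
have [] := @Ins_relations Q h (pr hX) (pr hY) (pr hZ) (pr hU) (pr hV) (pr hW) D eh.
  rewrite -tE => g gin.
  have : g \in map pr InsK by rewrite /InsK map_Insg.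
  by move=> /mapP[g' g'in ->]; apply/prP; apply: in_ideal_gen.
move=> [w2 v2 u2] [vw wu uv d0].
have lX : pr (lift3 'X_(inord 0)) = pr hX by rewrite evsX.
have lY : pr (lift3 'X_(inord 1)) = pr hY by rewrite evsX.
have lZ : pr (lift3 'X_(inord 2)) = pr hZ by rewrite evsX.
pose L : {rmorphism P3K -> Q} := pr \o lift3.
pose NF (q : Q) := exists f0 f1 f2 f3 : P3K, q = L f0 + L f1 * pr hW + L f2 * pr hV + L f3 * pr hU.
suff : NF (pr f) by [].
have NFD p q : NF p -> NF q -> NF (p + q).
  move=> [f0 [f1 [f2 [f3 ->]]]] [g0 [g1 [g2 [g3 ->]]]].
  exists (f0 + g0), (f1 + g1), (f2 + g2), (f3 + g3); rewrite !(rmorphD L).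
  move: (pr hW) (pr hV) (pr hU) (L f0) (L f1) (L f2) (L f3) (L g0) (L g1) (L g2) (L g3).
  by move=> *; ring.
have NFM p q : NF p -> NF q -> NF (p * q).
  move=> [f0 [f1 [f2 [f3 ->]]]] [g0 [g1 [g2 [g3 ->]]]].
  pose X : P3K := 'X_(inord 0); pose Y : P3K := 'X_(inord 1); pose Z : P3K := 'X_(inord 2).
  exists (f0 * g0 + f1 * g1 * ((1 - X ^+ 2) * (1 - Y ^+ 2)) + f2 * g2 * ((1 - X ^+ 2) * (1 - Z ^+ 2))
     + f3 * g3 * ((1 - Y ^+ 2) * (1 - Z ^+ 2))),
    (f0 * g1 + f1 * g0 + (f2 * g3 + f3 * g2) * (1 - Z ^+ 2)),
    (f0 * g2 + f2 * g0 + (f1 * g3 + f3 * g1) * (1 - Y ^+ 2)),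
    (f0 * g3 + f3 * g0 + (f1 * g2 + f2 * g1) * (1 - X ^+ 2)).
  have [eX eY eZ] : [/\ L X = pr hX, L Y = pr hY & L Z = pr hZ] by [].
  rewrite !(rmorphD L, rmorphN L, rmorphM L, rmorphXn L, rmorph1 L) eX eY eZ.
  move: (pr hW) (pr hV) (pr hU) (pr hX) (pr hY) (pr hZ) w2 v2 u2 vw wu uv => W V U X' Y' Z' w2 v2 u2 vw wu uv.
  move: (L f0) (L f1) (L f2) (L f3) (L g0) (L g1) (L g2) (L g3) => a0 a1 a2 a3 b0 b1 b2 b3.
  transitivity (a0 * b0 + a1 * b1 * W ^+ 2 + a2 * b2 * V ^+ 2 + a3 * b3 * U ^+ 2
    + (a0 * b1 + a1 * b0) * W + (a2 * b3 + a3 * b2) * (U * V)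
    + (a0 * b2 + a2 * b0) * V + (a1 * b3 + a3 * b1) * (W * U)
    + (a0 * b3 + a3 * b0) * U + (a1 * b2 + a2 * b1) * (V * W)); first by ring.
  by rewrite w2 v2 u2 vw wu uv; ring.
have NFL g : NF (L g) by exists g, 0, 0, 0; rewrite rmorph0 !mul0r !addr0.
have NFW : NF (pr hW) by exists 0, 1, 0, 0; rewrite rmorph0 rmorph1 mul1r !mul0r !addr0 add0r.
have NFV : NF (pr hV) by exists 0, 0, 1, 0; rewrite rmorph0 rmorph1 mul1r !mul0r !addr0 !add0r.
have NFU : NF (pr hU) by exists 0, 0, 0, 1; rewrite rmorph0 rmorph1 mul1r !mul0r !add0r.
have NFX : NF (pr hX) by rewrite -lX; apply: (NFL).
have NFY : NF (pr hY) by rewrite -lY; apply: (NFL).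
have NFZ : NF (pr hZ) by rewrite -lZ; apply: (NFL).
have NFC c : NF (pr c%:MP).
  by have := NFL c%:MP; rewrite /L /= evsC.
have NFN p : NF p -> NF (- p).
  by rewrite -mulN1r; apply: NFM; have := NFC (-1); rewrite mpolyCN !rmorphN !rmorph1.
have NF2 p : NF p -> NF (2%:R * p).
  by move=> hp; rewrite mulr_natl mulr2n; apply: NFD.
elim/mpoly_ring_ind: f => [c|i|p q hp hq|p q hp hq]; first exact: NFC.
- have -> : pr 'X_i = (tpt (pr hX) (pr hY) (pr hZ) (pr hU) (pr hV) (pr hW) D)`_i.
    rewrite -tE; case: i => -[|[|[|[|[|[|[|//]]]]]]] hi; congr (pr 'X__); apply: val_inj;
      by rewrite /= inordK.
  have NFB p q : NF p -> NF q -> NF (p - q) by move=> hp /NFN; apply: NFD.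
  rewrite d0; case: i => -[|[|[|[|[|[|[|//]]]]]]] hi /=; apply: NF2 => //; rewrite ?subr0;
    by do ?[apply: (NFB) | apply: (NFM)].
- by rewrite rmorphD; apply: NFD.
- by rewrite rmorphM; apply: NFM.
Qed.

End DiagonalPoints.

(** * Diagonal representations *)

Section DiagonalTraces.
Variable T : comNzRingType.
Implicit Types p q r x y z a b c j : T.

(* Traces of diag(p, p'), diag(q, q'), diag(r, r') and of their products. *)
Definition diag_traces p p' q q' r r' : seq T :=
  [:: p + p'; q + q'; r + r'; p * q + p' * q'; p * r + p' * r'; q * r + q' * r';
      p * q * r + p' * q' * r'].

Lemma diag_traces_tpt j x y z a b c : j ^+ 2 = -1 ->
  diag_traces (x + j * a) (x - j * a) (y + j * b) (y - j * b) (z + j * c) (z - j * c) =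
  tpt x y z (b * c) (a * c) (a * b) 0.
Proof.
move=> ej; rewrite /diag_traces /tpt; congr [:: _; _; _; _; _; _; _]; try by ring.
- by transitivity (2%:R * (x * y + j ^+ 2 * (a * b))); [ring | rewrite ej; ring].
- by transitivity (2%:R * (x * z + j ^+ 2 * (a * c))); [ring | rewrite ej; ring].
- by transitivity (2%:R * (y * z + j ^+ 2 * (b * c))); [ring | rewrite ej; ring].
- transitivity (2%:R * (x * y * z + j ^+ 2 * (x * (b * c) + y * (a * c) + z * (a * b)))); first by ring.
  by rewrite ej; ring.
Qed.

Lemma Ins_vanish x y z a b c h : x ^+ 2 + a ^+ 2 = 1 -> y ^+ 2 + b ^+ 2 = 1 -> z ^+ 2 + c ^+ 2 = 1 ->
  h \in app7 (@Insg T) (tpt x y z (b * c) (a * c) (a * b) 0) -> h = 0.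
Proof.
move=> /(canRL (addKr _)); rewrite addrC => ex /(canRL (addKr _)); rewrite addrC => ey.
move=> /(canRL (addKr _)); rewrite addrC => ez /Ins_tpt.
apply: (in_ideal_ker (phi := @idfun T)) => g; rewrite !inE /Nbc /Nac /Nab /Mab /Mac /Mbc -ex -ey -ez.
by case/or4P=> [/eqP->|/eqP->|/eqP->|/or4P[/eqP->|/eqP->|/eqP->|/eqP->]]; rewrite /=; ring.
Qed.

End DiagonalTraces.

Section NonSymmetricComponent.
Variable K : numClosedFieldType.
Implicit Types (x y z a b c p q r : K) (f : {mpoly K[7]}).
Local Notation P7K := {mpoly K[7]}.
Local Notation P3K := {mpoly K[3]}.

Definition diag_eval p q r : {rmorphism P7K -> K} :=
  evs (@idfun K) 7 (diag_traces p p^-1 q q^-1 r r^-1).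

Lemma diag_eval_tpt x y z a b c f : x ^+ 2 + a ^+ 2 = 1 -> y ^+ 2 + b ^+ 2 = 1 -> z ^+ 2 + c ^+ 2 = 1 ->
  exists p q r, [/\ p != 0, q != 0 & r != 0] /\
    diag_eval p q r f = evs (@idfun K) 7 (tpt x y z (b * c) (a * c) (a * b) 0) f.
Proof.
have key s t : s ^+ 2 + t ^+ 2 = 1 -> s + 'i * t != 0 /\ (s + 'i * t)^-1 = s - 'i * t.
  move=> e; have e1 : (s + 'i * t) * (s - 'i * t) = 1.
    by transitivity (s ^+ 2 - 'i ^+ 2 * t ^+ 2); [ring | rewrite sqrCi mulN1r opprK].
  have h : s + 'i * t != 0 by apply: contra_eqN e1 => /eqP ->; rewrite mul0r eq_sym oner_eq0.
  by split=> //; apply: (mulfI h); rewrite mulfV // e1.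
move=> /key[p0 p1] /key[q0 q1] /key[r0 r1].
exists (x + 'i * a), (y + 'i * b), (z + 'i * c); split=> //.
by rewrite /diag_eval p1 q1 r1 diag_traces_tpt // sqrCi.
Qed.

Lemma Ins_criterion f : (forall p q r, p != 0 -> q != 0 -> r != 0 -> diag_eval p q r f = 0) ->
  in_ideal (InsK K) f.
Proof.
move=> hf; have [f0 [f1 [f2 [f3 hn]]]] := Ins_normal_form f.
have n4 : 4%:R != 0 :> K by rewrite pnatr_eq0.
have e x y z a b c : x ^+ 2 + a ^+ 2 = 1 -> y ^+ 2 + b ^+ 2 = 1 -> z ^+ 2 + c ^+ 2 = 1 ->
   let E := evs (@idfun K) 3 [:: x; y; z] in
   E f0 + E f1 * (a * b) + E f2 * (a * c) + E f3 * (b * c) = 0.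
  move=> ea eb ec E; have [p [q [r [[p0 q0 r0] ev]]]] := diag_eval_tpt f ea eb ec.
  pose V := evs (@idfun K) 7 (tpt x y z (b * c) (a * c) (a * b) 0).
  have Vh : V (f - (evs (@mpolyC 7 K) 3 [:: hX K; hY K; hZ K] f0 +
      evs (@mpolyC 7 K) 3 [:: hX K; hY K; hZ K] f1 * hW K +
      evs (@mpolyC 7 K) 3 [:: hX K; hY K; hZ K] f2 * hV K +
      evs (@mpolyC 7 K) 3 [:: hX K; hY K; hZ K] f3 * hU K)) = 0.
    by apply: in_ideal_map0 hn => h; rewrite evs_InsK; apply: Ins_vanish.
  have half_mul s : inv2 K * (2%:R * s) = s by rewrite mulrA [inv2 K * _]mulrC two_inv2 mul1r.
  have [vX vY vZ] : [/\ V (hX K) = x, V (hY K) = y & V (hZ K) = z].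
    by split; rewrite rmorphM evsX // evsC /= half_mul.
  have [vW vV vU] : [/\ V (hW K) = a * b, V (hV K) = a * c & V (hU K) = b * c].
    split; rewrite rmorphB.
    + by rewrite (rmorphM V (hX K)) vX vY rmorphM evsX // evsC /= half_mul subKr.
    + by rewrite (rmorphM V (hX K)) vX vZ rmorphM evsX // evsC /= half_mul subKr.
    + by rewrite (rmorphM V (hY K)) vY vZ rmorphM evsX // evsC /= half_mul subKr.
  have vL g : V (evs (@mpolyC 7 K) 3 [:: hX K; hY K; hZ K] g) = E g.
    rewrite (evs_comp (@mpolyC 7 K) V) /E /= vX vY vZ; apply: evs_eq => k; exact: evsC.
  move: Vh; rewrite rmorphB !rmorphD !rmorphM !vL vW vV vU.
  have -> : V f = 0 by rewrite /V -ev hf.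
  by rewrite sub0r => /eqP; rewrite oppr_eq0 => /eqP.
pose d : P3K := (1 - 'X_(inord 0) ^+ 2) * (1 - 'X_(inord 1) ^+ 2) * (1 - 'X_(inord 2) ^+ 2).
have dE v : d.@[v] = (1 - v (inord 0) ^+ 2) * (1 - v (inord 1) ^+ 2) * (1 - v (inord 2) ^+ 2).
  by rewrite /d !(mevalM, mevalB, mevalXU, meval1) ?expr2.
have d0 : d != 0.
  apply/eqP => d0; have := dE (fun _ => 0); rewrite d0 meval0 expr0n subr0 !mulr1 => /esym/eqP.
  by rewrite oner_eq0.
have all0 v : d.@[v] != 0 -> [/\ f0.@[v] = 0, f1.@[v] = 0, f2.@[v] = 0 & f3.@[v] = 0].
  rewrite dE !mulf_eq0 !negb_or => /andP[/andP[x1 y1] z1].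
  pose sq (s : K) := sqrtC (1 - s ^+ 2).
  have rE s : s ^+ 2 + sq s ^+ 2 = 1 by rewrite /sq sqrtCK addrC subrK.
  have rN s : s ^+ 2 + (- sq s) ^+ 2 = 1 by rewrite sqrrN.
  have r0 s : 1 - s ^+ 2 != 0 -> sq s != 0 by rewrite /sq sqrtC_eq0.
  have ev g : evs (@idfun K) 3 [:: v (inord 0); v (inord 1); v (inord 2)] g = g.@[v].
    apply: (mpoly_rmorph_eq (psi := meval v)) => [k|i]; first by rewrite evsC /= mevalC.
    rewrite evsXi /= mevalXU; case: i => -[|[|[|//]]] hi; congr (v _); apply: val_inj;
      by rewrite /= inordK.
  have a0 := r0 _ x1; have b0 := r0 _ y1; have c0 := r0 _ z1.
  (* Changing the sign of one of the three square roots changes the signs of two of ab, ac, bc; the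
     four resulting equations isolate each coefficient, up to the factor 4. *)
  have := e _ _ _ _ _ _ (rN (v (inord 0))) (rE (v (inord 1))) (rE (v (inord 2))).
  have := e _ _ _ _ _ _ (rE (v (inord 0))) (rN (v (inord 1))) (rE (v (inord 2))).
  have := e _ _ _ _ _ _ (rE (v (inord 0))) (rE (v (inord 1))) (rN (v (inord 2))).
  have := e _ _ _ _ _ _ (rE (v (inord 0))) (rE (v (inord 1))) (rE (v (inord 2))).
  rewrite /= !ev; move: (sq (v (inord 0))) (sq (v (inord 1))) (sq (v (inord 2))) a0 b0 c0 => a b c a0 b0 c0.
  move: f0.@[v] f1.@[v] f2.@[v] f3.@[v] => g0 g1 g2 g3 e0 e1 e2 e3.
  have z4 (s t : K) : t != 0 -> 4%:R * (s * t) = 0 -> s = 0.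
    by move=> t0 /eqP; rewrite !mulf_eq0 (negbTE n4) (negbTE t0) orbF => /eqP.
  have s0 (s1 s2 s3 s4 s5 : K) : s1 = 0 -> s2 = 0 -> s3 = 0 -> s4 = 0 ->
      s5 = s1 + s2 + (s3 + s4) \/ s5 = s1 + s2 - (s3 + s4) -> s5 = 0.
    by move=> -> -> -> -> []->; rewrite !addr0 ?subr0.
  split; [apply: (z4 _ 1 (oner_neq0 _)) | apply: (z4 _ (a * b)) | apply: (z4 _ (a * c))
    | apply: (z4 _ (b * c))]; rewrite ?mulf_neq0 //.
  - by apply: (s0 _ _ _ _ _ e0 e1 e2 e3); left; ring.
  - by apply: (s0 _ _ _ _ _ e0 e1 e2 e3); right; ring.
  - by apply: (s0 _ _ _ _ _ e0 e2 e1 e3); right; ring.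
  - by apply: (s0 _ _ _ _ _ e0 e3 e1 e2); right; ring.
have z g : (forall v, d.@[v] != 0 -> g.@[v] = 0) -> g = 0 by apply: mpoly_eq0_generic d0.
have [f00 f10] : f0 = 0 /\ f1 = 0 by split; apply: (z) => v /all0[].
have [f20 f30] : f2 = 0 /\ f3 = 0 by split; apply: (z) => v /all0[].
rewrite f00 f10 f20 f30 in hn; move: hn.
by rewrite (rmorph0 (evs (@mpolyC 7 K) 3 _)) !mul0r !addr0 subr0.
Qed.

(** On the diagonal torus f is a Laurent polynomial; each trace has at most a simple pole in each of
    p, q, r, so a power of pqr clears the denominators. *)
Lemma diag_eval_prod f : exists n (N : P3K), forall p q r, p != 0 -> q != 0 -> r != 0 ->
  evs (@idfun K) 3 [:: p; q; r] N = (p * q * r) ^+ n * diag_eval p q r f.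
Proof.
elim/mpoly_ring_ind: f => [c|i|f g [n [N hN]] [m [M hM]]|f g [n [N hN]] [m [M hM]]].
- by exists 0, c%:MP => p q r _ _ _; rewrite mul1r /diag_eval !evsC.
- pose x : P3K := 'X_(inord 0); pose y : P3K := 'X_(inord 1); pose z : P3K := 'X_(inord 2).
  exists 1, [:: x * y * z * x + y * z; x * y * z * y + x * z; x * y * z * z + x * y;
    x * y * z * (x * y) + z; x * y * z * (x * z) + y; x * y * z * (y * z) + x;
    x * y * z * (x * y * z) + 1]`_i => p q r p0 q0 r0.
  rewrite /diag_eval evsXi expr1 -(rmorph_nth (evs (@idfun K) 3 [:: p; q; r])) /=.
  rewrite !(rmorphD, rmorphM, rmorph1) !evsX // [_`_0]/= [_`_1]/= [_`_2]/=.
  by case: i => -[|[|[|[|[|[|[|//]]]]]]] hi /=; field; rewrite ?p0 ?q0 ?r0.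
- exists (n + m)%N, (N * ('X_(inord 0) * 'X_(inord 1) * 'X_(inord 2)) ^+ m +
    M * ('X_(inord 0) * 'X_(inord 1) * 'X_(inord 2)) ^+ n) => p q r p0 q0 r0.
  rewrite rmorphD !rmorphM !rmorphXn !rmorphM !evsX //= hN // hM // rmorphD exprD.
  move: (p * q * r) => t; ring.
- exists (n + m)%N, (N * M) => p q r p0 q0 r0.
  by rewrite !rmorphM hN // hM // exprD; ring.
Qed.

(** I_ns is the kernel of restriction to the diagonal torus, whose functions form a domain;
    primeness is read off from the numerators. *)
Lemma InsK_prime : prime_ideal (InsK K).
Proof.
have sub f p q r : p != 0 -> q != 0 -> r != 0 -> in_ideal (InsK K) f -> diag_eval p q r f = 0.
  move=> p0 q0 r0; apply: in_ideal_map0 => h; rewrite evs_InsK /=.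
  have n2 : 2%:R != 0 :> K by rewrite pnatr_eq0.
  (* Cosine and sine of an eigenvalue s: s = x + i a and s^-1 = x - i a, which brings diagonal
     traces into Gram form. *)
  pose x s : K := (s + s^-1) / 2%:R; pose a s : K := (s - s^-1) / 2%:R / 'i.
  have xa s : s != 0 -> [/\ x s ^+ 2 + a s ^+ 2 = 1, x s + 'i * a s = s & x s - 'i * a s = s^-1].
    move=> s0; have ia : 'i * a s = (s - s^-1) / 2%:R by rewrite /a mulrC divfK ?neq0Ci.
    rewrite ia; split; [| by rewrite /x; field; rewrite s0 | by rewrite /x; field; rewrite s0].
    have -> : a s ^+ 2 = - ('i * a s) ^+ 2 by rewrite [('i * _) ^+ 2]exprMn sqrCi mulN1r opprK.
    by rewrite ia /x; field; rewrite s0.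
  have [e1 e2 e3] := xa p p0; have [e4 e5 e6] := xa q q0; have [e7 e8 e9] := xa r r0.
  have := @diag_traces_tpt K 'i (x p) (x q) (x r) (a p) (a q) (a r) (sqrCi K).
  rewrite e2 e3 e5 e6 e8 e9 => ->; exact: Ins_vanish.
split=> [/(sub 1 1 1 1)|f g fg].
  by rewrite rmorph1 oner_neq0 => /(_ isT isT isT) /eqP; rewrite oner_eq0.
have [n [N hN]] := diag_eval_prod f; have [m [M hM]] := diag_eval_prod g.
pose d : P3K := 'X_(inord 0) * 'X_(inord 1) * 'X_(inord 2).
have ev (h : P3K) v : h.@[v] = evs (@idfun K) 3 [:: v (inord 0); v (inord 1); v (inord 2)] h.
  apply: (mpoly_rmorph_eq (phi := meval v)) => [k|i]; first by rewrite evsC /= mevalC.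
  rewrite evsXi /= mevalXU; case: i => -[|[|[|//]]] hi; congr (v _); apply: val_inj;
    by rewrite /= inordK.
have d0 : d != 0.
  apply/eqP => e; have := ev d (fun _ => 1); rewrite [in X in X = _]e meval0 !rmorphM !evsX //= !mul1r.
  by move=> /esym/eqP; rewrite oner_eq0.
have : N * M = 0.
  apply: (mpoly_eq0_generic d0) => v; rewrite mevalM !ev !rmorphM !evsX //= !mulf_eq0 !negb_or.
  move=> /andP[/andP[p0 q0] r0]; rewrite hN // hM // mulrACA -rmorphM (sub (f * g)) ?mulr0 //.
have fin h k (L : P3K) : L = 0 -> (forall p q r, p != 0 -> q != 0 -> r != 0 ->
    evs (@idfun K) 3 [:: p; q; r] L = (p * q * r) ^+ k * diag_eval p q r h) -> in_ideal (InsK K) h.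
  move=> -> hL; apply: Ins_criterion => p q r p0 q0 r0; have := hL p q r p0 q0 r0.
  by rewrite rmorph0 => /esym/eqP; rewrite mulf_eq0 expf_eq0 !mulf_eq0 (negbTE p0) (negbTE q0)
    (negbTE r0) andbF => /eqP.
by move/eqP; rewrite mulf_eq0 => /orP[] /eqP e; [left; apply: fin e hN | right; apply: fin e hM].
Qed.


End NonSymmetricComponent.

(** * The eight components *)

Lemma diag_rep (K : fieldType) (p q r : K) (D := fun t : K => mx2 t 0 0 t^-1) :
  p != 0 -> q != 0 -> r != 0 ->
  bor_rep (D p) (D q) (D r) /\
  trseq (D p) (D q) (D r) = diag_traces p p^-1 q q^-1 r r^-1.
Proof.
move=> p0 q0 r0; split; last first.
  by rewrite /trseq /diag_traces /D !mx2E; congr [:: _; _; _; _; _; _; _]; ring.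
split; split; rewrite /innerX /D !mx2E ?mulr0 ?subr0 ?mulfV //; congr mx2; ring.
Qed.

Lemma Ins_forward (R : realType) (f : P7 R) : in_ideal (Jbor R) (tau f) -> in_ideal (Ins R) f.
Proof.
move=> hf; have : in_ideal (InsK _) f; last by exact.
apply: Ins_criterion => p q r p0 q0 r0; have [rep tr] := diag_rep p0 q0 r0.
by have := tau_of_rep rep hf; rewrite tr.
Qed.

Lemma Ins_prime (R : realType) : prime_ideal (Ins R).
Proof. exact: InsK_prime. Qed.

(** * Incomparability of the eight ideals *)

Section Incomparability.

Definition component_gens (T : comNzRingType) (s : seq T) : seq (seq T) :=
  [:: app7 (@Insg T) s; app7 (Iag 1) s; app7 (Iag (-1)) s;
      app7 (fun a b c ab ac bc => Iag 1 b a c ab bc ac) s;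
      app7 (fun a b c ab ac bc => Iag (-1) b a c ab bc ac) s;
      app7 (fun a b c ab ac bc => Iag 1 c a b ac bc ab) s;
      app7 (fun a b c ab ac bc => Iag (-1) c a b ac bc ab) s;
      app7 (@I0g T) s].

(** One integral point on each component and on no other, so that incomparability is decided by
    computation. The first is the character of a = b = c = diag(i, -i), the last has the traces of
    the quaternions i, j, -k, and the other six have free parameters 3, 5, 7. *)
Definition component_points : seq (seq int) :=
  [:: [:: 0; 0; 0; -2; -2; -2; 0];
      lqa 1 3 5 7; lqa (-1) 3 5 7; lqb 1 3 5 7; lqb (-1) 3 5 7; lqc 1 3 5 7; lqc (-1) 3 5 7;
      [:: 0; 0; 0; 0; 0; 0; 2]].

Lemma component_points_table :
  all (fun l => all (fun k =>
    all (eq_op^~ 0) (nth [::] (component_gens (nth [::] component_points l)) k) == (k == l))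
    (iota 0 8)) (iota 0 8).
Proof. by vm_compute. Qed.

Lemma rmorph_component_gens (T U : comNzRingType) (phi : {rmorphism T -> U}) s k :
  map phi (nth [::] (component_gens s) k) = nth [::] (component_gens (map phi s)) k.
Proof.
have e1 : phi (-1) = -1 by rewrite rmorphN1.
have [e2 nE] := (rmorph1 phi, rmorph_nth phi s).
case: k => [|[|[|[|[|[|[|[|[|k]]]]]]]]] //; apply: etrans (_ : map phi (app7 _ s) = app7 _ (map phi s)) => //;
  rewrite /app7 ?map_Insg ?map_Iag ?map_I0g ?e1 ?e2 !nE //.
Qed.

Variable R : realType.
Local Notation K := (CC R).

Lemma evs_Ik (s : seq K) (k : 'I_8) :
  map (evs (@idfun K) 7 s) (Ik R k) = nth [::] (component_gens s) k.
Proof.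
case: k => -[|[|[|[|[|[|[|[|//]]]]]]]] hk; rewrite /Ik /eight /component_gens /=.
- exact: evs_Ins.
- exact: (evs_Ia _ s true).
- exact: (evs_Ia _ s false).
- exact: (evs_Ib _ s true).
- exact: (evs_Ib _ s false).
- exact: (evs_Ic _ s true).
- exact: (evs_Ic _ s false).
- exact: evs_I0.
Qed.

Lemma Ik_incomparable (k l : 'I_8) : k != l -> ~ ideal_sub (Ik R k) (Ik R l).
Proof.
move=> ne_kl sub; pose s : seq K := map intr (nth [::] component_points l).
have vals (j : 'I_8) : map (evs (@idfun K) 7 s) (Ik R j) =
    map intr (nth [::] (component_gens (nth [::] component_points l)) j).
  by rewrite evs_Ik /s -(rmorph_component_gens (intr : {rmorphism int -> K})).
have tab (j : 'I_8) : all (eq_op^~ 0) (nth [::] (component_gens (nth [::] component_points l)) j)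
    = (j == l).
  have mem (i : 'I_8) : val i \in iota 0 8 by rewrite mem_iota add0n /=.
  by move: component_points_table => /allP/(_ _ (mem l))/allP/(_ _ (mem j))/eqP.
have kill f : in_ideal (Ik R l) f -> evs (@idfun K) 7 s f = 0.
  apply: in_ideal_map0 => h; rewrite vals => /mapP[z zin ->].
  by have := tab l; rewrite eqxx => /allP/(_ _ zin)/eqP ->; rewrite rmorph0.
have := tab k; rewrite (negbTE ne_kl) => /negP; apply; apply/allP => z zin.
have : intr z \in map (evs (@idfun K) 7 s) (Ik R k) by rewrite vals map_f.
move=> /mapP[g gin e]; have := kill g (sub g (in_ideal_gen gin)); rewrite -e => /eqP.
by rewrite intr_eq0.
Qed.

End Incomparability.

(** * Primeness, kernel and reducedness combined *)

Section Assembly.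
Variable R : realType.
Local Notation K := (CC R).

Lemma Ik_prime (k : 'I_8) : prime_ideal (Ik R k).
Proof.
have aff I lq sec : @affine_data R I lq sec -> prime_ideal I.
  by case=> [_ h2 h3]; apply: affine_prime h2 h3.
case: k => -[|[|[|[|[|[|[|[|//]]]]]]]] hk; rewrite /Ik /eight /=.
- exact: Ins_prime.
- exact: aff (Ia_data R true).
- exact: aff (Ia_data R false).
- exact: aff (Ib_data R true).
- exact: aff (Ib_data R false).
- exact: aff (Ic_data R true).
- exact: aff (Ic_data R false).
- exact: I0_prime.
Qed.

Lemma kernel_forward (f : P7 R) : in_ideal (Jbor R) (tau f) -> in_IBor f.
Proof.
move=> hf; have [hat hbt hct] := Iabc_forward true hf.
have [haf hbf hcf] := Iabc_forward false hf.
case=> -[|[|[|[|[|[|[|[|//]]]]]]]] hk; rewrite /Ik /eight /=.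
- exact: Ins_forward.
- exact: hat.
- exact: haf.
- exact: hbt.
- exact: hbf.
- exact: hct.
- exact: hcf.
- exact: I0_forward.
Qed.

Lemma Ik_affine (k : 'I_8) : (0 < val k < 7)%N -> exists lq : 7.-tuple (P3 R),
  (forall h : P3 R, exists f : P7 R, f \mPo lq = h) /\
  (forall f : P7 R, f \mPo lq = 0 <-> in_ideal (Ik R k) f).
Proof.
case: k => -[|[|[|[|[|[|[|[|//]]]]]]]] hk //= _; rewrite /Ik /eight /=.
- exact: affine_iso (Ia_data R true).
- exact: affine_iso (Ia_data R false).
- exact: affine_iso (Ib_data R true).
- exact: affine_iso (Ib_data R false).
- exact: affine_iso (Ic_data R true).
- exact: affine_iso (Ic_data R false).
Qed.

Lemma in_ideal_exp_cong (T : comNzRingType) (gs : seq T) p q n : in_ideal gs (p - q) ->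
  in_ideal gs (p ^+ n) <-> in_ideal gs (q ^+ n).
Proof.
move=> h; have key : in_ideal gs (p ^+ n - q ^+ n).
  by rewrite subrXX mulrC; apply: in_idealM.
split=> hh; first by rewrite -[_ ^+ _](subKr (p ^+ n)); apply: in_idealB.
by rewrite -[_ ^+ _](subrK (q ^+ n)); apply: in_idealD.
Qed.

Lemma trace_ring_reduced (p : P12 R) n : Binv p -> in_ideal (Jbor R) (p ^+ n) ->
  in_ideal (Jbor R) p.
Proof.
move=> hp hn; have [f hf] := trace_surjective hp.
have hfn : in_ideal (Jbor R) (tau (f ^+ n)).
  apply: eq_ind (proj1 (in_ideal_exp_cong n hf) hn) _ _.
  by apply: esym; exact: (rmorphXn (tauh R) n f).
have hk : in_IBor f.
  by move=> k; apply: (in_ideal_prime_exp (n := n) (Ik_prime k)); exact: kernel_forward hfn k.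
have e := in_ideal_exp_cong 1 hf; rewrite !expr1 in e; apply/e; exact: kernel_reverse.
Qed.

End Assembly.

Theorem mainTheorem17 (R : realType) :
  (* the trace map lands in B(Γ_Bor) *)
  (forall f : P7 R, Binv (tau f)) /\
  (* it is surjective onto B(Γ_Bor) *)
  (forall p : P12 R, Binv p -> exists f : P7 R, in_ideal (Jbor R) (p - tau f)) /\
  (* its kernel is I_Bor = I_ns ∩ I_a^+ ∩ I_a^- ∩ I_b^+ ∩ I_b^- ∩ I_c^+ ∩ I_c^- ∩ I_0 *)
  (forall f : P7 R, in_ideal (Jbor R) (tau f) <-> in_IBor f) /\
  (* B(Γ_Bor) is reduced *)
  (forall (p : P12 R) (n : nat), Binv p ->
      in_ideal (Jbor R) (p ^+ n) -> in_ideal (Jbor R) p) /\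
  (* the eight ideals are prime *)
  (forall k : 'I_8, prime_ideal (Ik R k)) /\
  (* and pairwise incomparable: exactly eight irreducible components *)
  (forall k l : 'I_8, k != l -> ~ ideal_sub (Ik R k) (Ik R l)) /\
  (* X_a^±, X_b^±, X_c^± are isomorphic to C^3 *)
  (forall k : 'I_8, (0 < val k < 7)%N ->
     exists lq : 7.-tuple (P3 R),
       (forall h : P3 R, exists f : P7 R, f \mPo lq = h) /\
       (forall f : P7 R, f \mPo lq = 0 <-> in_ideal (Ik R k) f)).
Proof.
split; first exact: trace_invariant.
split; first exact: trace_surjective.
split; first by move=> f; split; [exact: kernel_forward | exact: kernel_reverse].
split; first exact: trace_ring_reduced.
split; first exact: Ik_prime.
split; first exact: Ik_incomparable.
exact: Ik_affine.
Qed.
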